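(* Let $m_i$ $(i\in\Gamma=\{1,\dots,\ell\})$ be positive integers, let $\mathcal M$ be the space of meromorphic functions in the variables $\{\gamma_{i,k}: i\in\Gamma,\ 1\le k\le m_i\}$, let $P_i(u)=\prod_{p=1}^{m_i}(u-\gamma_{i,p})$, and let $\beta_{i,k}=e^{\frac{\imath\hbar}{2}(\alpha_i,\alpha_i)\partial_{\gamma_{i,k}}}$ be the operator on $\mathcal M$ shifting $\gamma_{i,k}$ to $\gamma_{i,k}+\frac{\imath\hbar}{2}(\alpha_i,\alpha_i)$. For rational functions $R_i(u)$ (with constant coefficients) consider the operators on $\mathcal M$ $$H_i(u)=R_i(u)\,\frac{\prod_{s\ne i}\prod_{r=1}^{-a_{si}}P_s\big(u-\frac{\imath\hbar}{2}(\alpha_i+r\alpha_s,\alpha_s)\big)}{P_i(u)\,P_i\big(u-\frac{\imath\hbar}{2}(\alpha_i,\alpha_i)\big)},$$ $$E_i(u)=d_i^{-1/2}\sum_{k=1}^{m_i}\frac{\prod_{s=i+1}^{\ell}\prod_{r=1}^{-a_{si}}P_s\big(\gamma_{i,k}-\frac{\imath\hbar}{2}(\alpha_i+r\alpha_s,\alpha_s)\big)}{(u-\gamma_{i,k})\prod_{p\ne k}(\gamma_{i,k}-\gamma_{i,p})}\,\beta_{i,k}^{-1},$$ $$F_i(u)=-d_i^{-1/2}\sum_{k=1}^{m_i}R_i\big(\gamma_{i,k}+\tfrac{\imath\hbar}{2}(\alpha_i,\alpha_i)\big)\,\frac{\prod_{s=1}^{i-1}\prod_{r=1}^{-a_{si}}P_s\big(\gamma_{i,k}-\frac{\imath\hbar}{2}(\alpha_i+r\alpha_s,\alpha_s)+\frac{\imath\hbar}{2}(\alpha_i,\alpha_i)\big)}{\big(u-\gamma_{i,k}-\frac{\imath\hbar}{2}(\alpha_i,\alpha_i)\big)\prod_{p\ne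 k}(\gamma_{i,k}-\gamma_{i,p})}\,\beta_{i,k}.$$ (i) Suppose $l_i:=\sum_{j=1}^{\ell}m_ja_{ji}\ge 0$ for all $i\in\Gamma$, let $\{\nu_{i,k}: i\in\Gamma,\ 1\le k\le l_i\}$ be arbitrary complex parameters, and put $R_i(u)=\prod_{k=1}^{l_i}(u-\nu_{i,k})$. Then the operators $H_i(u),E_i(u),F_i(u)$, $i\in\Gamma$, considered as formal power series in $u^{-1}$, form a representation of $Y(\mathfrak g)$ in the space $\mathcal M$. (ii) Let the $m_i$ be arbitrary, let $l_i^{\pm}$ be non-negative integers with $l_i^+-l_i^-=\sum_{j=1}^{\ell}m_ja_{ji}$, let $\{\nu^{\pm}_{i,k}: i\in\Gamma,\ 1\le k\le l_i^{\pm}\}$ be arbitrary complex parameters, and put $$R_i(u)=\frac{\prod_{k=1}^{l_i^+}(u-\nu^+_{i,k})}{\prod_{k=1}^{l_i^-}(u-\nu^-_{i,k})}.$$ Then the operators $H_i(u),E_i(u)$, $i\in\Gamma$, considered as formal power series in $u^{-1}$, form a representation of $Y(\mathfrak b)$ in the space $\mathcal M$.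
   Context: $\mathfrak g$ is a simple finite-dimensional complex Lie algebra of rank $\ell$ with Cartan subalgebra $\mathfrak h$ and Borel subalgebra $\mathfrak b\supset\mathfrak h$; $\Gamma=\{1,\dots,\ell\}$ is the set of vertices of the Dynkin diagram, $\alpha_i$ the simple roots, $\alpha_i^\vee$ the coroots, $a_{ij}=\alpha_i^\vee(\alpha_j)$ the Cartan matrix. Positive integers $d_1,\dots,d_\ell$ are such that $\|d_ia_{ij}\|$ is symmetric, and the bilinear form on $\mathfrak h^*$ is $(\alpha_i,\alpha_j)=d_ia_{ij}$; thus $a_{ij}=2(\alpha_i,\alpha_j)/(\alpha_i,\alpha_i)$ and $d_i=(\alpha_i,\alpha_i)/2$. $\imath=\sqrt{-1}$, and $\hbar$ is a fixed nonzero complex parameter. Empty products equal $1$. The Yangian $Y(\mathfrak g)$ is the associative unital algebra with generators $H_i^{(s)},E_i^{(s)},F_i^{(s)}$ ($i\in\Gamma$, $s=0,1,\dots$), collected in $$H_i(u)=1+\sum_{s\ge0}H_i^{(s)}u^{-s-1},\quad E_i(u)=\sum_{s\ge0}E_i^{(s)}u^{-s-1},\quad F_i(u)=\sum_{s\ge0}F_i^{(s)}u^{-s-1},$$ and the following defining relations, where $[a,b]_+=ab+ba$: - $[H_i(u),H_j(v)]=0$; - $[H_i(u),E_j(v)]=-\frac{\imath\hbar}{2}(\alpha_i,\alpha_j)\frac{[H_i(u),\,E_j(u)-E_j(v)]_+}{u-v}$ and $[H_i(u),F_j(v)]=\frac{\imath\hbar}{2}(\alpha_i,\alpha_j)\frac{[H_i(u),\,F_j(u)-F_j(v)]_+}{u-v}$;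 - $[E_i(u),F_j(v)]=-\imath\hbar\,\delta_{i,j}\frac{H_i(u)-H_i(v)}{u-v}$; - $[E_i(u),E_i(v)]=-\frac{\imath\hbar}{2}(\alpha_i,\alpha_i)\frac{(E_i(u)-E_i(v))^2}{u-v}$ and $[F_i(u),F_i(v)]=\frac{\imath\hbar}{2}(\alpha_i,\alpha_i)\frac{(F_i(u)-F_i(v))^2}{u-v}$; - for $i\ne j$, $a_{ij}\ne0$: $[E_i(u),E_j(v)]=-\frac{\imath\hbar}{2}(\alpha_i,\alpha_j)\frac{[E_i(u),\,E_j(u)-E_j(v)]_+}{u-v}-\frac{[E_i^{(0)},\,E_j(u)-E_j(v)]}{u-v}$ and $[F_i(u),F_j(v)]=\frac{\imath\hbar}{2}(\alpha_i,\alpha_j)\frac{[F_i(u),\,F_j(u)-F_j(v)]_+}{u-v}-\frac{[F_i^{(0)},\,F_j(u)-F_j(v)]}{u-v}$; - for $i\ne j$, $n=1-a_{ij}$: $\sum_{\sigma\in\mathfrak S_n}[E_i(u_{\sigma(1)}),[E_i(u_{\sigma(2)}),\dots,[E_i(u_{\sigma(n)}),E_j(v)]\dots]]=0$, and the same with $F$ in place of $E$. $Y(\mathfrak b)\subset Y(\mathfrak g)$ is the subalgebra generated by the coefficients of $H_i(u),E_i(u)$, $i\in\Gamma$. ''The operators form a representation'' means that the assignment sending the generators $H_i^{(s)},E_i^{(s)}$ (and $F_i^{(s)}$) to the coefficients of the expansions of the given operators in powers of $u^{-1}$ extends to an algebra homomorphism from $Y(\mathfrak g)$ (resp. $Y(\mathfrak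 b)$) to operators on $\mathcal M$. *)

(* Defs.v *)
From HB Require Import structures.
From mathcomp Require Import all_boot all_order all_algebra perm.
From mathcomp Require Import complex.
From mathcomp Require Import all_classical all_reals all_analysis.
From mathcomp.multinomials Require Import -(notations) monalg.

Set Implicit Arguments.
Unset Strict Implicit.
Unset Printing Implicit Defensive.

Import Order.TTheory GRing.Theory Num.Theory.
Import numFieldNormedType.Exports.

Local Open Scope classical_set_scope.
Local Open Scope quotient_scope.
Local Open Scope ring_scope.

Section MeromorphicRepresentatives.
Variables (C : numClosedFieldType) (n : nat).
Implicit Types (f g h : 'rV[C]_n -> C) (x y v : 'rV[C]_n).

Definition holomorphic_at f x := \forall y \near x, differentiable f y.

(* Pointwise representatives of meromorphic functions: locally quotients of
   holomorphic functions, with arbitrary values where the denominator vanishes.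
   The third condition says that [h] vanishes identically on no nonempty open
   subset of some neighbourhood of [x], i.e. is locally not a zero divisor. *)
Definition meromorphic f := forall x, exists g h,
  [/\ holomorphic_at g x, holomorphic_at h x,
      \forall y \near x, closure [set z | h z != 0] y
    & \forall y \near x, h y != 0 -> f y = g y / h y].

Lemma closure_neq0M x g h : holomorphic_at g x ->
  (\forall y \near x, closure [set z | g z != 0] y) ->
  (\forall y \near x, closure [set z | h z != 0] y) ->
  \forall y \near x, closure [set z | g z * h z != 0] y.
Proof.
move=> /near_join hg cg /near_join ch; near=> y.
have hgy : \forall z \near y, differentiable g z by near: y.
have chy : \forall z \near y, closure [set w | h w != 0] z by near: y.
have cgy : closure [set z | g z != 0] y by near: y.
move=> B yB.
have [z [/= gz0 [[dz cz] Bz]]] : [set z | g z != 0] `&`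
    ([set z | differentiable g z] `&` [set z | closure [set w | h w != 0] z]
     `&` B^°) !=set0.
  by apply: cgy; do 2?apply: filterI => //; exact/nbhs_interior.
have gzn : \forall w \near z, g w != 0.
  exact: (cvgr_neq0 _ (differentiable_continuous dz)).
have [w [/= hw [gw Bw]]] := cz _ (filterI gzn Bz).
by exists w; split=> //=; rewrite mulf_neq0.
Unshelve. all: by end_near.
Qed.

Lemma holomorphic_meromorphic f : (forall x, differentiable f x) ->
  meromorphic f.
Proof.
move=> df x; exists f, (cst 1); split; near=> y => //.
- by apply: subset_closure => /=; exact: oner_neq0.
- by move=> _; rewrite divr1.
Unshelve. all: by end_near.
Qed.

Lemma meromorphicM f1 f2 : meromorphic f1 -> meromorphic f2 ->
  meromorphic (f1 * f2).
Proof.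
move=> m1 m2 x; have [g1 [h1 [dg1 dh1 c1 e1]]] := m1 x.
have [g2 [h2 [dg2 dh2 c2 e2]]] := m2 x.
exists (g1 * g2), (h1 * h2); split; rewrite /holomorphic_at.
- by near=> y; apply: differentiableM; near: y.
- by near=> y; apply: differentiableM; near: y.
- exact: closure_neq0M.
- near=> y => /=; suff: h1 y * h2 y != 0 ->
    f1 y * f2 y = g1 y * g2 y / (h1 y * h2 y) by [].
  rewrite mulf_eq0 negb_or => /andP[h1y h2y].
  have -> : f1 y = g1 y / h1 y by move: h1y; near: y.
  have -> : f2 y = g2 y / h2 y by move: h2y; near: y.
  by rewrite mulf_div.
Unshelve. all: by end_near.
Qed.

Lemma meromorphicB f1 f2 : meromorphic f1 -> meromorphic f2 ->
  meromorphic (f1 - f2).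
Proof.
move=> m1 m2 x; have [g1 [h1 [dg1 dh1 c1 e1]]] := m1 x.
have [g2 [h2 [dg2 dh2 c2 e2]]] := m2 x.
exists (g1 * h2 - g2 * h1), (h1 * h2); split; rewrite /holomorphic_at.
- by near=> y; apply: differentiableB; apply: differentiableM; near: y.
- by near=> y; apply: differentiableM; near: y.
- exact: closure_neq0M.
- near=> y; suff: h1 y * h2 y != 0 ->
    f1 y - f2 y = (g1 y * h2 y - g2 y * h1 y) / (h1 y * h2 y) by [].
  rewrite mulf_eq0 negb_or => /andP[h1y h2y].
  have -> : f1 y = g1 y / h1 y by move: h1y; near: y.
  have -> : f2 y = g2 y / h2 y by move: h2y; near: y.
  by rewrite -mulNr addf_div // mulNr.
Unshelve. all: by end_near.
Qed.

Definition translate v f : 'rV[C]_n -> C := fun x => f (x + v).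

Lemma near_translate (P : 'rV[C]_n -> Prop) x v :
  (\forall y \near x + v, P y) -> \forall y \near x, P (y + v).
Proof. exact: (cvgD cvg_id (cvg_cst v)). Qed.

Lemma meromorphic_translate v f : meromorphic f -> meromorphic (translate v f).
Proof.
move=> m x; have [g [h [dg dh c e]]] := m (x + v).
have dtr k y : differentiable k (y + v) -> differentiable (translate v k) y.
  move=> dk; apply: (@differentiable_comp _ _ _ _ (fun z => z + v) k) => //.
exists (translate v g), (translate v h); split.
- by have := near_translate dg; apply: filterS => y; exact: dtr.
- by have := near_translate dh; apply: filterS => y; exact: dtr.
- have := near_translate c; apply: filterS => y cy B yB.
  have : \forall z \near y + v, B (z - v).
    by apply: near_translate; rewrite addrK.
  by move=> /cy[z [/= hz Bz]]; exists (z - v); split=> //=; rewrite /translate subrK.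
- exact: (near_translate e).
Qed.

Definition negligible f := dense [set x | f x = 0]^°.

Lemma negligibleS f g : (forall x, f x = 0 -> g x = 0) ->
  negligible f -> negligible g.
Proof.
move=> fg nf O O0 oO; have [x [Ox fx]] := nf O O0 oO.
by exists x; split=> //; move: fx; apply: interiorS => y; exact: fg.
Qed.

Lemma negligible_closedB f g : negligible f -> negligible g ->
  negligible (f - g).
Proof.
move=> nf ng; have : dense ([set x | f x = 0]^° `&` [set x | g x = 0]^°).
  by apply: denseI => //; exact: open_interior.
rewrite -interiorI => nI O O0 oO; have [x [Ox Ix]] := nI O O0 oO.
exists x; split=> //; move: Ix; apply: interiorS => y [/= fy gy].
by suff: f y - g y = 0 by []; rewrite fy gy subr0.
Qed.

Lemma negligible0 : negligible 0.
Proof. by move=> O [x Ox] _; exists x; split=> //; exact: filterE. Qed.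

Lemma negligible1 : ~ negligible 1.
Proof.
move=> /(_ setT)[||x [_ /nbhs_singleton/eqP]]; [|exact: openT|].
  by exists 0.
by apply/negP; exact: oner_neq0.
Qed.

Lemma negligible_translate v f : negligible f -> negligible (translate v f).
Proof.
move=> nf O [z Oz] oO.
have [||x [Ox fx]] := nf [set y | O (y - v)].
- by exists (z + v); rewrite /= addrK.
- by rewrite openE => y /= Oy; apply: near_translate; exact: open_nbhs_nbhs.
- exists (x - v); split=> //; rewrite /interior /=.
  have : nbhs (x - v + v) [set x | f x = 0] by rewrite subrK.
  exact: near_translate.
Qed.

End MeromorphicRepresentatives.

Section MeromorphicField.
Variables (C : numClosedFieldType) (n : nat).
Local Notation V := 'rV[C]_n.

Definition mero_pred : {pred V -> C} := fun f => `[< meromorphic f >].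

Lemma meroP f : reflect (meromorphic f) (f \in mero_pred).
Proof. exact: asboolP. Qed.

Fact meromorphic_subring_closed : subring_closed mero_pred.
Proof.
split=> [|f g /meroP mf /meroP mg|f g /meroP mf /meroP mg]; apply/meroP.
- by apply: holomorphic_meromorphic => x; exact: differentiable_cst.
- exact: meromorphicB.
- exact: meromorphicM.
Qed.

HB.instance Definition _ :=
  GRing.isSubringClosed.Build (V -> C) mero_pred
    meromorphic_subring_closed.

Record mero_fun := MeroFun {
  mero_val :> V -> C;
  mero_valP : mero_val \in mero_pred
}.

HB.instance Definition _ := [isSub for mero_val].
HB.instance Definition _ := [Choice of mero_fun by <:].
HB.instance Definition _ := [SubChoice_isSubComNzRing of mero_fun by <:].

Definition negligible_pred : {pred mero_fun} := fun f => `[< negligible f >].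

Fact negligible_idealr_closed : idealr_closed negligible_pred.
Proof.
split; first exact/asboolP/negligible0.
  by apply/negP => /asboolP; exact: negligible1.
move=> a u v /asboolP nu /asboolP nv; apply/asboolP.
have nNau : negligible (- (mero_val a * mero_val u)).
  apply: negligibleS nu => x ux; suff: - (mero_val a x * mero_val u x) = 0 by [].
  by rewrite ux mulr0 oppr0.
apply: negligibleS (negligible_closedB nv nNau) => x.
suff: mero_val v x - - (mero_val a x * mero_val u x) = 0 ->
  mero_val a x * mero_val u x + mero_val v x = 0 by [].
by rewrite opprK addrC.
Qed.

HB.instance Definition _ := isIdealr.Build mero_fun negligible_pred
  negligible_idealr_closed.

(* Meromorphic functions on C^n: representatives are identified when they agree
   on a dense open set. *)
Definition mero := {ideal_quot negligible_pred}.
HB.instance Definition _ := GRing.ComNzRing.on mero.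

Definition mero_class (f : V -> C) (mf : meromorphic f) : mero :=
  \pi_mero (MeroFun (introT (meroP f) mf)).

Lemma mero_classP (f g : V -> C) (mf : meromorphic f) (mg : meromorphic g) :
  mero_class mf = mero_class mg <-> negligible (f - g).
Proof.
split=> [/eqP|nfg].
  by rewrite -Quotient.idealrBE => /asboolP.
by apply/eqP; rewrite -Quotient.idealrBE; exact/asboolP.
Qed.

Lemma mero_classE (a : mero) : exists f (mf : meromorphic f), a = mero_class mf.
Proof.
exists (repr a), (elimT (meroP _) (mero_valP (repr a))).
by rewrite -[LHS]reprK; congr \pi_mero; apply: val_inj.
Qed.

Definition mero_const (c : C) : mero :=
  mero_class (holomorphic_meromorphic (fun x => differentiable_cst c x)).

Definition mero_coord (j : 'I_n) : mero :=
  mero_class (holomorphic_meromorphic (fun x => differentiable_coord x 0 j)).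

Definition mero_translate (v : V) (a : mero) : mero :=
  mero_class
    (meromorphic_translate v (elimT (meroP _) (mero_valP (repr a)))).

Lemma mero_translateE v (f : V -> C) (mf : meromorphic f) :
  mero_translate v (mero_class mf) = mero_class (meromorphic_translate v mf).
Proof.
apply/mero_classP; set g := repr _.
have /eqP : mero_class mf = \pi_mero g by rewrite reprK.
rewrite -Quotient.idealrBE => /asboolP nfg.
apply: (@negligibleS _ _ (- translate v (f - g))) => [x|].
  suff : - (f (x + v) - g (x + v)) = 0 -> g (x + v) - f (x + v) = 0 by [].
  by rewrite opprB.
have : negligible (translate v (f - g)) by exact: negligible_translate.
apply: negligibleS => x; suff : translate v (f - g) x = 0 ->
  - translate v (f - g) x = 0 by [].
by move=> ->; rewrite oppr0.
Qed.

Fact mero_const1 : mero_const 1 = 1.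
Proof.
by rewrite -[RHS](rmorph1 \pi_mero); congr \pi_mero; exact: val_inj.
Qed.

Fact mero_constD c d : mero_const (c + d) = mero_const c + mero_const d.
Proof.
by rewrite -[RHS](rmorphD \pi_mero); congr \pi_mero; exact: val_inj.
Qed.

Fact mero_constM c d : mero_const (c * d) = mero_const c * mero_const d.
Proof.
by rewrite -[RHS](rmorphM \pi_mero); congr \pi_mero; exact: val_inj.
Qed.

Definition mero_scale (c : C) (a : mero) := mero_const c * a.

Fact mero_scaleA c d a : mero_scale c (mero_scale d a) = mero_scale (c * d) a.
Proof. by rewrite /mero_scale mero_constM mulrA. Qed.

Fact mero_scale1 : left_id 1 mero_scale.
Proof. by move=> a; rewrite /mero_scale mero_const1 mul1r. Qed.

Fact mero_scaleDr : right_distributive mero_scale +%R.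
Proof. by move=> c a b; rewrite /mero_scale mulrDr. Qed.

Fact mero_scaleDl a : {morph mero_scale^~ a : c d / c + d}.
Proof. by move=> c d; rewrite /mero_scale mero_constD mulrDl. Qed.

HB.instance Definition _ := GRing.Zmodule_isLmodule.Build C mero
  mero_scaleA mero_scale1 mero_scaleDr mero_scaleDl.

Fact mero_scaleAl (c : C) (a b : mero) : c *: (a * b) = c *: a * b.
Proof. by rewrite [LHS]mulrA. Qed.

HB.instance Definition _ := GRing.Lmodule_isLalgebra.Build C mero mero_scaleAl.
HB.instance Definition _ := GRing.Lalgebra_isComAlgebra.Build C mero.

(* Inverses are taken in [mero]; they are junk for the elements that are not
   invertible there. *)
Definition mero_unit : {pred mero} := fun a => `[< exists b, b * a = 1 >].

Definition mero_inv (a : mero) : mero :=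
  if pselect (exists b, b * a = 1) is left ex then projT1 (cid ex) else a.

Fact mero_mulVr : {in mero_unit, left_inverse 1 mero_inv *%R}.
Proof.
move=> a /asboolP ua; rewrite /mero_inv; case: pselect => // ex.
exact: projT2 (cid ex).
Qed.

Fact mero_unitPl (a b : mero) : b * a = 1 -> mero_unit a.
Proof. by move=> ba1; apply/asboolP; exists b. Qed.

Fact mero_inv_out : {in [predC mero_unit], mero_inv =1 id}.
Proof.
move=> a /negP nua; rewrite /mero_inv; case: pselect => // ex.
by case: nua; exact/asboolP.
Qed.

HB.instance Definition _ := GRing.ComNzRing_hasMulInverse.Build mero
  mero_mulVr mero_unitPl mero_inv_out.

End MeromorphicField.

Section LieAlgebra.
Variables (K : fieldType) (g : vectType K) (br : g -> g -> g).
Implicit Types (U V h b : {vspace g}) (x y : g).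

Definition lie_bracket := [/\ forall x, linear (br x),
  forall y, linear (br^~ y), forall x, br x x = 0
  & forall x y z, br x (br y z) + br y (br z x) + br z (br x y) = 0].

Definition brv U V : {vspace g} :=
  <<[seq br x y | x <- vbasis U, y <- vbasis V]>>%VS.

Definition lie_subalgebra U := (brv U U <= U)%VS.

Definition lie_simple := brv fullv fullv != 0%VS /\
  forall I : {vspace g}, (brv fullv I <= I)%VS -> I = 0%VS \/ I = fullv.

Definition lie_nilpotent U := exists k, iter k (brv U) U = 0%VS.

Definition lie_solvable U := exists k, iter k (fun V => brv V V) U = 0%VS.

Definition cartan_subalgebra h := [/\ lie_subalgebra h, lie_nilpotent h
  & forall x, (forall y, y \in h -> br x y \in h) -> x \in h].

Definition borel_subalgebra b := [/\ lie_subalgebra b, lie_solvable b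
  & forall b', lie_subalgebra b' -> lie_solvable b' -> (b <= b')%VS -> b' = b].

Section Roots.
Variable h : {vspace g}.
Local Notation dual := 'Hom(subvs_of h, K^o).

(* Linear forms on [h] are the elements of [dual]. *)
Definition root_vector (lam : dual) x :=
  forall t : subvs_of h, br (vsval t) x = (lam t : K) *: x.

Definition is_root (lam : dual) :=
  lam != 0 /\ exists2 x, x != 0 & root_vector lam x.

(* Base of the root system such that the positive root spaces lie in [b]. *)
Definition simple_roots b (l : nat) (alpha : l.-tuple dual) :=
  [/\ basis_of fullv alpha,
      forall i, is_root (tnth alpha i),
      forall lam, is_root lam -> exists c : 'I_l -> nat,
        lam = \sum_i tnth alpha i *+ c i \/ lam = - \sum_i tnth alpha i *+ c i
    & forall i x, root_vector (tnth alpha i) x -> x \in b].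

(* The element [t] of [[g_lam, g_-lam]] normalized by [lam t = 2]. *)
Definition is_coroot (lam : dual) (t : subvs_of h) := lam t = 2%:R :> K /\
  exists e f, [/\ root_vector lam e, root_vector (- lam) f & vsval t = br e f].

End Roots.
End LieAlgebra.

Section FreeAlgebra.
Variables (K : comNzRingType) (X : choiceType).

Definition free_algebra := malg (fmonom X) K.

HB.instance Definition _ := GRing.Lalgebra.on free_algebra.

Fact malgC_central (c : K) (x : malg (fmonom X) K) :
  (malgC c : malg (fmonom X) K) * x = x * (malgC c : malg (fmonom X) K).
Proof.
rewrite mul_malgC malgM_def fgmulgU malgZ_def /fgscale.
by apply: eq_bigr => k _; rewrite mulrC mulm1.
Qed.

Fact free_algebra_scaleAr (c : K) (x y : malg (fmonom X) K) :
  c *: (x * y) = x * (c *: y).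
Proof.
transitivity ((malgC c : malg (fmonom X) K) * (x * y)); first by rewrite mul_malgC.
rewrite mulrA malgC_central -mulrA; congr (_ * _); exact: mul_malgC.
Qed.

HB.instance Definition _ := GRing.Lalgebra_isAlgebra.Build K free_algebra
  free_algebra_scaleAr.

Definition free_gen (x : X) : free_algebra := mkmalgU (fmu x) 1.

End FreeAlgebra.

Section IdealQuotient.
Variables (K : comNzRingType) (B : algType K) (rel : B -> B -> Prop).

Inductive relation_ideal : B -> Prop :=
| relation_ideal_rel x y : rel x y -> relation_ideal (x - y)
| relation_ideal0 : relation_ideal 0
| relation_idealD x y :
    relation_ideal x -> relation_ideal y -> relation_ideal (x + y)
| relation_idealM a x b : relation_ideal x -> relation_ideal (a * x * b).

Definition relation_ideal_pred : {pred B} := fun x => `[< relation_ideal x >].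

Fact relation_ideal_zmod_closed : zmod_closed relation_ideal_pred.
Proof.
split; first exact/asboolP/relation_ideal0.
move=> x y /asboolP Ix /asboolP Iy; apply/asboolP/relation_idealD => //.
by have := relation_idealM (-1) 1 Iy; rewrite mulr1 mulN1r.
Qed.

HB.instance Definition _ := GRing.isZmodClosed.Build B relation_ideal_pred
  relation_ideal_zmod_closed.

Local Notation Q := {ideal_quot relation_ideal_pred}.
Local Notation pi := (\pi_Q : B -> Q).

Fact quot_eqP x y : reflect (relation_ideal (x - y)) (pi x == pi y).
Proof. by rewrite -Quotient.idealrBE; exact: asboolP. Qed.

Fact relation_ideal_repr x : relation_ideal (x - repr (pi x)).
Proof. by apply/quot_eqP; rewrite reprK. Qed.

Fact relation_idealMl a x : relation_ideal x -> relation_ideal (a * x).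
Proof. by move=> /(relation_idealM a 1); rewrite mulr1. Qed.

Fact relation_idealMr b x : relation_ideal x -> relation_ideal (x * b).
Proof. by move=> /(relation_idealM 1 b); rewrite mul1r. Qed.

Definition quot_mul (p q : Q) : Q := pi (repr p * repr q).
Definition quot_scale (c : K) (p : Q) : Q := pi (c *: repr p).

Fact quot_piM x y : pi (x * y) = quot_mul (pi x) (pi y).
Proof.
apply/eqP/quot_eqP; set x' := repr _; set y' := repr _.
have -> : x * y - x' * y' = (x - x') * y + x' * (y - y').
  by rewrite mulrBl mulrBr addrA subrK.
by apply: relation_idealD;
  [apply: relation_idealMr | apply: relation_idealMl]; exact: relation_ideal_repr.
Qed.

Fact quot_piZ c x : pi (c *: x) = quot_scale c (pi x).
Proof.
apply/eqP/quot_eqP; rewrite -scalerBr -[_ - _]mul1r scalerAl.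
by apply: relation_idealMl; exact: relation_ideal_repr.
Qed.

Fact quot_piD x y : pi (x + y) = pi x + pi y.
Proof. exact: (raddfD pi). Qed.

Fact quot_surj p : exists x, p = pi x.
Proof. by exists (repr p); rewrite reprK. Qed.

Fact quot_mulA : associative quot_mul.
Proof.
move=> p q r; have [[[x ->] [y ->]] [z ->]] := (quot_surj p, quot_surj q, quot_surj r).
by have := congr1 pi (mulrA x y z); rewrite !quot_piM.
Qed.

Fact quot_mul1l : left_id (pi 1) quot_mul.
Proof.
move=> p; have [x ->] := quot_surj p.
by have := congr1 pi (mul1r x); rewrite quot_piM.
Qed.

Fact quot_mul1r : right_id (pi 1) quot_mul.
Proof.
move=> p; have [x ->] := quot_surj p.
by have := congr1 pi (mulr1 x); rewrite quot_piM.
Qed.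

Fact quot_mulDl : left_distributive quot_mul +%R.
Proof.
move=> p q r; have [[[x ->] [y ->]] [z ->]] := (quot_surj p, quot_surj q, quot_surj r).
by have := congr1 pi (mulrDl x y z); rewrite !(quot_piM, quot_piD).
Qed.

Fact quot_mulDr : right_distributive quot_mul +%R.
Proof.
move=> p q r; have [[[x ->] [y ->]] [z ->]] := (quot_surj p, quot_surj q, quot_surj r).
by have := congr1 pi (mulrDr x y z); rewrite !(quot_piM, quot_piD).
Qed.

Fact quot_scaleA a b p : quot_scale a (quot_scale b p) = quot_scale (a * b) p.
Proof.
have [x ->] := quot_surj p.
by have := congr1 pi (scalerA a b x); rewrite !quot_piZ.
Qed.

Fact quot_scale1 : left_id 1 quot_scale.
Proof.
move=> p; have [x ->] := quot_surj p.
by have := congr1 pi (scale1r x); rewrite quot_piZ.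
Qed.

Fact quot_scaleDr : right_distributive quot_scale +%R.
Proof.
move=> c p q; have [[x ->] [y ->]] := (quot_surj p, quot_surj q).
by have := congr1 pi (scalerDr c x y); rewrite !(quot_piZ, quot_piD).
Qed.

Fact quot_scaleDl p : {morph quot_scale^~ p : a b / a + b}.
Proof.
move=> a b; have [x ->] := quot_surj p.
by have := congr1 pi (scalerDl x a b); rewrite !(quot_piZ, quot_piD).
Qed.

Fact quot_scaleAl c p q : quot_scale c (quot_mul p q) = quot_mul (quot_scale c p) q.
Proof.
have [[x ->] [y ->]] := (quot_surj p, quot_surj q).
by have := congr1 pi (scalerAl c x y); rewrite !(quot_piM, quot_piZ).
Qed.

Fact quot_scaleAr c p q : quot_scale c (quot_mul p q) = quot_mul p (quot_scale c q).
Proof.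
have [[x ->] [y ->]] := (quot_surj p, quot_surj q).
by have := congr1 pi (scalerAr c x y); rewrite !(quot_piM, quot_piZ).
Qed.

Section Proper.
Hypothesis proper : ~ relation_ideal 1.

(* The quotient of [B] by the two-sided ideal generated by the differences
   [x - y], for [rel x y].  An [algType] is nonzero, hence the argument. *)
Definition presented of ~ relation_ideal 1 := Q.
Local Notation P := (presented proper).

Fact quot_1neq0 : pi 1 != 0.
Proof. by rewrite -(raddf0 pi); apply/quot_eqP; rewrite subr0. Qed.

HB.instance Definition _ := GRing.Zmodule.on P.
HB.instance Definition _ := GRing.Zmodule_isNzRing.Build P
  quot_mulA quot_mul1l quot_mul1r quot_mulDl quot_mulDr quot_1neq0.
HB.instance Definition _ := GRing.Zmodule_isLmodule.Build K P
  quot_scaleA quot_scale1 quot_scaleDr quot_scaleDl.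
HB.instance Definition _ := GRing.Lmodule_isLalgebra.Build K P quot_scaleAl.
HB.instance Definition _ := GRing.Lalgebra_isAlgebra.Build K P quot_scaleAr.

Definition presented_pi (x : B) : P := pi x.

Fact presented_pi_eqP x y :
  reflect (relation_ideal (x - y)) (presented_pi x == presented_pi y).
Proof. exact: quot_eqP. Qed.

Fact presented_pi_surj (p : P) : exists x, p = presented_pi x.
Proof. by exists (repr (p : Q)); rewrite [RHS]reprK. Qed.

Fact presented_pi_is_zmod_morphism : zmod_morphism presented_pi.
Proof. by move=> x y; exact: (raddfB pi). Qed.

Fact presented_pi_is_monoid_morphism : monoid_morphism presented_pi.
Proof. by split=> // x y; exact: quot_piM. Qed.

Fact presented_pi_is_scalable : scalable presented_pi.
Proof. by move=> c x; exact: quot_piZ. Qed.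

HB.instance Definition _ := GRing.isZmodMorphism.Build B P presented_pi
  presented_pi_is_zmod_morphism.
HB.instance Definition _ := GRing.isMonoidMorphism.Build B P presented_pi
  presented_pi_is_monoid_morphism.
HB.instance Definition _ := GRing.isScalable.Build K B P *:%R presented_pi
  presented_pi_is_scalable.

End Proper.
End IdealQuotient.

Section FormalSeries.
Variable B : nzRingType.
Implicit Types (f : nat -> B) (X Y : nat -> nat -> B).

(* [f : nat -> B] stands for the series of general term [f n * u^-n], and
   [X : nat -> nat -> B] for that of general term [X p q * u^-p * v^-q]. *)

Definition in_u f : nat -> nat -> B := fun p q => f p *+ (q == 0%N).
Definition in_v f : nat -> nat -> B := fun p q => f q *+ (p == 0%N).

Definition series_sub X Y : nat -> nat -> B := fun p q => X p q - Y p q.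

Definition series_mul X Y : nat -> nat -> B := fun p q =>
  \sum_(a < p.+1) \sum_(b < q.+1) X a b * Y (p - a)%N (q - b)%N.

Definition series_comm X Y : nat -> nat -> B := fun p q =>
  series_mul X Y p q - series_mul Y X p q.

Definition series_acomm X Y : nat -> nat -> B := fun p q =>
  series_mul X Y p q + series_mul Y X p q.

(* (f(u) - f(v)) / (u - v), by (u^-n - v^-n) / (u - v) =
   - \sum_(p + q = n + 1, p > 0, q > 0) u^-p v^-q. *)
Definition divdiff f : nat -> nat -> B := fun p q =>
  - f (p + q).-1 *+ ((0 < p) && (0 < q))%N.

(* (u - v) * divdiff f = f(u) - f(v), coefficientwise. *)
Lemma divdiffP f p q : divdiff f p.+1 q - divdiff f p q.+1 = in_u f p q - in_v f p q.
Proof.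
rewrite /divdiff /in_u /in_v addSn addnS /=.
case: p q => [|p] [|q]; rewrite ?mulr0n ?mulr1n ?addn0 ?add0n ?subrr ?subr0 ?sub0r //=.
by rewrite opprK.
Qed.

Definition commutator (x y : B) := x * y - y * x.

End FormalSeries.

Variant yangian_gen (l : nat) :=
  | GenH of 'I_l & nat | GenE of 'I_l & nat | GenF of 'I_l & nat.

Section YangianGenChoice.
Variable l : nat.

Definition yangian_gen_encode (x : yangian_gen l) :
    'I_l * nat + ('I_l * nat + 'I_l * nat) :=
  match x with
  | GenH i s => inl (i, s) | GenE i s => inr (inl (i, s))
  | GenF i s => inr (inr (i, s))
  end.

Definition yangian_gen_decode (x : 'I_l * nat + ('I_l * nat + 'I_l * nat)) :
    yangian_gen l :=
  match x with
  | inl (i, s) => GenH i s | inr (inl (i, s)) => GenE i s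
  | inr (inr (i, s)) => GenF i s
  end.

Fact yangian_gen_encodeK : cancel yangian_gen_encode yangian_gen_decode.
Proof. by case. Qed.

HB.instance Definition _ :=
  Choice.copy (yangian_gen l) (can_type yangian_gen_encodeK).
End YangianGenChoice.

Section Yangian.
Variables (C : numClosedFieldType) (hbar : C).
Variables (l : nat) (A : 'M[int]_l) (d : 'I_l -> nat).
Implicit Types (i j : 'I_l) (p q s r : nat).

(* (alpha_i, alpha_j) *)
Definition root_form i j : int := (d i)%:Z * A i j.

Section Relations.
Variables (B : algType C) (H E F : 'I_l -> nat -> B).

(* Coefficient of u^-n in H_i(u), and in E_i(u), F_i(u). *)
Definition H_series i n : B := if n is s.+1 then H i s else 1.
Definition EF_series (X : 'I_l -> nat -> B) i n : B :=
  if n is s.+1 then X i s else 0.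

Local Notation Hs := H_series.
Local Notation Es := (EF_series E).
Local Notation Fs := (EF_series F).
Local Notation c i j := ('i * hbar / 2%:R * (root_form i j)%:~R).

(* Coefficient of u_1^-(t 1 + 1) ... u_n^-(t n + 1) v^-(r + 1) in
   \sum_sg [X_i(u_sg(1)), [X_i(u_sg(2)), ..., [X_i(u_sg(n)), X_j(v)] ...]]. *)
Definition serre_sum (X : 'I_l -> nat -> B) i j n (t : 'I_n -> nat) r : B :=
  \sum_(sg : 'S_n)
    foldr (fun k x => commutator (X i (t (sg k))) x) (X j r) (enum 'I_n).

Inductive yangian_rel : B -> B -> Prop :=
| yangian_HH i j p q :
    yangian_rel (series_comm (in_u (Hs i)) (in_v (Hs j)) p q) 0
| yangian_HE i j p q :
    yangian_rel (series_comm (in_u (Hs i)) (in_v (Es j)) p q)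
      (- c i j *: series_acomm (in_u (Hs i)) (divdiff (Es j)) p q)
| yangian_HF i j p q :
    yangian_rel (series_comm (in_u (Hs i)) (in_v (Fs j)) p q)
      (c i j *: series_acomm (in_u (Hs i)) (divdiff (Fs j)) p q)
| yangian_EF i j p q :
    yangian_rel (series_comm (in_u (Es i)) (in_v (Fs j)) p q)
      (- ('i * hbar * (i == j)%:R) *: divdiff (Hs i) p q)
| yangian_EE i p q :
    yangian_rel (series_comm (in_u (Es i)) (in_v (Es i)) p q)
      (- c i i *: series_mul (series_sub (in_u (Es i)) (in_v (Es i)))
                             (divdiff (Es i)) p q)
| yangian_FF i p q :
    yangian_rel (series_comm (in_u (Fs i)) (in_v (Fs i)) p q)
      (c i i *: series_mul (series_sub (in_u (Fs i)) (in_v (Fs i)))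
                           (divdiff (Fs i)) p q)
| yangian_EE_adj i j p q : i != j -> A i j != 0 ->
    yangian_rel (series_comm (in_u (Es i)) (in_v (Es j)) p q)
      (- c i j *: series_acomm (in_u (Es i)) (divdiff (Es j)) p q
         - commutator (E i 0) (divdiff (Es j) p q))
| yangian_FF_adj i j p q : i != j -> A i j != 0 ->
    yangian_rel (series_comm (in_u (Fs i)) (in_v (Fs j)) p q)
      (c i j *: series_acomm (in_u (Fs i)) (divdiff (Fs j)) p q
         - commutator (F i 0) (divdiff (Fs j) p q))
| yangian_serreE i j n (t : 'I_n -> nat) r : i != j -> n%:Z = 1 - A i j ->
    yangian_rel (serre_sum E i j t r) 0
| yangian_serreF i j n (t : 'I_n -> nat) r : i != j -> n%:Z = 1 - A i j ->
    yangian_rel (serre_sum F i j t r) 0.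

Section Counit.
Variable eps : {rmorphism B -> C}.
Hypothesis epsZ : forall a x, eps (a *: x) = a * eps x.
Hypotheses (epsH : forall i s, eps (H i s) = 0)
  (epsE : forall i s, eps (E i s) = 0) (epsF : forall i s, eps (F i s) = 0).

Fact counit_series_comm X Y p q : eps (series_comm X Y p q) = 0.
Proof.
rewrite rmorphB /series_mul !rmorph_sum /=; apply/eqP; rewrite subr_eq0; apply/eqP.
rewrite [RHS](reindex_inj rev_ord_inj) /=; apply: eq_bigr => -[a ap] _ /=.
rewrite !rmorph_sum /= [RHS](reindex_inj rev_ord_inj) /=.
apply: eq_bigr => -[b bq] _ /=; rewrite !rmorphM mulrC !subSS.
by rewrite !subKn.
Qed.

Fact counit_divdiff f p q : (forall s, eps (f s.+1) = 0) ->
  eps (divdiff f p q) = 0.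
Proof.
move=> f0; rewrite /divdiff; case: p q => [|p] [|q]; try exact: rmorph0.
by rewrite addSn addnS mulr1n rmorphN f0 oppr0.
Qed.

Fact counit_series_mul X Y p q : (forall a b, eps (Y a b) = 0) ->
  eps (series_mul X Y p q) = 0.
Proof.
move=> Y0; rewrite rmorph_sum big1 // => a _; rewrite rmorph_sum big1 // => b _.
by rewrite rmorphM Y0 mulr0.
Qed.

Fact counit_series_mulr X Y p q : (forall a b, eps (X a b) = 0) ->
  eps (series_mul X Y p q) = 0.
Proof.
move=> X0; rewrite rmorph_sum big1 // => a _; rewrite rmorph_sum big1 // => b _.
by rewrite rmorphM X0 mul0r.
Qed.

Fact counit_commutator x y : eps (commutator x y) = 0.
Proof. by rewrite rmorphB !rmorphM mulrC subrr. Qed.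

Fact counit_serre (X : 'I_l -> nat -> B) i j n (t : 'I_n -> nat) r :
  (forall i s, eps (X i s) = 0) -> eps (serre_sum X i j t r) = 0.
Proof.
move=> X0; rewrite rmorph_sum big1 // => sg _.
by case: (enum _) => [|k e] /=; rewrite ?X0 ?counit_commutator.
Qed.

Fact counit_yangian_rel x y : yangian_rel x y -> eps x = eps y.
Proof.
have DE i p q : eps (divdiff (Es i) p q) = 0 by apply: counit_divdiff => s; rewrite /= ?epsE ?epsF ?epsH.
have DF i p q : eps (divdiff (Fs i) p q) = 0 by apply: counit_divdiff => s; rewrite /= ?epsE ?epsF ?epsH.
have DH i p q : eps (divdiff (Hs i) p q) = 0 by apply: counit_divdiff => s; rewrite /= ?epsE ?epsF ?epsH.
have acomm0 X Y p q : (forall a b, eps (Y a b) = 0) ->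
    eps (series_acomm X Y p q) = 0.
  move=> Y0; rewrite rmorphD; apply/eqP.
  by rewrite counit_series_mul // counit_series_mulr // addr0.
case=> {x y} [i j p q|i j p q|i j p q|i j p q|i p q|i p q|i j p q _ _
  |i j p q _ _|i j n t r _ _|i j n t r _ _];
  rewrite ?counit_series_comm ?rmorph0 ?counit_serre //.
- by rewrite epsZ acomm0 ?mulr0.
- by rewrite epsZ acomm0 ?mulr0.
- by rewrite epsZ DH mulr0.
- by rewrite epsZ counit_series_mul ?mulr0.
- by rewrite epsZ counit_series_mul ?mulr0.
- by rewrite rmorphB epsZ acomm0 // counit_commutator mulr0 subrr.
- by rewrite rmorphB epsZ acomm0 // counit_commutator mulr0 subrr.
Qed.
End Counit.

End Relations.

Definition free_yangian : algType C := free_algebra C (yangian_gen l).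
Definition free_rel : free_yangian -> free_yangian -> Prop :=
  yangian_rel (fun i s => free_gen C (GenH i s))
    (fun i s => free_gen C (GenE i s)) (fun i s => free_gen C (GenF i s)).

Fact yangian_proper : ~ relation_ideal free_rel 1.
Proof.
pose eps : {rmorphism free_yangian -> C} := @mcoeff (fmonom (yangian_gen l)) C mone.
have epsZ a (x : free_yangian) : eps (a *: x) = a * eps x by exact: mcoeffZ.
have eps0 (x : yangian_gen l) : eps (free_gen C x) = 0.
  rewrite [LHS]mcoeffU; case: eqP => // /(congr1 (@fdeg _)).
  by rewrite fdeg1 fdegU.
have epsI x : relation_ideal free_rel x -> eps x = 0.
  elim=> {x} [x y /(counit_yangian_rel epsZ) xy||x y _ ex _ ey|a x b _ ex].
  - by rewrite rmorphB xy ?subrr // => i s; exact: eps0.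
  - exact: rmorph0.
  - by rewrite rmorphD ex ey addr0.
  - by rewrite !rmorphM ex mulr0 mul0r.
by move/epsI; rewrite rmorph1; apply/eqP; exact: oner_neq0.
Qed.

Definition yangian : algType C := presented yangian_proper.

Definition yangian_of_gen (x : yangian_gen l) : yangian :=
  presented_pi yangian_proper (free_gen C x).

Definition yH i s := yangian_of_gen (GenH i s).
Definition yE i s := yangian_of_gen (GenE i s).
Definition yF i s := yangian_of_gen (GenF i s).

(* The subalgebra generated by the H_i^(s) and E_i^(s). *)
Inductive yangian_borel : yangian -> Prop :=
| yangian_borelH i s : yangian_borel (yH i s)
| yangian_borelE i s : yangian_borel (yE i s)
| yangian_borel1 : yangian_borel 1
| yangian_borelD x y :
    yangian_borel x -> yangian_borel y -> yangian_borel (x + y)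
| yangian_borelZ (a : C) x : yangian_borel x -> yangian_borel (a *: x)
| yangian_borelM x y :
    yangian_borel x -> yangian_borel y -> yangian_borel (x * y).

End Yangian.

(* [phi] restricts to a morphism from the subalgebra [S] of [B] to the linear
   operators on [M]. *)
Definition algebra_action (K : comNzRingType) (B : algType K) (S : B -> Prop)
    (M : lmodType K) (phi : B -> M -> M) : Prop :=
  [/\ forall x, S x -> linear (phi x),
      forall f, phi 1 f = f,
      forall x y f, S x -> S y -> phi (x * y) f = phi x (phi y f)
    & forall (a : K) x y f, S x -> S y ->
        phi (a *: x + y) f = a *: phi x f + phi y f].

(* For [q] monic, [h n] is the coefficient of u^-n in the expansion of p/q in
   powers of u^-1, and this expansion involves no positive power of u:
   p/q - \sum_(k <= n) h k * u^-k = O(u^-(n+1)) for all n. *)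
Definition is_expansion (M : comNzRingType) (p q : {poly M}) (h : nat -> M) :=
  forall n, (size (p * 'X^n - q * \sum_(k < n.+1) h k *: 'X^(n - k))%R
              < size q)%N.

Section Operators.
Variables (C : numClosedFieldType) (hbar : C).
Variables (l : nat) (A : 'M[int]_l) (d : 'I_l -> nat) (m : 'I_l -> nat).
(* R_i(u) = Rn i / Rd i, where Rd i is monic. *)
Variables (Rn Rd : 'I_l -> {poly C}).
Implicit Types (i s : 'I_l).

Definition nvars := #|{: {i : 'I_l & 'I_(m i)}}|.

Definition var i (k : 'I_(m i)) : 'I_nvars :=
  enum_rank (Tagged (fun i => 'I_(m i)) k).

Local Notation M := (mero C nvars).

(* Below [absz (A s i)] is -a_si: off-diagonal entries of a Cartan matrix are
   nonpositive. *)

Definition gamma i (k : 'I_(m i)) : M := mero_coord C (var k).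

Definition Ppoly i : {poly M} := \prod_(p < m i) ('X - (gamma p)%:P).

(* (i hbar / 2) x, for an integer x *)
Definition half_hbar (x : int) : C := 'i * hbar / 2%:R * x%:~R.

Local Notation form := (root_form A d).

(* (i hbar / 2) (alpha_i + r alpha_s, alpha_s) *)
Definition pole_shift i s (r : nat) : M :=
  (half_hbar (form i s + r%:Z * form s s))%:A.

(* (i hbar / 2) (alpha_i, alpha_i) *)
Definition step i : M := (half_hbar (form i i))%:A.

Definition beta i (k : 'I_(m i)) (f : M) : M :=
  mero_translate (half_hbar (form i i) *: delta_mx 0 (var k)) f.

Definition beta_inv i (k : 'I_(m i)) (f : M) : M :=
  mero_translate (- half_hbar (form i i) *: delta_mx 0 (var k)) f.

Definition to_meroP (p : {poly C}) : {poly M} := map_poly (in_alg M) p.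

Definition R_at i (x : M) : M := (to_meroP (Rn i)).[x] / (to_meroP (Rd i)).[x].

Definition H_num i : {poly M} := to_meroP (Rn i) *
  \prod_(s < l | s != i) \prod_(1 <= r < (absz (A s i)).+1)
    (Ppoly s \Po ('X - (pole_shift i s r)%:P)).

Definition H_den i : {poly M} :=
  to_meroP (Rd i) * (Ppoly i * (Ppoly i \Po ('X - (step i)%:P))).

Definition inv_sqrt_d i : C := (sqrtC (d i)%:R)^-1.

Definition gamma_diff i (k : 'I_(m i)) : M :=
  \prod_(p < m i | p != k) (gamma k - gamma p).

(* Coefficients of u^-(n+1) in E_i(u) and F_i(u), obtained from
   1/(u - x) = \sum_n x^n u^-(n+1). *)
Definition E_op i (n : nat) (f : M) : M := inv_sqrt_d i *: \sum_(k < m i)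
  (\prod_(s < l | (i < s)%N) \prod_(1 <= r < (absz (A s i)).+1)
     (Ppoly s).[gamma k - pole_shift i s r])
  / gamma_diff k * gamma k ^+ n * beta_inv k f.

Definition F_op i (n : nat) (f : M) : M := - inv_sqrt_d i *: \sum_(k < m i)
  R_at i (gamma k + step i) *
  (\prod_(s < l | (s < i)%N) \prod_(1 <= r < (absz (A s i)).+1)
     (Ppoly s).[gamma k - pole_shift i s r + step i])
  / gamma_diff k * (gamma k + step i) ^+ n * beta k f.

Definition represents_HE (S : yangian hbar A d -> Prop)
    (phi : yangian hbar A d -> M -> M) : Prop :=
  [/\ algebra_action S phi,
      forall i, exists2 h : nat -> M, is_expansion (H_num i) (H_den i) h &
        forall n f, phi (H_series (yH hbar A d) i n) f = h n * f
    & forall i n f, phi (yE hbar A d i n) f = E_op i n f].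

End Operators.

(* Main.v *)
(* Write E_i(u) = \sum_v a_v / (u - z_v) T_v, where v runs over the variables of
   node i and T_v shifts z_v.  The quadratic relations hold termwise because
     (z_v - z_w - c_vw) a_v T_v(a_w) = (z_v - z_w + c_vw) a_w T_w(a_v),
   and they imply the Serre relations: for n = 1 - a_ij the symmetrized n-fold
   commutator carries a factor \prod_(t < n) (2 c_ij + t c_ii) = 0.  The relation
   between E_i and F_i is the partial fraction decomposition of H_i(u), whose
   residues at z_v and at z_v + c_vv are exchanged up to sign by T_v.

   If R_i is only rational, add variables z_w that take their values in a lattice
   stable under the shifts.  The functions that vanish at the points with a
   positive coordinate form a Y(b)-stable space, which evaluation at the origin
   maps onto M.  There the E_i(u) act by the same formulas as on M, and R_i gets
   multiplied by a fixed rational function of u, namely the contribution of the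
   z_w to H_i.  With sufficiently many new variables (some combination of the rows
   of the Cartan matrix is positive), a polynomial R'_i can be chosen such that
   the resulting H_i(u) agrees with the given one modulo u^-N.  Hence each relation
   of Y(g) between finitely many H_i^(s), E_i^(s) holds on M. *)

(* Y(b) is a subalgebra of Y(g), so its relations include consequences of relations that involve the
   F_i; identities between the operators H_i and E_i alone do not show that they extend to it. Each
   relation of Y(b) is therefore tested inside representations of the whole of Y(g). These are built
   for polynomial R_i: the terms of [E_i, F_i] account for the poles z_v and z_v + c_vv of H_i(u)
   and for no others. A fraction R_i is replaced by the quotient of a polynomial division, which is
   the closer the larger its degree; the extra variables serve to raise that degree. Lattice values
   allow evaluation at a point: from the origin, a shift of an extra variable leads to a positive
   coordinate, where the functions considered vanish, and well-chosen offsets keep all denominators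
   invertible. For the Serre relations, let e be one term of E_j, at w. Dividing the weights of E_i
   by z_v - z_w + c gives a current y with, term by term, E_i = (z_v - z_w + c) y and e E_i = (z_v -
   z_w - c) y e, so the nested commutators can be computed recursively. *)
Require Import Defs.
From HB Require Import structures.
From mathcomp Require Import all_boot all_order all_algebra perm.
From mathcomp Require Import complex.
From mathcomp Require Import all_classical all_reals all_analysis.
From mathcomp Require Import ring zify.
From mathcomp.multinomials Require Import -(notations) monalg.

Set Implicit Arguments.
Unset Strict Implicit.
Unset Printing Implicit Defensive.

Import Order.TTheory GRing.Theory Num.Theory.
Local Open Scope ring_scope.

(** * Identities in abelian groups, by reflection *)

Section ZmodReflection.
Variable V : zmodType.

Inductive zmod_term :=
  | ZVar of nat | ZZero | ZAdd of zmod_term & zmod_term | ZOpp of zmod_term.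

Fixpoint zmod_eval (e : seq V) t : V :=
  match t with
  | ZVar k => e`_k
  | ZZero => 0
  | ZAdd t1 t2 => zmod_eval e t1 + zmod_eval e t2
  | ZOpp t1 => - zmod_eval e t1
  end.

Fixpoint zmod_coef t k : int :=
  match t with
  | ZVar j => (j == k)%:Z
  | ZZero => 0
  | ZAdd t1 t2 => zmod_coef t1 k + zmod_coef t2 k
  | ZOpp t1 => - zmod_coef t1 k
  end.

Lemma zmod_evalE e t : zmod_eval e t = \sum_(k < size e) e`_k *~ zmod_coef t k.
Proof.
elim: t => [j||t1 IH1 t2 IH2|t1 IH1] /=.
- case: (ltnP j (size e)) => [jn|nj]; last first.
    rewrite nth_default // big1 // => k _; rewrite gtn_eqF ?mulr0z //.
    exact: leq_trans (ltn_ord k) nj.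
  rewrite (bigD1 (Ordinal jn)) //= eqxx mulr1z big1 ?addr0 // => k kj.
  by rewrite eq_sym (negbTE (kj : (k : nat) != j)) mulr0z.
- by rewrite big1 // => k _; rewrite mulr0z.
- by rewrite IH1 IH2 -big_split; apply: eq_bigr => k _; rewrite mulrzDr.
- by rewrite IH1 -sumrN; apply: eq_bigr => k _; rewrite mulrNz.
Qed.

Lemma zmod_reflection e t1 t2 :
  all (fun k => zmod_coef t1 k == zmod_coef t2 k) (iota 0 (size e)) ->
  zmod_eval e t1 = zmod_eval e t2.
Proof.
move=> /allP t12; rewrite !zmod_evalE; apply: eq_bigr => k _.
suff /eqP -> : zmod_coef t1 k == zmod_coef t2 k by [].
by apply: t12; rewrite mem_iota add0n leq0n ltn_ord.
Qed.

End ZmodReflection.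

(** An atom is matched syntactically first and up to unification second, so convertible forms of one
    subterm share an index. *)
Ltac zmod_index e x n :=
  lazymatch e with
  | ?y :: ?e' =>
      match goal with
      | _ => let _ := match goal with _ => constr_eq x y end in n
      | _ => let _ := match goal with _ => unify x y end in n
      | _ => zmod_index e' x constr:(S n)
      end
  end.

Ltac zmod_atoms e t :=
  lazymatch t with
  | GRing.add ?a ?b => let e1 := zmod_atoms e a in zmod_atoms e1 b
  | GRing.opp ?a => zmod_atoms e a
  | GRing.zero => e
  | ?x => match goal with
          | _ => let n := zmod_index e x constr:(0%N) in e
          | _ => constr:(x :: e)
          end
  end.

Ltac zmod_reify e t :=
  lazymatch t with
  | GRing.add ?a ?b =>
      let a' := zmod_reify e a in let b' := zmod_reify e b in
      constr:(ZAdd a' b')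
  | GRing.opp ?a => let a' := zmod_reify e a in constr:(ZOpp a')
  | GRing.zero => constr:(ZZero)
  | ?x => let n := zmod_index e x constr:(0%N) in constr:(ZVar n)
  end.

(* Decides equalities that hold in every abelian group. *)
Ltac zmod :=
  lazymatch goal with
  | |- @eq ?T ?a ?b =>
      let e0 := zmod_atoms (@nil T) a in let e := zmod_atoms e0 b in
      let a' := zmod_reify e a in let b' := zmod_reify e b in
      refine (@zmod_reflection _ e a' b' _); vm_compute; reflexivity
  end.

(** Uses a known equality additively: what remains is a pure identity, left to [zmod] or [ring]. *)
Lemma eq_from_subr (V : zmodType) (a b x y : V) : a = b -> x - y = a - b -> x = y.
Proof. by move=> ->; rewrite subrr => /subr0_eq. Qed.

(** * Relations between formal series *)

Section ModeRelations.
Variables (K : numFieldType) (B : algType K).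
Implicit Types (f g : nat -> B) (X Y : nat -> nat -> B) (c : K).

(* [(u - v - c) f(u) g(v) = (u - v + c) g(v) f(u)], coefficientwise. *)
Definition quadratic_relation c f g := forall p q,
  f p.+1 * g q - f p * g q.+1 - c *: (f p * g q)
  = g q * f p.+1 - g q.+1 * f p + c *: (g q * f p).

(** Multiplication by u - v sends X to the differences [X p.+1 q - X p q.+1]; where these vanish, X
    is constant along antidiagonals, hence equal to a boundary value. *)
Lemma series_eq0 X : (forall q, X 0%N q = 0) -> (forall p, X p 0%N = 0) ->
  (forall p q, X p.+1 q.+1 = X p q.+2) -> forall p q, X p q = 0.
Proof.
move=> X0q Xp0 XS; elim=> [|p IH] [|q] //.
by rewrite XS.
Qed.

Lemma series_mul_uv f g p q : series_mul (in_u f) (in_v g) p q = f p * g q.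
Proof.
rewrite /series_mul big_ord_recr /= big1 => [|a _].
  rewrite add0r big_ord_recl /= big1 => [|b _].
    by rewrite addr0 /in_u /in_v subnn subn0 !mulr1n.
  by rewrite /in_u /= mulr0n mul0r.
rewrite big1 // => b _; rewrite /in_v.
by have := ltn_ord a; rewrite -subn_gt0; case: (p - a)%N => // k _; rewrite mulr0n mulr0.
Qed.

Lemma series_mul_vu f g p q : series_mul (in_v f) (in_u g) p q = f q * g p.
Proof.
rewrite /series_mul big_ord_recl /= [X in _ + X]big1 => [|a _].
  rewrite addr0 big_ord_recr /= big1 => [|b _].
    by rewrite add0r /in_u /in_v subnn subn0 !mulr1n.
  rewrite /in_u; have := ltn_ord b; rewrite -subn_gt0.
  by case: (q - b)%N => // k _; rewrite mulr0n mulr0.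
by rewrite big1 // => b _; rewrite /in_v /= mulr0n mul0r.
Qed.

Lemma series_mul_ul f Y p q :
  series_mul (in_u f) Y p q = \sum_(a < p.+1) f a * Y (p - a)%N q.
Proof.
apply: eq_bigr => a _; rewrite big_ord_recl /= big1 => [|b _].
  by rewrite addr0 /in_u mulr1n subn0.
by rewrite /in_u /= mulr0n mul0r.
Qed.

Lemma series_mul_vl f Y p q :
  series_mul (in_v f) Y p q = \sum_(b < q.+1) f b * Y p (q - b)%N.
Proof.
rewrite /series_mul big_ord_recl [X in _ + X]big1 => [|a _].
  by rewrite addr0; apply: eq_bigr => b _; rewrite /in_v mulr1n subn0.
by rewrite big1 // => b _; rewrite /in_v /= mulr0n mul0r.
Qed.

Lemma series_mul_ur f Y p q :
  series_mul Y (in_u f) p q = \sum_(a < p.+1) Y (p - a)%N q * f a.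
Proof.
rewrite /series_mul (reindex_inj rev_ord_inj) /=.
apply: eq_bigr => a _; rewrite subSS big_ord_recr /= big1 => [|b _].
  by rewrite add0r /in_u subnn mulr1n subKn // -ltnS.
rewrite /in_u; have := ltn_ord b; rewrite -subn_gt0.
by case: (q - b)%N => // k _; rewrite mulr0n mulr0.
Qed.

Lemma divdiff0q f q : divdiff f 0 q = 0. Proof. by []. Qed.
Lemma divdiffp0 f p : divdiff f p 0 = 0.
Proof. by rewrite /divdiff andbF. Qed.

Lemma divdiffC f p q : divdiff f p q = divdiff f q p.
Proof. by rewrite /divdiff addnC andbC. Qed.

Lemma divdiff_shift f p q :
  divdiff f p.+1 q.+1 - divdiff f p q.+2 = - (f q.+1 *+ (p == 0)%N).
Proof. by rewrite divdiffP /in_u /in_v /= mulr0n sub0r. Qed.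

(** The product by u - v is f(u) g(u) - f(u) g(v), and only the second term has positive degree in
    1/v. *)
Lemma series_mulr_divdiff_shift f g p q :
  series_mul (in_u f) (divdiff g) p.+1 q.+1 - series_mul (in_u f) (divdiff g) p q.+2
  = - (f p * g q.+1).
Proof.
rewrite !series_mul_ul big_ord_recr /= subnn divdiff0q mulr0 addr0 -sumrB.
rewrite big_ord_recr /= big1 => [|a _].
  by rewrite add0r subSnn subnn -mulrBr divdiff_shift eqxx mulr1n mulrN.
rewrite -mulrBr subSn ?divdiff_shift; last exact: ltnW.
have := ltn_ord a; rewrite -subn_gt0; case: (p - a)%N => // k _.
by rewrite mulr0n oppr0 mulr0.
Qed.

Lemma series_mull_divdiff_shift f g p q :
  series_mul (divdiff g) (in_u f) p.+1 q.+1 - series_mul (divdiff g) (in_u f) p q.+2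
  = - (g q.+1 * f p).
Proof.
rewrite !series_mul_ur big_ord_recr /= subnn divdiff0q mul0r addr0 -sumrB.
rewrite big_ord_recr /= big1 => [|a _].
  by rewrite add0r subSnn subnn -mulrBl divdiff_shift eqxx mulr1n mulNr.
rewrite -mulrBl subSn ?divdiff_shift; last exact: ltnW.
have := ltn_ord a; rewrite -subn_gt0; case: (p - a)%N => // k _.
by rewrite mulr0n oppr0 mul0r.
Qed.

Lemma series_acomm_divdiff_shift f g p q :
  series_acomm (in_u f) (divdiff g) p.+1 q.+1
  - series_acomm (in_u f) (divdiff g) p q.+2 = - (f p * g q.+1 + g q.+1 * f p).
Proof.
rewrite /series_acomm opprD addrACA series_mulr_divdiff_shift.
by rewrite series_mull_divdiff_shift opprD.
Qed.

Lemma series_acomm_divdiff0q f g q : series_acomm (in_u f) (divdiff g) 0 q = 0.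
Proof.
rewrite /series_acomm series_mul_ul series_mul_ur !big_ord1.
by rewrite divdiff0q mulr0 mul0r addr0.
Qed.

Lemma series_acomm_divdiffp0 f g p : series_acomm (in_u f) (divdiff g) p 0 = 0.
Proof.
rewrite /series_acomm series_mul_ul series_mul_ur !big1 ?addr0 // => a _;
  by rewrite divdiffp0 ?mulr0 ?mul0r.
Qed.

Lemma quadratic_relation_comm c f g : quadratic_relation c f g -> forall p q,
  (f p.+1 * g q - g q * f p.+1) - (f p * g q.+1 - g q.+1 * f p)
  = c *: (f p * g q + g q * f p).
Proof.
move=> fg p q; apply: (eq_from_subr (fg p q)); rewrite scalerDr; zmod.
Qed.

(** After multiplication by u - v the claim is the quadratic relation; the boundary coefficients
    vanish because [h 0 = 1] is central and [e 0 = 0]. *)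
Lemma series_comm_quadratic c (h e : nat -> B) : h 0%N = 1 -> e 0%N = 0 ->
  quadratic_relation c h (e \o succn) -> forall p q,
  series_comm (in_u h) (in_v e) p q
  = - c *: series_acomm (in_u h) (divdiff e) p q.
Proof.
move=> h0 e0 /quadratic_relation_comm he p q.
apply: subr0_eq; rewrite scaleNr opprK.
move: p q; apply: series_eq0 => [q|p|p q].
- rewrite series_acomm_divdiff0q scaler0 addr0 /series_comm series_mul_uv.
  by rewrite series_mul_vu h0 mulr1 mul1r subrr.
- rewrite series_acomm_divdiffp0 scaler0 addr0 /series_comm series_mul_uv.
  by rewrite series_mul_vu e0 mulr0 mul0r subrr.
have /(congr1 ( *:%R c)) a := series_acomm_divdiff_shift h e p q.
rewrite scalerBr scalerN in a.
have /= b := he p q; apply: (eq_from_subr b); apply: (eq_from_subr a).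
rewrite /series_comm !series_mul_uv !series_mul_vu /=; zmod.
Qed.

Lemma series_comm_quadratic_adj c (x y : nat -> B) : x 0%N = 0 -> y 0%N = 0 ->
  quadratic_relation c (x \o succn) (y \o succn) -> forall p q,
  series_comm (in_u x) (in_v y) p q
  = - c *: series_acomm (in_u x) (divdiff y) p q
    - commutator (x 1%N) (divdiff y p q).
Proof.
move=> x0 y0 /quadratic_relation_comm xy p q.
apply: subr0_eq; rewrite scaleNr opprD !opprK.
move: p q; apply: series_eq0 => [q|p|p q].
- rewrite series_acomm_divdiff0q /series_comm series_mul_uv.
  by rewrite series_mul_vu x0 /commutator divdiff0q !(mulr0, mul0r, scaler0, subrr, addr0).
- rewrite series_acomm_divdiffp0 /series_comm series_mul_uv.
  by rewrite series_mul_vu y0 /commutator divdiffp0 !(mulr0, mul0r, scaler0, subrr, addr0).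
have /(congr1 ( *:%R c)) a := series_acomm_divdiff_shift x y p q.
rewrite scalerBr scalerN in a; apply: (eq_from_subr a) => {a}.
have := congr1 (commutator (x 1%N)) (divdiff_shift y p q).
rewrite /commutator mulrBr mulrBl => b; apply: (eq_from_subr b) => {b}.
rewrite /series_comm !series_mul_uv !series_mul_vu /=.
(* The quadratic relation between [x 1], [x 2], ... says nothing in the row p = 0; there the
   commutator with [x 1] supplies the missing term. *)
case: p => [|p] /=.
  by rewrite x0 !(mulr0, mul0r, mulr1n, addr0, scaler0, mulrN, mulNr); zmod.
have /= b := xy p q; apply: (eq_from_subr b); rewrite mulr0n oppr0 mulr0 mul0r; zmod.
Qed.

(** The quadratic relation only shows that the coefficient of index (p + 1, q + 1) of the difference
    X of both sides depends on p + q; as X is antisymmetric, it vanishes. *)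
Lemma series_comm_quadratic_self c (x : nat -> B) : x 0%N = 0 ->
  quadratic_relation c (x \o succn) (x \o succn) -> forall p q,
  series_comm (in_u x) (in_v x) p q
  = - c *: series_mul (series_sub (in_u x) (in_v x)) (divdiff x) p q.
Proof.
move=> x0 /quadratic_relation_comm xx.
pose X p q := series_comm (in_u x) (in_v x) p q
  + c *: (series_mul (in_u x) (divdiff x) p q - series_mul (in_u x) (divdiff x) q p).
have vu p q : series_mul (in_v x) (divdiff x) p q = series_mul (in_u x) (divdiff x) q p.
  by rewrite series_mul_vl series_mul_ul; apply: eq_bigr => a _; rewrite divdiffC.
suff X0 p q : X p q = 0.
  move=> p q; apply: (eq_from_subr (X0 p q)); rewrite /X -(vu p q).
  have -> : series_mul (series_sub (in_u x) (in_v x)) (divdiff x) p q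
      = series_mul (in_u x) (divdiff x) p q - series_mul (in_v x) (divdiff x) p q.
    rewrite -sumrB; apply: eq_bigr => a _; rewrite -sumrB; apply: eq_bigr => b _.
    by rewrite -mulrBl.
  by rewrite scaleNr; zmod.
have XC u v : X u v = - X v u.
  rewrite /X /series_comm !series_mul_uv !series_mul_vu !scalerBr; zmod.
have X0q v : X 0%N v = 0.
  rewrite /X /series_comm series_mul_uv series_mul_vu x0.
  rewrite series_mul_ul series_mul_ul big_ord1 divdiff0q mulr0 big1 => [|a _].
    by rewrite mulr0 mul0r !subrr scaler0 addr0.
  by rewrite divdiffp0 mulr0.
have XS u v : X u.+2 v.+1 = X u.+1 v.+2.
  have /(congr1 ( *:%R c)) a := series_mulr_divdiff_shift x x u.+1 v.
  have /(congr1 ( *:%R c)) b := series_mulr_divdiff_shift x x v.+1 u.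
  rewrite scalerBr scalerN in a; rewrite scalerBr scalerN in b.
  have e := xx u v; rewrite /= scalerDr in e.
  apply: (eq_from_subr e); apply: (eq_from_subr a); apply: (eq_from_subr b).
  rewrite /X /series_comm !series_mul_uv !series_mul_vu !scalerBr; zmod.
have X1 u v : X u.+1 v.+1 = X 1%N (u + v).+1.
  by elim: u v => [|u IH] v //; rewrite XS IH addSnnS.
have X0' u v : X u.+1 v.+1 = 0.
  apply/eqP; have /eqP := XC u.+1 v.+1.
  by rewrite X1 [X v.+1 _]X1 addnC -addr_eq0 -mulr2n -scaler_nat scaler_eq0 pnatr_eq0.
case: p q => [|p] [|q] //; by rewrite XC X0q oppr0.
Qed.
End ModeRelations.

(** * Sums over orderings of a finite set *)

Section OrderedSums.
Variables (I : finType) (V : nmodType).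
Implicit Types (A : {set I}) (g : I -> V -> V).

(* Sum of [g i1 (... (g in x))] over the [n]-element sequences
   [i1, ..., in] of distinct elements of [A]. *)
Fixpoint ordered_sum g (x : V) n A : V :=
  if n is n'.+1 then \sum_(i in A) g i (ordered_sum g x n' (A :\ i)) else x.

Lemma exchange_setD1 A (F : I -> I -> V) :
  \sum_(i in A) \sum_(j in A :\ i) F i j = \sum_(j in A) \sum_(i in A :\ j) F i j.
Proof.
rewrite (exchange_big_dep (fun j => j \in A)) /= => [|i j _].
  by apply: eq_bigr => j jA; apply: eq_bigl => i; rewrite !inE jA eq_sym andbT andbC.
by rewrite !inE => /andP[].
Qed.

Lemma setD1C A i j : A :\ i :\ j = A :\ j :\ i.
Proof. by rewrite !finset.setDDl finset.setUC. Qed.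

End OrderedSums.

(** A permutation of n + 1 points is its value at 0 together with a permutation of the others
    ([lift_perm]). This puts the Serre sum in a form that allows recursion on the set of indices. *)
Lemma sum_perm_ordered_sum (I J : finType) (V : zmodType) (g : J -> {additive V -> V})
    (x : V) n (t : 'I_n -> J) : injective t ->
  \sum_(sg : 'S_n) foldr (fun k => g (t (sg k))) x (enum 'I_n)
  = ordered_sum (fun j => g j) x n [set t k | k in [set: _]].
Proof.
elim: n t => [|n IH] t tI.
  rewrite (big_pred1 (1%g : {perm (ordinal 0)})) => [|sg]; last by apply/esym/eqP/permP => -[].
  by rewrite (size0nil (size_enum_ord 0)).
rewrite /= big_imset /=; last by move=> ? ? _ _; exact: tI.
pose f (p : 'I_n.+1 * 'S_n) := lift_perm ord0 p.1 p.2.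
have lift_inj' : injective (fun p : 'I_n.+1 * 'S_n => f p).
  move=> [i a] [j b] /= e; have ij : i = j.
    by have := congr1 (fun s : 'S_n.+1 => s ord0) e; rewrite /f /= !lift_perm_id.
  subst j; congr (_, _); apply/permP => k.
  have := congr1 (fun s : 'S_n.+1 => s (lift ord0 k)) e.
  by rewrite /f /= !lift_perm_lift => /lift_inj.
have f_bij : bijective f.
  by apply: inj_card_bij => //; rewrite card_prod card_ord !card_Sn factS.
rewrite (reindex f) /=; last exact: onW_bij.
rewrite -(pair_bigA _ (fun i sg => foldr (fun k => g (t (f (i, sg) k))) x (enum 'I_n.+1))).
apply: eq_big => [i|i _]; first by rewrite inE.
have ->: [set t k | k in [set: _]] :\ t i = [set t (lift i k) | k in [set: _]].
  apply/setP => j; rewrite !inE; apply/andP/imsetP => [[ji /imsetP[k _ jk]]|[k _ ->]].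
    have : k != i by apply: contraNneq ji => <-; rewrite jk.
    by rewrite eq_sym => /unlift_some[k' kk' _]; exists k'; rewrite // jk kk'.
  by rewrite inj_eq // eq_sym neq_lift imset_f.
rewrite -(IH (fun k => t (lift i k))); last by move=> a b /tI/lift_inj.
rewrite raddf_sum; apply: eq_bigr => sg _.
rewrite enum_ordSl /= /f /= lift_perm_id; congr (g _ _).
elim: (enum 'I_n) => //= k ks ->; by rewrite lift_perm_lift.
Qed.

(** * The Serre relations *)

Section SerreRelation.
Variables (K : numFieldType) (B : algType K) (I : finType).
Variables (y y' x : I -> B) (zeta e : B) (c s : K).
(** In the application [y i] is a mode of a modified current and [y' i] the next mode, [zeta]
    multiplies by z_w, and [e] is one term of E_j. *)
Hypothesis y_quad : forall i j, i != j ->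
  y' i * y j - y i * y' j + (y' j * y i - y j * y' i) = s *: (y i * y j + y j * y i).
Hypothesis zeta_y : forall i, zeta * y i = y i * zeta.
Hypothesis xE : forall i, x i = y' i + c *: y i - zeta * y i.
Hypothesis exE : forall i, e * x i = (y' i - c *: y i - zeta * y i) * e.
Implicit Types A : {set I}.

Let Z := ordered_sum (fun i => *%R (y i)) 1.

Lemma Z_recl n A : Z n.+1 A = \sum_(i in A) y i * Z n (A :\ i).
Proof. by []. Qed.

Lemma Z_recr n A : Z n.+1 A = \sum_(i in A) Z n (A :\ i) * y i.
Proof.
elim: n A => [|n IH] A.
  by rewrite Z_recl; apply: eq_bigr => i _; rewrite mulr1 mul1r.
transitivity (\sum_(i in A) \sum_(j in A :\ i) y i * (Z n (A :\ i :\ j) * y j)).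
  by rewrite Z_recl; apply: eq_bigr => i _; rewrite IH mulr_sumr.
rewrite exchange_setD1; apply: eq_bigr => j _.
rewrite mulr_suml; apply: eq_bigr => i _.
by rewrite setD1C mulrA.
Qed.

(** In the symmetrized product, moving the primed factor one place to the right costs [s *: Z] by
    [y_quad]; from the first place to the last there are n moves. *)
Lemma Z_bracket n A : #|A| = n.+1 ->
  \sum_(i in A) y' i * Z n (A :\ i) - \sum_(i in A) Z n (A :\ i) * y' i
  = (n%:R * s) *: Z n.+1 A.
Proof.
elim: n A => [|n IH] A cA.
  rewrite mul0r scale0r -sumrB big1 // => i _.
  by rewrite mulr1 mul1r subrr.
have swap (F : I -> I -> B) : (forall i j, i != j -> F i j + F j i = 0) ->
    \sum_(i in A) \sum_(j in A :\ i) F i j = 0.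
  move=> F0; set S := (X in X = 0).
  have : S + S = 0.
    rewrite {2}/S exchange_setD1 /S -big_split big1 // => i _.
    rewrite -big_split big1 // => j; rewrite !inE => /andP[ji _].
    by apply: F0; rewrite eq_sym.
  by move/eqP; rewrite -mulr2n -scaler_nat scaler_eq0 pnatr_eq0 => /eqP.
have s1 : \sum_(i in A) \sum_(j in A :\ i)
    (y' i * y j - y i * y' j - s *: (y i * y j)) * Z n (A :\ i :\ j) = 0.
  apply: swap => i j ij; rewrite [A :\ j :\ i]setD1C -mulrDl.
  have -> : y' i * y j - y i * y' j - s *: (y i * y j)
     + (y' j * y i - y j * y' i - s *: (y j * y i)) = 0.
    apply: (eq_from_subr (y_quad ij)); rewrite scalerDr; zmod.
  by rewrite mul0r.
have s2 : \sum_(i in A) y i * (\sum_(j in A :\ i) y' j * Z n (A :\ i :\ j)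
     - \sum_(j in A :\ i) Z n (A :\ i :\ j) * y' j)
   = (n%:R * s) *: Z n.+2 A.
  rewrite [Z n.+2 A]Z_recl scaler_sumr.
  apply: eq_bigr => i iA; rewrite IH ?scalerAr //.
  by apply/eqP; have := cardsD1 i A; rewrite iA cA add1n => -[<-].
have s3 : \sum_(i in A) y i * \sum_(j in A :\ i) Z n (A :\ i :\ j) * y' j
    = \sum_(j in A) Z n.+1 (A :\ j) * y' j.
  transitivity (\sum_(i in A) \sum_(j in A :\ i) y i * (Z n (A :\ i :\ j) * y' j)).
    by apply: eq_bigr => i _; rewrite mulr_sumr.
  rewrite exchange_setD1; apply: eq_bigr => j _.
  rewrite Z_recl mulr_suml; apply: eq_bigr => i _.
  by rewrite setD1C mulrA.
have s4 : \sum_(i in A) y' i * Z n.+1 (A :\ i) =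
    \sum_(i in A) \sum_(j in A :\ i) y' i * y j * Z n (A :\ i :\ j).
  by apply: eq_bigr => i _; rewrite Z_recl mulr_sumr; apply: eq_bigr => j _; rewrite mulrA.
have s5 : \sum_(i in A) y i * \sum_(j in A :\ i) y' j * Z n (A :\ i :\ j) =
    \sum_(i in A) \sum_(j in A :\ i) y i * y' j * Z n (A :\ i :\ j).
  by apply: eq_bigr => i _; rewrite mulr_sumr; apply: eq_bigr => j _; rewrite mulrA.
have s6 : s *: Z n.+2 A =
    \sum_(i in A) \sum_(j in A :\ i) s *: (y i * y j) * Z n (A :\ i :\ j).
  rewrite [Z n.+2 A]Z_recl scaler_sumr.
  apply: eq_bigr => i _; rewrite Z_recl mulr_sumr scaler_sumr.
  by apply: eq_bigr => j _; rewrite mulrA scalerAl.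
have s1' : \sum_(i in A) \sum_(j in A :\ i) y' i * y j * Z n (A :\ i :\ j)
  - \sum_(i in A) \sum_(j in A :\ i) y i * y' j * Z n (A :\ i :\ j)
  - \sum_(i in A) \sum_(j in A :\ i) s *: (y i * y j) * Z n (A :\ i :\ j) = 0.
  rewrite -[RHS]s1 -!sumrB; apply: eq_bigr => i _; rewrite -!sumrB.
  by apply: eq_bigr => j _; rewrite !mulrBl.
have s2' : \sum_(i in A) y i * \sum_(j in A :\ i) y' j * Z n (A :\ i :\ j)
  - \sum_(i in A) y i * \sum_(j in A :\ i) Z n (A :\ i :\ j) * y' j
  = (n%:R * s) *: Z n.+2 A.
  by rewrite -s2 -sumrB; apply: eq_bigr => i _; rewrite mulrBr.
rewrite -natr1 mulrDl scalerDl mul1r s4 -s3.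
apply: (eq_from_subr s1'); apply: (eq_from_subr s2'); rewrite s5 s6; zmod.
Qed.

Lemma zeta_Z n A : zeta * Z n A = Z n A * zeta.
Proof.
elim: n A => [|n IH] A; first by rewrite mul1r mulr1.
rewrite Z_recl mulr_sumr mulr_suml.
by apply: eq_bigr => i _; rewrite mulrA zeta_y -mulrA IH mulrA.
Qed.

(* If [c] and [s] are the same multiple of [(alpha_i, alpha_j)] and
   [(alpha_i, alpha_i)], the factor [t = - a_ij] of the product vanishes. *)
Lemma ordered_sum_commutator n A : #|A| = n ->
  ordered_sum (fun i => commutator (x i)) e n A
  = (\prod_(t < n) (c *+ 2 + t%:R * s)) *: (Z n A * e).
Proof.
elim: n A => [|n IH] A cA; first by rewrite big_ord0 scale1r mul1r.
have step i : i \in A -> commutator (x i) (ordered_sum (fun i => commutator (x i)) e n (A :\ i))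
   = (\prod_(t < n) (c *+ 2 + t%:R * s)) *:
     ((y' i * Z n (A :\ i) - Z n (A :\ i) * y' i + c *: (y i * Z n (A :\ i))
      + c *: (Z n (A :\ i) * y i)
      - (zeta * (y i * Z n (A :\ i)) - zeta * (Z n (A :\ i) * y i))) * e).
  move=> iA; rewrite IH; last by apply/eqP; have := cardsD1 i A; rewrite iA cA add1n => -[<-].
  rewrite /commutator -scalerAr -scalerAl -scalerBr; congr (_ *: _).
  rewrite -[X in _ - X]mulrA exE xE !mulrA -mulrBl; congr (_ * _).
  rewrite !(mulrDl, mulrDr) !(mulNr, mulrN) -!scalerAr -!scalerAl !mulrA zeta_Z; zmod.
rewrite [LHS](eq_bigr _ step) -scaler_sumr -mulr_suml big_ord_recr /= -scalerA.
congr (_ *: _); rewrite scalerAl; congr (_ * _).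
(* Summed over i, the two terms in c give 2 c, the terms in [zeta] cancel, and [Z_bracket]
   contributes n s: this is the new factor t = n. *)
rewrite !(big_split, sumrN) /= -!scaler_sumr -!mulr_sumr -Z_recl -Z_recr subrr subr0.
apply: (eq_from_subr (Z_bracket cA)).
rewrite mulr2n !scalerDl; zmod.
Qed.

End SerreRelation.

(** * Representations of presented algebras *)

Section LinearOperators.
Variables (K : comNzRingType) (M : comAlgType K).

Definition linear_pred : {pred M -> M} := fun f => `[< linear f >].

Fact linear_submod_closed : submod_closed linear_pred.
Proof.
split=> [|a f g /asboolP lf /asboolP lg]; apply/asboolP => b u v.
  by change ((0 : M) = b *: 0 + 0); rewrite scaler0 addr0.
change (a *: f (b *: u + v) + g (b *: u + v)
  = b *: (a *: f u + g u) + (a *: f v + g v)).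
by rewrite lf lg !scalerDr !scalerA [b * a]mulrC; zmod.
Qed.

HB.instance Definition _ :=
  GRing.isSubmodClosed.Build K (M -> M) linear_pred linear_submod_closed.

(** Operators are bundled into an [algType] so that they can be the target of a morphism from the
    free algebra. *)
Record lin_op := LinOp { lin_fun :> M -> M; lin_funP : lin_fun \in linear_pred }.

HB.instance Definition _ := [isSub for lin_fun].
HB.instance Definition _ := [Choice of lin_op by <:].
HB.instance Definition _ := [SubChoice_isSubLmodule of lin_op by <:].

Implicit Types f g k : lin_op.

Lemma lin_op_linear f : linear f. Proof. exact/asboolP/lin_funP. Qed.

HB.instance Definition _ f := GRing.isLinear.Build K M M *:%R (lin_fun f) (lin_op_linear f).

Lemma lin_opP f g : (forall u, f u = g u) -> f = g.
Proof. by move=> fg; apply: val_inj; apply/funext. Qed.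

Fact lin_op_comp_subproof f g : f \o g \in linear_pred.
Proof. by apply/asboolP => a u v /=; rewrite !linearP. Qed.

Definition lin_op_comp f g := LinOp (lin_op_comp_subproof f g).

Fact lin_op_id_subproof : idfun \in linear_pred.
Proof. exact/asboolP. Qed.

Definition lin_op_id := LinOp lin_op_id_subproof.

Fact lin_op_compA : associative lin_op_comp.
Proof. by move=> f g k; apply: lin_opP. Qed.

Fact lin_op_id_comp : left_id lin_op_id lin_op_comp.
Proof. by move=> f; apply: lin_opP. Qed.

Fact lin_op_comp_id : right_id lin_op_id lin_op_comp.
Proof. by move=> f; apply: lin_opP. Qed.

Fact lin_op_compDl : left_distributive lin_op_comp +%R.
Proof. by move=> f g k; apply: lin_opP. Qed.

Fact lin_op_compDr : right_distributive lin_op_comp +%R.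
Proof. by move=> f g k; apply: lin_opP => u; exact: (raddfD f). Qed.

Fact lin_op_id_neq0 : lin_op_id != 0.
Proof.
apply/eqP => /(congr1 (fun f : lin_op => f 1)) /eqP.
by apply/negP; exact: oner_neq0.
Qed.

HB.instance Definition _ := GRing.Zmodule_isNzRing.Build lin_op lin_op_compA
  lin_op_id_comp lin_op_comp_id lin_op_compDl lin_op_compDr lin_op_id_neq0.

Fact lin_op_scaleAl a f g : a *: (f * g) = a *: f * g.
Proof. exact: lin_opP. Qed.

Fact lin_op_scaleAr a f g : a *: (f * g) = f * (a *: g).
Proof.
by apply: lin_opP => u; change (a *: f (g u) = f (a *: g u)); rewrite linearZ.
Qed.

HB.instance Definition _ := GRing.Lmodule_isLalgebra.Build K lin_op lin_op_scaleAl.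
HB.instance Definition _ := GRing.Lalgebra_isAlgebra.Build K lin_op lin_op_scaleAr.

Lemma lin_opME f g u : (f * g) u = f (g u). Proof. by []. Qed.
Lemma lin_opDE f g u : (f + g) u = f u + g u. Proof. by []. Qed.
Lemma lin_opZE a f u : (a *: f) u = a *: f u. Proof. by []. Qed.
Lemma lin_op_sumE (I : Type) (r : seq I) (P : pred I) (F : I -> lin_op) u :
  (\sum_(i <- r | P i) F i) u = \sum_(i <- r | P i) F i u.
Proof.
by elim/big_rec2: _ => // i a b _ <-; rewrite lin_opDE.
Qed.

End LinearOperators.

Section FreeAlgebraMorphism.
Variables (K : comNzRingType) (X : choiceType) (B : algType K) (g : X -> B).

Definition word_eval (w : fmonom X) : B := \prod_(x <- w : seq X) g x.

Fact word_eval_is_mmorphism : mmorphism word_eval.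
Proof.
split; last by rewrite /word_eval fm1 big_nil.
by move=> v w; rewrite /word_eval fmM big_cat.
Qed.

HB.instance Definition _ := monalg.isMultiplicative.Build (fmonom X) B word_eval
  word_eval_is_mmorphism.

Definition free_eval (p : free_algebra K X) : B :=
  mmap (in_alg B) word_eval p.

Fact free_eval_is_zmod_morphism : zmod_morphism free_eval.
Proof. exact: (@mmap_is_additive _ _ _ (in_alg B) word_eval). Qed.

Fact free_eval_is_monoid_morphism : monoid_morphism free_eval.
Proof.
have [|m1 m2] := @commr_mmap_is_multiplicative (fmonom X) K B (in_alg B) word_eval.
  by move=> p v w; rewrite /GRing.comm /= mulr_algl mulr_algr.
by split=> //; exact: m1.
Qed.

HB.instance Definition _ := GRing.isZmodMorphism.Build (free_algebra K X) B
  free_eval free_eval_is_zmod_morphism.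
HB.instance Definition _ := GRing.isMonoidMorphism.Build (free_algebra K X) B
  free_eval free_eval_is_monoid_morphism.

Lemma free_evalZ c p : free_eval (c *: p) = c *: free_eval p.
Proof. by rewrite [LHS]mmapZ /= mulr_algl. Qed.

Lemma free_eval_gen x : free_eval (free_gen K x) = g x.
Proof.
by rewrite [LHS]mmapU /= scale1r mul1r /word_eval fmU big_seq1.
Qed.
End FreeAlgebraMorphism.

Section PresentedAlgebraMorphism.
Variables (K : comNzRingType) (B D : algType K) (rel : B -> B -> Prop).
Variable (ev : {rmorphism B -> D}).
Hypothesis evZ : forall a x, ev (a *: x) = a *: ev x.
Hypothesis ev_rel : forall x y, rel x y -> ev x = ev y.
Hypothesis proper : ~ relation_ideal rel 1.

Lemma relation_ideal_eval x : relation_ideal rel x -> ev x = 0.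
Proof.
elim=> {x} [x y /ev_rel xy||x y _ ex _ ey|a x b _ ex].
- by rewrite rmorphB xy subrr.
- exact: rmorph0.
- by rewrite rmorphD ex ey addr0.
- by rewrite !rmorphM ex mulr0 mul0r.
Qed.

Lemma presented_eval : exists psi : presented proper -> D,
  [/\ forall x, psi (presented_pi proper x) = ev x, psi 1 = 1,
      forall x y, psi (x * y) = psi x * psi y
    & forall a x y, psi (a *: x + y) = a *: psi x + psi y].
Proof.
pose lift (p : presented proper) := projT1 (cid (presented_pi_surj p)).
have liftP p : p = presented_pi proper (lift p) := projT2 (cid (presented_pi_surj p)).
have pi_ev x y : presented_pi proper x = presented_pi proper y -> ev x = ev y.
  by move=> /eqP/presented_pi_eqP/relation_ideal_eval/eqP; rewrite rmorphB subr_eq0 => /eqP.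
exists (fun p => ev (lift p)); split=> [x||x y|a x y].
- exact/pi_ev/esym/liftP.
- rewrite -[RHS](rmorph1 ev); apply: pi_ev; apply: etrans (esym (liftP 1)) _.
  exact: esym (rmorph1 _).
- rewrite -rmorphM; apply: pi_ev; apply: etrans (esym (liftP _)) _.
  by rewrite rmorphM /= -!liftP.
- rewrite -evZ -rmorphD; apply: pi_ev; apply: etrans (esym (liftP _)) _.
  by rewrite linearP /= -!liftP.
Qed.
End PresentedAlgebraMorphism.

Section YangianRelMorphism.
Variables (C : numClosedFieldType) (hbar : C) (l : nat) (A : 'M[int]_l) (d : 'I_l -> nat).
Variables (B D : algType C) (ev : {rmorphism B -> D}).
Hypothesis evZ : forall a x, ev (a *: x) = a *: ev x.
Variables (H E F : 'I_l -> nat -> B).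
Implicit Types (f : nat -> B) (X Y : nat -> nat -> B).

Lemma morph_in_u f : (fun p q => ev (in_u f p q)) = in_u (ev \o f).
Proof. by apply/funext => p; apply/funext => q; rewrite /in_u rmorphMn. Qed.

Lemma morph_in_v f : (fun p q => ev (in_v f p q)) = in_v (ev \o f).
Proof. by apply/funext => p; apply/funext => q; rewrite /in_v rmorphMn. Qed.

Lemma morph_divdiff f : (fun p q => ev (divdiff f p q)) = divdiff (ev \o f).
Proof. by apply/funext => p; apply/funext => q; rewrite /divdiff rmorphMn rmorphN. Qed.

Lemma morph_series_mul X Y p q : ev (series_mul X Y p q) =
  series_mul (B := D) (fun p q => ev (X p q)) (fun p q => ev (Y p q)) p q.
Proof.
rewrite rmorph_sum; apply: eq_bigr => a _; rewrite rmorph_sum; apply: eq_bigr => b _.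
exact: rmorphM.
Qed.

Lemma morph_commutator x y : ev (commutator x y) = commutator (ev x) (ev y).
Proof. by rewrite rmorphB !rmorphM. Qed.

Lemma morph_H_series i : ev \o H_series H i = H_series (fun i s => ev (H i s)) i.
Proof. by apply/funext => -[|s] //=; rewrite rmorph1. Qed.

Lemma morph_EF_series (E' : 'I_l -> nat -> B) i : ev \o EF_series E' i = EF_series (fun i s => ev (E' i s)) i.
Proof. by apply/funext => -[|s] //=; rewrite rmorph0. Qed.

Lemma morph_serre_sum (E' : 'I_l -> nat -> B) i j n (t : 'I_n -> nat) r :
  ev (serre_sum E' i j t r) = serre_sum (fun i s => ev (E' i s)) i j t r.
Proof.
rewrite rmorph_sum; apply: eq_bigr => sg _.
by elim: (enum 'I_n) => //= k ks <-; rewrite morph_commutator.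
Qed.

(** Each relation is natural in the algebra, so a relation on the free generators can be checked on
    their images, as an identity between operators. *)
Lemma yangian_rel_morph x y : yangian_rel hbar A d H E F x y ->
  yangian_rel hbar A d (fun i s => ev (H i s)) (fun i s => ev (E i s))
    (fun i s => ev (F i s)) (ev x) (ev y).
Proof.
have sc X Y p q : ev (series_comm X Y p q) =
  series_comm (B := D) (fun p q => ev (X p q)) (fun p q => ev (Y p q)) p q.
  by rewrite rmorphB !morph_series_mul.
have sa X Y p q : ev (series_acomm X Y p q) =
  series_acomm (B := D) (fun p q => ev (X p q)) (fun p q => ev (Y p q)) p q.
  by rewrite rmorphD !morph_series_mul.
have ss f Y p q : ev (series_mul (series_sub (in_u f) (in_v f)) Y p q) =
  series_mul (B := D) (series_sub (in_u (ev \o f)) (in_v (ev \o f))) (fun p q => ev (Y p q)) p q.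
  rewrite morph_series_mul -morph_in_u -morph_in_v; congr series_mul.
  by apply/funext => a; apply/funext => b; rewrite /series_sub rmorphB.
have dd f p q : ev (divdiff f p q) = divdiff (ev \o f) p q.
  by rewrite -morph_divdiff.
have mE := (sc, sa, ss, dd, morph_serre_sum, morph_commutator,
  morph_in_u, morph_in_v, morph_divdiff, morph_H_series, morph_EF_series, rmorphB, evZ, rmorph0).
by case; intros; rewrite !mE; constructor.
Qed.
End YangianRelMorphism.

(** * The defining relations of the Yangian in terms of modes *)

Section YangianModeRelations.
Variables (C : numClosedFieldType) (hbar : C) (l : nat) (A : 'M[int]_l) (d : 'I_l -> nat).
Variables (B : algType C) (H E F : 'I_l -> nat -> B).
Local Notation c i j := ('i * hbar / 2%:R * (root_form A d i j)%:~R).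
Hypothesis relHH : forall i j p q, H i p * H j q = H j q * H i p.
Hypothesis relHE : forall i j, quadratic_relation (c i j) (H_series H i) (E j).
Hypothesis relHF : forall i j, quadratic_relation (- c i j) (H_series H i) (F j).
Hypothesis relEE : forall i j, quadratic_relation (c i j) (E i) (E j).
Hypothesis relFF : forall i j, quadratic_relation (- c i j) (F i) (F j).
Hypothesis relEF : forall i j p q,
  commutator (E i p) (F j q) = ('i * hbar * (i == j)%:R) *: H i (p + q)%N.
Hypothesis relEEE : forall i j n (t : 'I_n -> nat) r,
  i != j -> n%:Z = 1 - A i j -> serre_sum E i j t r = 0.
Hypothesis relFFF : forall i j n (t : 'I_n -> nat) r,
  i != j -> n%:Z = 1 - A i j -> serre_sum F i j t r = 0.

(** One quadratic relation for all pairs i, j covers both the relation of a node with itself and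
    that of adjacent nodes; its forms for F are those for E with c negated. *)
Lemma yangian_rel_modes x y : yangian_rel hbar A d H E F x y -> x = y.
Proof.
case=> {x y} [i j p q|i j p q|i j p q|i j p q|i p q|i p q|i j p q _ _
  |i j p q _ _|i j n t r ij nA|i j n t r ij nA].
- rewrite /series_comm series_mul_uv series_mul_vu.
  by case: p q => [|p] [|q] /=; rewrite ?mulr1 ?mul1r ?subrr // relHH subrr.
- exact: series_comm_quadratic.
- by rewrite -[c i j]opprK; exact: series_comm_quadratic.
- rewrite /series_comm series_mul_uv series_mul_vu.
  case: p q => [|p] [|q] /=; rewrite ?mulr0 ?mul0r ?subrr /divdiff ?scaler0 //.
  by rewrite mulr1n addSn addnS /= scaleNr scalerN opprK; exact: relEF.
- exact: series_comm_quadratic_self.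
- by rewrite -[c i i]opprK; exact: series_comm_quadratic_self.
- exact: (@series_comm_quadratic_adj _ _ _ (EF_series E i) (EF_series E j)).
- rewrite -[c i j]opprK.
  exact: (@series_comm_quadratic_adj _ _ _ (EF_series F i) (EF_series F j)).
- exact: relEEE.
- exact: relFFF.
Qed.
End YangianModeRelations.

(** * Expansions of rational functions *)

Section Expansions.
Variable M : comNzRingType.
Implicit Types (p q : {poly M}) (h : nat -> M).

Definition expansion_poly h n : {poly M} := \sum_(k < n.+1) h k *: 'X^(n - k).

Lemma coef_expansion_poly h n j : (expansion_poly h n)`_j = h (n - j)%N *+ (j <= n)%N.
Proof.
rewrite coef_sum; case: leqP => [jn|nj].
  rewrite (bigD1 (Ordinal (leq_subr j n : (n - j < n.+1)%N))) //= big1 => [|k kj].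
    by rewrite addr0 coefZ coefXn subKn // eqxx mulr1.
  rewrite coefZ coefXn; case: eqP => [e|]; last by rewrite mulr0.
  case/eqP: kj; apply: val_inj; by rewrite /= e subKn // -ltnS ltn_ord.
rewrite big1 // => k _; rewrite coefZ coefXn gtn_eqF ?mulr0 //.
by apply: leq_ltn_trans nj; exact: leq_subr.
Qed.

(** The coefficient ring may have zero divisors, so sizes of products are controlled through monic
    factors throughout. *)
Lemma size_monicM_le (q s : {poly M}) n : q \is monic ->
  (size (q * s)%R < size q + n)%N -> (size s <= n)%N.
Proof.
move=> mq; have [->|s0] := eqVneq s 0; first by rewrite size_poly0.
rewrite size_monicM // => e; rewrite -(leq_add2l (size q)).
by case: (size q + size s)%N e.
Qed.

Lemma size_prod_monic (I : finType) (P : pred I) (F : I -> {poly M}) :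
  (forall k, P k -> F k \is monic) ->
  (size (\prod_(k | P k) F k)).-1 = (\sum_(k | P k) (size (F k)).-1)%N.
Proof.
move=> mF; suff : \prod_(k | P k) F k \is monic /\
   (size (\prod_(k | P k) F k)).-1 = (\sum_(k | P k) (size (F k)).-1)%N by case.
elim/big_rec2: _ => [|k n p Pk [mp <-]]; first by rewrite monic1 size_poly1.
split; first by rewrite monicMl ?mF.
rewrite size_monicM ?mF ?monic_neq0 //.
move: (monic_neq0 (mF k Pk)) (monic_neq0 mp); rewrite -!size_poly_eq0; lia.
Qed.

Lemma size_monicM_lt (u v w : {poly M}) : u \is monic -> v \is monic ->
  (size w < size v)%N -> (size (u * w)%R < size (u * v)%R)%N.
Proof.
move=> mu mv wv; rewrite [size (u * v)]size_monicM ?monic_neq0 //.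
have [->|w0] := eqVneq w 0; rewrite ?mulr0 ?size_poly0 ?size_monicM //;
  move: wv (monic_neq0 mu); rewrite -!size_poly_eq0; lia.
Qed.

Lemma expansion_ratio (a b : M) p q p' q' h h' : q \is monic -> q' \is monic ->
  is_expansion p q h -> is_expansion p' q' h' ->
  ('X - a%:P) * p * q' = ('X - b%:P) * p' * q ->
  forall n, h n.+1 - a * h n = h' n.+1 - b * h' n.
Proof.
move=> mq mq' hpq hpq' e n; apply: subr0_eq.
have := hpq n.+1; have := hpq' n.+1.
rewrite -!/(expansion_poly _ n.+1).
set r := p * _ - _; set r' := p' * _ - _ => sr' sr.
have E : q * q' * (('X - a%:P) * expansion_poly h n.+1
    - ('X - b%:P) * expansion_poly h' n.+1)
  = ('X - b%:P) * (q * r') - ('X - a%:P) * (q' * r).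
  have -> : q * q' * (('X - a%:P) * expansion_poly h n.+1
    - ('X - b%:P) * expansion_poly h' n.+1) =
    ('X - a%:P) * q' * (q * expansion_poly h n.+1)
    - ('X - b%:P) * q * (q' * expansion_poly h' n.+1) by ring.
  have -> : q * expansion_poly h n.+1 = p * 'X^(n.+1) - r by rewrite subKr.
  have -> : q' * expansion_poly h' n.+1 = p' * 'X^(n.+1) - r' by rewrite subKr.
  have -> : ('X - a%:P) * q' * (p * 'X^(n.+1) - r) - ('X - b%:P) * q * (p' * 'X^(n.+1) - r')
   = (('X - a%:P) * p * q' - ('X - b%:P) * p' * q) * 'X^(n.+1)
     + ('X - b%:P) * (q * r') - ('X - a%:P) * (q' * r) by ring.
  by rewrite e subrr mul0r add0r.
have sz (u v w : {poly M}) : u \is monic -> v \is monic -> (size w < size v)%N ->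
    forall x : M, (size (('X - x%:P) * (u * w))%R < size (u * v)%R + 1)%N.
  move=> mu mv wv x; rewrite mulrA.
  have -> : (size (u * v)%R + 1)%N = size (('X - x%:P) * u * v).
    by rewrite -mulrA [RHS]size_monicM ?monicXsubC ?monic_neq0 ?monicMl // size_XsubC addn1.
  by apply: size_monicM_lt => //; rewrite monicMl ?monicXsubC.
have s1 : (size (('X - a%:P) * expansion_poly h n.+1
    - ('X - b%:P) * expansion_poly h' n.+1)%R <= 1)%N.
  apply: (@size_monicM_le (q * q')); first by rewrite monicMl.
  rewrite E; apply: leq_ltn_trans (size_polyD _ _) _.
  rewrite size_polyN gtn_max; apply/andP; split; first exact: sz.
  by rewrite mulrC [q * q']mulrC mulrC; exact: sz.
have := @leq_sizeP _ _ 1 s1 1%N isT.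
rewrite coefB !mulrBl !coefB !coefXM !coefCM /= !coef_expansion_poly /=.
by rewrite !subn0 subn1 /= !mulr1n.
Qed.

(** The bound on sizes says p/q - p'/q' = O(u^-N). *)
Lemma expansion_close N p q p' q' h h' : q \is monic -> q' \is monic ->
  is_expansion p q h -> is_expansion p' q' h' ->
  (size (p * q' - p' * q)%R + N <= size (q * q')%R)%N ->
  forall k, (k < N)%N -> h k = h' k.
Proof.
move=> mq mq' hpq hpq'; case: N => // N sN k kN.
have := hpq N; have := hpq' N; rewrite -!/(expansion_poly _ N).
set r := p * _ - _; set r' := p' * _ - _ => sr' sr.
have E : q * q' * (expansion_poly h N - expansion_poly h' N)
  = (p * q' - p' * q) * 'X^N + q * r' - q' * r.
  have -> : r' = p' * 'X^N - q' * expansion_poly h' N by [].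
  have -> : r = p * 'X^N - q * expansion_poly h N by [].
  ring.
have s0 : (size (expansion_poly h N - expansion_poly h' N)%R <= 0)%N.
  apply: (@size_monicM_le (q * q')); first by rewrite monicMl.
  rewrite addn0 E; apply: leq_ltn_trans (size_polyD _ _) _.
  rewrite size_polyN gtn_max; apply/andP; split; last by rewrite [q * q']mulrC; exact: size_monicM_lt.
  apply: leq_ltn_trans (size_polyD _ _) _; rewrite gtn_max; apply/andP; split; last exact: size_monicM_lt.
  have [->|x0] := eqVneq (p * q' - p' * q) 0.
    by rewrite mul0r size_poly0 size_monicM ?monic_neq0 //; move: (monic_neq0 mq) (monic_neq0 mq');
      rewrite -!size_poly_eq0; lia.
  by rewrite size_mulXn //; move: sN; lia.
have /eqP := @leq_sizeP _ _ 0 s0 (N - k)%N isT.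
rewrite coefB !coef_expansion_poly !leq_subr !mulr1n subKn; last by rewrite -ltnS.
by rewrite subr_eq0 => /eqP.
Qed.

Lemma expansion0 p q h : p \is monic -> q \is monic -> size p = size q ->
  is_expansion p q h -> h 0%N = 1.
Proof.
move=> mp mq spq hpq; have := hpq 0%N.
rewrite big_ord1 expr0 mulr1 -mul_polyC mulr1 => s.
have q0 : (0 < size q)%N by rewrite lt0n size_poly_eq0 monic_neq0.
have s' : (size (p - q * (h 0%N)%:P)%R <= (size q).-1)%N by rewrite -ltnS prednK.
have := @leq_sizeP _ _ _ s' _ (leqnn _).
rewrite coefB mulrC coefCM -/(lead_coef q) -{1}spq -/(lead_coef p).
by rewrite (monicP mp) (monicP mq) mulr1 => /eqP; rewrite subr_eq0 => /eqP.
Qed.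

Lemma expansion_polyS h n :
  expansion_poly h n.+1 = 'X * expansion_poly h n + (h n.+1)%:P.
Proof.
apply/polyP => -[|j]; rewrite coefD coefXM coefC !coef_expansion_poly /=.
  by rewrite subn0 mulr1n add0r.
by rewrite subSS ltnS addr0.
Qed.

(** [h n] is the constant coefficient of the quotient of p u^n by q. The next quotient is u times
    this one plus a constant, since u times the remainder has at most the size of q. *)
Lemma expansion_exists p q : q \is monic -> (size p <= size q)%N ->
  exists h, is_expansion p q h.
Proof.
move=> mq spq; pose Q n := Pdiv.Ring.rdivp (p * 'X^n) q; pose r n := Pdiv.Ring.rmodp (p * 'X^n) q.
have QE n : p * 'X^n = q * Q n + r n by rewrite [q * _]mulrC; exact: (Pdiv.RingMonic.rdivp_eq mq).
have sr n : (size (r n) < size q)%N by rewrite Pdiv.Ring.ltn_rmodpN0 ?monic_neq0.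
pose h n := (Q n)`_0.
suff Qh n : Q n = expansion_poly h n.
  exists h => n; rewrite -/(expansion_poly h n) -Qh QE addrC addKr; exact: sr.
elim: n => [|n IH].
  rewrite /expansion_poly big_ord1 expr0 alg_polyC; apply: size1_polyC.
  apply: (size_monicM_le mq).
  have -> : q * Q 0%N = p - r 0%N by rewrite -[p]mulr1 -(expr0 'X) QE addrK.
  apply: leq_ltn_trans (size_polyD _ _) _; rewrite size_polyN gtn_max.
  by move: spq (sr 0%N); lia.
rewrite expansion_polyS -IH.
have s1 : (size (- ('X * Q n) + Q n.+1)%R <= 1)%N.
  apply: (size_monicM_le mq).
  have -> : q * (- ('X * Q n) + Q n.+1) = 'X * r n - r n.+1.
    have e := QE n.+1; rewrite exprS in e.
    have -> : r n.+1 = p * ('X * 'X^n) - q * Q n.+1 by rewrite e addrC addKr.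
    have -> : r n = p * 'X^n - q * Q n by rewrite QE addrC addKr.
    ring.
  apply: leq_ltn_trans (size_polyD _ _) _; rewrite size_polyN gtn_max.
  apply/andP; split; last by rewrite addn1 ltnS ltnW.
  apply: leq_ltn_trans (size_polyMleq _ _) _; rewrite size_polyX addn1 ltnS /=.
  exact: sr.
rewrite -[LHS](addNKr ('X * Q n)) (size1_polyC s1); congr (_ + _%:P).
by rewrite coefD coefN coefXM oppr0 add0r.
Qed.

End Expansions.

Lemma size_map_poly_monic (M M' : comNzRingType) (f : {rmorphism M -> M'}) (q : {poly M}) :
  q \is monic -> size (map_poly f q) = size q.
Proof.
by move=> mq; rewrite size_map_poly_id0 // (monicP mq) rmorph1 oner_neq0.
Qed.

Lemma map_expansion (M M' : comNzRingType) (f : {rmorphism M -> M'}) (p q : {poly M}) h :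
  q \is monic -> is_expansion p q h ->
  is_expansion (map_poly f p) (map_poly f q) (f \o h).
Proof.
move=> mq hpq n; rewrite size_map_poly_monic //.
have -> : map_poly f p * 'X^n - map_poly f q * \sum_(k < n.+1) (f \o h) k *: 'X^(n - k)
    = map_poly f (p * 'X^n - q * \sum_(k < n.+1) h k *: 'X^(n - k)).
  rewrite rmorphB !rmorphM /= map_polyXn rmorph_sum; congr (_ - _ * _).
  by apply: eq_bigr => k _ /=; rewrite linearZ /= map_polyXn.
apply: leq_ltn_trans _ (hpq n); apply/leq_sizeP => j sj.
by rewrite coef_map /= (@leq_sizeP _ _ _ (leqnn _) j sj) rmorph0.
Qed.

(** * Partial fractions with simple poles over a commutative ring *)

Section PartialFractions.
Variables (M : comUnitRingType) (I : finType) (P : pred I) (x : I -> M).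
Hypothesis x_unit : forall i j, P i -> P j -> i != j -> x i - x j \is a GRing.unit.

Lemma uniq_roots_points (s : seq I) : uniq s -> all P s -> uniq_roots (map x s).
Proof.
elim: s => //= i s IH /andP[iNs us] /andP[Pi /[dup] Ps /allP Ps']; rewrite IH // andbT.
apply/allP => _ /mapP[j js ->]; rewrite /diff_roots mulrC eqxx /=.
by apply: x_unit => //; [exact: Ps'|apply: contraNneq iNs => <-].
Qed.

(** Zero divisors do no harm because the differences of the points are invertible. *)
Lemma poly_eq0_points (p : {poly M}) : (size p <= #|P|)%N ->
  (forall i, P i -> p.[x i] = 0) -> p = 0.
Proof.
move=> sp px; apply/eqP; apply: contraLR sp => p0; rewrite -ltnNge.
rewrite cardE -(size_map x); apply: max_ring_poly_roots => //.
  apply/allP => _ /mapP[i iP ->]; apply/rootP/px.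
  by rewrite mem_enum in iP.
by apply: uniq_roots_points; [exact: enum_uniq|apply/allP => i; rewrite mem_enum].
Qed.

Variable (p : {poly M}).
Hypotheses (p_monic : p \is monic) (size_p : size p = #|P|.+1).

Let Q := \prod_(i | P i) ('X - (x i)%:P).
Let Qi i := \prod_(j | P j && (j != i)) ('X - (x j)%:P).

Definition residue i := p.[x i] / \prod_(j | P j && (j != i)) (x i - x j).

Lemma size_prod_points (S : pred I) :
  size (\prod_(i | S i) ('X - (x i)%:P)) = #|S|.+1.
Proof. by rewrite -big_enum size_prod_XsubC cardE. Qed.

Lemma Q_Qi i : P i -> Q = ('X - (x i)%:P) * Qi i.
Proof. by move=> Pi; rewrite /Q (bigD1 i). Qed.

Lemma size_Qi i : P i -> (size (Qi i) <= #|P|)%N.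
Proof.
move=> Pi; rewrite size_prod_points (@eq_card _ _ [predD1 P & i]).
  by rewrite [leqRHS](cardD1 i) [i \in P]Pi.
by move=> j; rewrite !inE andbC.
Qed.

(** Lagrange interpolation of p - Q: both polynomials are monic of the same degree, and Q vanishes
    at the points. *)
Lemma partial_fractions_poly : p = Q + \sum_(i | P i) residue i *: Qi i.
Proof.
apply/eqP; rewrite -subr_eq0; apply/eqP/poly_eq0_points => [|i Pi].
  have sQ : size Q = #|P|.+1 by rewrite size_prod_points.
  rewrite opprD addrA; apply/leq_sizeP => j lj; rewrite coefB coef_sum big1 => [|i Pi]; last first.
    by rewrite coefZ (@leq_sizeP _ _ _ (size_Qi Pi)) ?mulr0.
  rewrite subr0 coefB; move: lj; rewrite leq_eqVlt => /orP[/eqP<-|lj].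
    have -> : p`_#|P| = 1 by rewrite -(monicP p_monic) /lead_coef size_p.
    suff -> : Q`_#|P| = 1 by rewrite subrr.
    by rewrite -(monicP (monic_prod_XsubC (index_enum I) P x)) /lead_coef -/Q sQ.
  by rewrite (@leq_sizeP _ p _ (leqnn _)) ?size_p // (@leq_sizeP _ Q _ (leqnn _)) ?sQ ?subrr.
rewrite hornerD hornerN hornerD (Q_Qi Pi) hornerM hornerXsubC subrr mul0r add0r.
rewrite horner_sum (bigD1 i) //= big1 => [|j /andP[Pj ji]].
  rewrite addr0 hornerZ horner_prod /residue.
  under [X in _ * X]eq_bigr do rewrite hornerXsubC.
  rewrite mulrVK ?subrr //.
  by rewrite rpred_prod // => j /andP[Pj ji]; apply: x_unit; rewrite // eq_sym.
rewrite hornerZ horner_prod (bigD1 i) 1?eq_sym ?Pi //= hornerXsubC subrr.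
by rewrite mul0r mulr0.
Qed.

Definition partial_fractions_series n : M :=
  if n is n'.+1 then \sum_(i | P i) residue i * x i ^+ n' else 1.

Lemma partial_fractions_expansion : is_expansion p Q partial_fractions_series.
Proof.
(* Truncated geometric series: u^n - x^n is divisible by u - x, which leaves [x i ^+ n *: Qi i] as
   remainder. *)
have QiX i n : P i ->
    Qi i * 'X^n = Q * (\sum_(k < n) x i ^+ k *: 'X^(n - k.+1)) + x i ^+ n *: Qi i.
  move=> Pi.
  have e : 'X^n - (x i ^+ n)%:P = ('X - (x i)%:P) * \sum_(k < n) x i ^+ k *: 'X^(n - k.+1).
    rewrite polyC_exp subrXX; congr (_ * _); apply: eq_bigr => k _.
    by rewrite -subn1 -subnDA add1n -polyC_exp -mul_polyC mulrC.
  rewrite (Q_Qi Pi) -mulrA mulrCA -e mulrBr -mul_polyC [Qi i * _%:P]mulrC.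
  by rewrite subrK.
move=> n; rewrite {1}partial_fractions_poly.
have -> : (Q + \sum_(i | P i) residue i *: Qi i) * 'X^n
    - Q * \sum_(k < n.+1) partial_fractions_series k *: 'X^(n - k)
    = \sum_(i | P i) (residue i * x i ^+ n) *: Qi i.
  rewrite big_ord_recl subn0 scale1r mulrDl mulrDr opprD addrACA subrr add0r.
  rewrite mulr_suml; under [X in X - _]eq_bigr => i Pi.
    rewrite -scalerAl QiX // scalerDr scalerA; over.
  rewrite big_split /= addrAC [X in X + _ = _](_ : _ = 0) ?add0r //.
  apply/eqP; rewrite subr_eq0; apply/eqP.
  transitivity (\sum_(i | P i) \sum_(k < n) Q * ((residue i * x i ^+ k) *: 'X^(n - k.+1))).
    apply: eq_bigr => i _; rewrite scalerAr scaler_sumr mulr_sumr.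
    by apply: eq_bigr => k _; rewrite scalerA.
  rewrite exchange_big mulr_sumr; apply: eq_bigr => k _.
  by rewrite /= scaler_suml mulr_sumr.
have sQ : size Q = #|P|.+1 by rewrite size_prod_points.
rewrite sQ ltnS; apply/leq_sizeP => j Ij; rewrite coef_sum big1 // => i Pi.
rewrite coefZ; suff -> : (Qi i)`_j = 0 by rewrite mulr0.
by apply: (@leq_sizeP _ _ _ (leqnn _)); apply: leq_trans Ij; exact: size_Qi.
Qed.

End PartialFractions.

(** * Cartan matrices of simple Lie algebras *)

Section LieRoots.
Variables (K : numFieldType) (g : vectType K) (br : g -> g -> g) (h : {vspace g}).
Hypothesis br_lie : lie_bracket br.
Local Notation dual := 'Hom(subvs_of h, K^o).
Implicit Types (x y z : g) (lam mu : dual) (t : subvs_of h).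

Lemma brDr x y z : br x (y + z) = br x y + br x z.
Proof. by have [l _ _ _] := br_lie; have := l x 1 y z; rewrite !scale1r. Qed.

Lemma brZr x a y : br x (a *: y) = a *: br x y.
Proof.
have [l _ _ _] := br_lie; have br0 : br x 0 = 0.
  by have := l x (-1) 0 0; rewrite scaler0 addr0 scaleN1r addNr.
by have := l x a y 0; rewrite br0 !addr0.
Qed.

Lemma br0r x : br x 0 = 0. Proof. by rewrite -[0 in LHS](scale0r 0) brZr scale0r. Qed.

Lemma brDl x y z : br (x + y) z = br x z + br y z.
Proof. by have [_ r _ _] := br_lie; have := r z 1 x y; rewrite !scale1r. Qed.

Lemma br_anti x y : br x y = - br y x.
Proof.
have [_ _ b0 _] := br_lie; have := b0 (x + y).
by rewrite brDl !brDr !b0 addr0 add0r => /eqP; rewrite addr_eq0 => /eqP.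
Qed.

Lemma br_sumr x (I : Type) (r : seq I) (P : pred I) (F : I -> g) :
  br x (\sum_(i <- r | P i) F i) = \sum_(i <- r | P i) br x (F i).
Proof. by apply: (big_morph (br x) (brDr x) (br0r x)). Qed.

Lemma brNr x y : br x (- y) = - br x y.
Proof. by rewrite -scaleN1r brZr scaleN1r. Qed.

Lemma brZl a x y : br (a *: x) y = a *: br x y.
Proof. by rewrite br_anti brZr -scalerN -br_anti. Qed.

Lemma jacobi x y z : br x (br y z) = br (br x y) z + br y (br x z).
Proof.
have [_ _ _ jac] := br_lie; have := jac x y z.
rewrite [br z x]br_anti [br z _]br_anti brNr => e.
by apply: (eq_from_subr e); zmod.
Qed.

Lemma root_vector_br lam mu x y : root_vector br lam x -> root_vector br mu y ->
  root_vector br (lam + mu) (br x y).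
Proof.
by move=> rx ry t; rewrite jacobi rx ry brZr brZl add_lfunE scalerDl.
Qed.

(** It serves to end a root string, whose vectors have distinct eigenvalues under a coroot. *)
Lemma eigen_independent (t : g) n (x : nat -> g) (ev : nat -> K) :
  (forall k, (k < n)%N -> x k != 0) -> (forall k, br t (x k) = ev k *: x k) ->
  (forall k k', ev k = ev k' -> k = k') -> (n <= \dim (fullv : {vspace g}))%N.
Proof.
move=> x0 xE evI.
have indep m (c : nat -> K) : (m <= n)%N -> \sum_(k < m) c k *: x k = 0 ->
    forall k, (k < m)%N -> c k = 0.
  elim: m c => // m IH c mn; rewrite big_ord_recr /= => s0.
  have c0 k : (k < m)%N -> c k = 0.
    move=> km; suff /eqP : c k * (ev k - ev m) = 0.
      by rewrite mulf_eq0 subr_eq0 => /orP[/eqP//|/eqP/evI kE]; rewrite kE ltnn in km.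
    apply: (IH (fun k => c k * (ev k - ev m))) => //; first exact: ltnW.
    have := congr1 (br t) s0; rewrite br0r brDr br_sumr brZr xE.
    have /(congr1 ( *:%R (ev m))) := s0; rewrite scaler0 scalerDr scaler_sumr => e1 e2.
    have e := etrans e2 (esym e1); apply: (eq_from_subr e).
    have -> : c m *: (ev m *: x m) = ev m *: (c m *: x m) by rewrite !scalerA mulrC.
    have -> : \sum_(i < m) (c i * (ev i - ev m)) *: x i
       = \sum_(i < m) br t (c i *: x i) - \sum_(i < m) ev m *: (c i *: x i).
      rewrite -sumrB; apply: eq_bigr => i _.
      by rewrite brZr xE !scalerA mulrBr scalerBl [ev m * _]mulrC.
    zmod.
  move: s0; rewrite big1 => [|k _]; last by rewrite c0 ?scale0r.
  rewrite add0r => /eqP; rewrite scaler_eq0 (negbTE (x0 m mn)) orbF => /eqP cm.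
  by move=> k; rewrite ltnS leq_eqVlt => /orP[/eqP->//|]; exact: c0.
have fX : free (mktuple (fun k : 'I_n => x k)).
  apply/freeP => c s0 i.
  have := @indep n (fun k => if insub k is Some k' then c k' else 0) (leqnn n).
  move=> /(_ _ i (ltn_ord i)); rewrite valK; apply.
  rewrite -[RHS]s0; apply: eq_bigr => k _.
  by rewrite valK -tnth_nth tnth_mktuple.
have := dimvS (subvf <<mktuple (fun k : 'I_n => x k)>>%VS).
by move: fX; rewrite /free size_tuple => /eqP->.
Qed.

Variables (b : {vspace g}) (l : nat) (alpha : l.-tuple dual).
Hypothesis alpha_simple : simple_roots br b alpha.
Variable alphav : 'I_l -> subvs_of h.
Hypothesis alphav_coroot : forall i, is_coroot br (tnth alpha i) (alphav i).
Variable A : 'M[int]_l.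
Hypothesis A_cartan : forall i j, (A i j)%:~R = tnth alpha j (alphav i) :> K.

Local Notation al i := (tnth alpha i).

Definition weight_sum (c : 'I_l -> nat) : dual := \sum_i al i *+ c i.

Lemma alpha_coef (c c' : 'I_l -> K) :
  \sum_i c i *: al i = \sum_i c' i *: al i -> c =1 c'.
Proof.
have [/andP[_ /freeP fa] _ _ _] := alpha_simple; move=> e i; apply/eqP.
rewrite -subr_eq0; apply/eqP; move: i; apply: fa.
transitivity (\sum_i c i *: al i - \sum_i c' i *: al i); last by rewrite e subrr.
by rewrite -sumrB; apply: eq_bigr => i _; rewrite scalerBl -tnth_nth.
Qed.

Lemma weight_sumZ c : weight_sum c = \sum_i (c i)%:R *: al i.
Proof. by apply: eq_bigr => i _; rewrite scaler_nat. Qed.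

Lemma weight_sumE c t : (weight_sum c t : K) = \sum_i (al i t : K) *+ c i.
Proof.
rewrite weight_sumZ sum_lfunE; apply: eq_bigr => i _.
by rewrite scale_lfunE [LHS]mulr_natl.
Qed.

Lemma alphaE i : al i = \sum_j (j == i)%:R *: al j.
Proof.
rewrite (bigD1 i) //= eqxx scale1r big1 ?addr0 // => j /negbTE->.
by rewrite scale0r.
Qed.

Lemma A_diag i : A i i = 2.
Proof.
apply: (@intr_inj K); rewrite A_cartan; have [-> _] := alphav_coroot i.
by rewrite rmorph_nat.
Qed.

(* [f'] generates a finite-dimensional module with highest weight [- A i j] over
   the [sl_2]-triple of the root [al i], since [br e f' = 0]. *)
Lemma A_offdiag_le0 i j : i != j -> A i j <= 0.
Proof.
move=> ij; have [ai2 [e [f [re rf tE]]]] := alphav_coroot i.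
have [aj2 [e' [f' [re' rf' tE']]]] := alphav_coroot j.
have f'0 : f' != 0.
  apply/eqP => f0; rewrite f0 br0r in tE'; move: aj2.
  have -> : alphav j = 0 by apply: val_inj; rewrite [LHS]tE'.
  by rewrite linear0 => /esym/eqP; rewrite pnatr_eq0.
have [_ _ rootE _] := alpha_simple.
have wE (k : nat) : - al j - al i *+ k = \sum_s (- (s == j)%:R - (s == i)%:R * k%:R) *: al s.
  under eq_bigr do rewrite scalerBl scaleNr mulrC -scalerA.
  by rewrite sumrB sumrN -scaler_sumr -!alphaE scaler_nat.
(* A nonzero [e, f'] would make [al i - al j] a root with coefficients of both signs. *)
have ef0 : br e f' = 0.
  apply/eqP; apply: contraT => ef0; exfalso.
  have r := root_vector_br re rf'.
  have wD : al i - al j = \sum_s ((s == i)%:R - (s == j)%:R) *: al s.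
    by under eq_bigr do rewrite scalerBl; rewrite sumrB -!alphaE.
  have r0 : al i - al j != 0.
    apply/eqP => e0; have : \sum_s ((s == i)%:R - (s == j)%:R) *: al s = \sum_s 0 *: al s.
      by rewrite -wD e0 big1 // => s _; rewrite scale0r.
    move=> /alpha_coef/(_ i); rewrite eqxx (negbTE ij) subr0 => /eqP.
    by rewrite oner_eq0.
  have [|c [cE|cE]] := rootE (al i - al j); first by split=> //; exists (br e f').
    move: cE; rewrite -/(weight_sum c) weight_sumZ wD => /alpha_coef/(_ j).
    rewrite eqxx eq_sym (negbTE ij) sub0r => /esym/eqP.
    by rewrite eq_sym lt_eqF // (lt_le_trans _ (ler0n _ _)) // oppr_lt0.
  move: cE; rewrite -/(weight_sum c) weight_sumZ wD -sumrN.
  under [RHS]eq_bigr do rewrite -scaleNr.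
  move=> /alpha_coef/(_ i); rewrite eqxx (negbTE ij) subr0 => /eqP.
  by rewrite gt_eqF // (le_lt_trans _ ltr01) // oppr_le0.
pose v k := iter k (br f) f'.
have vw k : root_vector br (- al j - al i *+ k) (v k).
  elim: k => [|k IH]; first by rewrite mulr0n subr0.
  have := root_vector_br rf IH; rewrite mulrS opprD addrCA; exact.
pose L : K := - (A i j)%:~R.
have tv k : br (vsval (alphav i)) (v k) = (L - k%:R *+ 2) *: v k.
  rewrite vw; congr (_ *: _).
  rewrite wE sum_lfunE; under eq_bigr do rewrite scale_lfunE.
  rewrite (bigD1 j) //= (bigD1 i) //= big1 => [|s /andP[sj si]].
    rewrite !eqxx [j == i]eq_sym (negbTE ij) mul0r subr0 oppr0 sub0r addr0 mul1r.
    by rewrite ai2 -A_cartan /L /GRing.scale /= mulN1r mulNr mulr_natr.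
  by rewrite (negbTE sj) (negbTE si) oppr0 mul0r subr0 scale0r.
have vS k : v k.+1 = br f (v k) by [].
have ev_k k : br e (v k.+1) = (k.+1%:R * (L - k%:R)) *: v k.
  elim: k => [|k IH].
    by rewrite vS jacobi ef0 br0r addr0 -tE tv mul0rn mul1r.
  rewrite [v k.+2]vS jacobi -tE tv IH brZr -vS -scalerDl; congr (_ *: _).
  by rewrite -!natr1; ring.
(* The eigenvalues L - 2 k are distinct, so the chain ends; at its last vector [v n], [ev_k] gives L
   = n, that is A i j = - n. *)
have [n vn0 vn] : exists2 n, v n.+1 = 0 & v n != 0.
  apply: contrapT => no.
  have vk0 k : v k != 0.
    elim: k => // k IH; apply/eqP => v0; apply: no; by exists k.
  have := @eigen_independent (vsval (alphav i)) (\dim (fullv : {vspace g})).+1 v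
    (fun k => L - k%:R *+ 2) (fun k _ => vk0 k) tv.
  rewrite ltnn => /(_ _)/notF; apply => k k' /addrI/oppr_inj/eqP.
  by rewrite -!mulrnA eqr_nat eqn_pmul2r // => /eqP.
have := ev_k n; rewrite vn0 br0r => /esym/eqP.
rewrite scaler_eq0 (negbTE vn) orbF mulf_eq0 pnatr_eq0 /= subr_eq0 /L -mulrNz => /eqP.
by rewrite pmulrn => /intr_inj; lia.
Qed.

(* The coefficients of the sum of the positive roots: for [e, f] spanning the
   root spaces of [al i] and [- al i], the trace of [[e, f]] vanishes on the sum
   of the positive root spaces whose roots are not multiples of [al i]. *)
Lemma exists_coroot_positive_sum : exists w : 'I_l -> nat, forall i, 0 < \sum_j A i j * (w j)%:Z.
Proof.
pose pos x (c : 'I_l -> nat) := [/\ root_vector br (weight_sum c) x, x != 0 & exists j, c j != 0%N].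
pose good n := `[< exists X : n.-tuple g, free X /\
   forall k, exists c, pos (tnth X k) c >].
have good0 : exists n, good n.
  by exists 0%N; apply/asboolP; exists [tuple]; split=> [|[]//]; rewrite nil_free.
have good_le n : good n -> (n <= \dim (fullv : {vspace g}))%N.
  move=> /asboolP[X [fX _]]; have := dimvS (subvf <<X>>%VS).
  by move: fX; rewrite /free size_tuple => /eqP->.
(* A free family of maximal size among the root vectors of positive weight spans all of these. *)
case: (ex_maxnP good0 good_le) => n /asboolP[X [fX posX]] maxn.
have [c cP] : exists c : 'I_n -> 'I_l -> nat, forall k, pos (tnth X k) (c k).
  by have [c cP] := choice posX; exists c.
have spanX x cx : pos x cx -> x \in <<X>>%VS.
  move=> px; apply: contraT => xX; suff : (n.+1 <= n)%N by rewrite ltnn.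
  apply: maxn; apply/asboolP; exists [tuple of x :: X].
  split; first by rewrite free_cons xX.
  move=> k; case: (unliftP ord0 k) => [k' ->|->]; last by exists cx.
  by exists (c k'); rewrite tnthS; exact: cP.
have weight_inj c1 c2 : weight_sum c1 = weight_sum c2 -> c1 =1 c2.
  rewrite !weight_sumZ => /alpha_coef e i; have := e i.
  by move/eqP; rewrite eqr_nat => /eqP.
have rk (k : 'I_n) t : br (vsval t) X`_k = (weight_sum (c k) t : K) *: X`_k.
  by have [r _ _] := cP k; rewrite -tnth_nth r.
have coordE x k cx : root_vector br (weight_sum cx) x -> x \in <<X>>%VS ->
   coord X k x != 0 -> c k =1 cx.
  move=> rx xX xk; apply: weight_inj; apply/lfunP => t.
  have := congr1 (coord X k) (rx t); rewrite linearZ /=.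
  rewrite {1}(coord_span xX) br_sumr linear_sum (bigD1 k) //= big1 => [|i ik].
    by rewrite brZr rk !linearZ /= coord_free // eqxx mulr1 addr0 mulrC => /(mulIf xk).
  by rewrite brZr rk !linearZ /= coord_free // (negbTE ik) !mulr0.
exists (fun j => \sum_(k < n) c k j)%N => i.
have [ai2 [e [f [re rf tE]]]] := alphav_coroot i.
pose t := alphav i.
pose N := [pred k | [exists j, (j != i) && (c k j != 0%N)]].
have wE : (\sum_j A i j * (\sum_(k < n) c k j)%N%:Z)%:~R = \sum_(k < n) weight_sum (c k) t :> K.
  rewrite rmorph_sum /=; under [RHS]eq_bigr do rewrite weight_sumE.
  rewrite exchange_big; apply: eq_bigr => j _ /=.
  rewrite rmorphM /= A_cartan -/t -pmulrn natr_sum mulr_sumr.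
  by apply: eq_bigr => k _; rewrite mulr_natr.
have rX k : root_vector br (weight_sum (c k)) X`_k.
  by have [r _ _] := cP k; rewrite -tnth_nth.
have wC (c1 c2 : 'I_l -> K) : \sum_s c1 s *: al s + \sum_s c2 s *: al s = \sum_s (c1 s + c2 s) *: al s.
  by rewrite -big_split; apply: eq_bigr => s _; rewrite scalerDl.
(* Adding or subtracting [al i] keeps the coefficient of some j != i positive, so the root stays
   positive and is no multiple of [al i]: e and f preserve the span of N. *)
have stepE k : k \in N -> br e X`_k \in <<X>>%VS /\
    forall k', coord X k' (br e X`_k) != 0 -> k' \in N.
  move=> /existsP[j /andP[ji ckj]].
  have := root_vector_br re (rX k).
  have -> : al i + weight_sum (c k) = weight_sum (fun s => (s == i) + c k s)%N.
    rewrite (alphaE i) !weight_sumZ wC; apply: eq_bigr => s _.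
    by rewrite natrD.
  move=> r; have sp : br e X`_k \in <<X>>%VS.
    have [->|e0] := eqVneq (br e X`_k) 0; first exact: mem0v.
    by apply: (spanX _ (fun s => (s == i) + c k s)%N); split=> //; exists j; rewrite (negbTE ji).
  split=> // k' /(coordE _ _ _ r sp) ck'; apply/existsP; exists j.
  by rewrite ji ck' (negbTE ji).
have stepF k : k \in N -> br f X`_k \in <<X>>%VS /\
    forall k', coord X k' (br f X`_k) != 0 -> k' \in N.
  move=> /existsP[j /andP[ji ckj]].
  have := root_vector_br rf (rX k).
  have wD : - al i + weight_sum (c k) = \sum_s (- (s == i)%:R + (c k s)%:R) *: al s.
    rewrite (alphaE i) weight_sumZ -sumrN; under eq_bigr do rewrite -scaleNr.
    exact: wC.
  move=> r; have [->|f0] := eqVneq (br f X`_k) 0.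
    by split=> [|k']; rewrite ?mem0v ?linear0 ?eqxx.
  have r0 : - al i + weight_sum (c k) != 0.
    apply/eqP => r0; have : \sum_s (- (s == i)%:R + (c k s)%:R) *: al s = \sum_s 0 *: al s.
      by rewrite -wD r0 big1 // => s _; rewrite scale0r.
    move=> /alpha_coef/(_ j); rewrite (negbTE ji) oppr0 add0r => /eqP.
    by rewrite pnatr_eq0 (negbTE ckj).
  have [_ _ rootE _] := alpha_simple.
  have [|c' [cE|cE]] := rootE (- al i + weight_sum (c k)); first by split=> //; exists (br f X`_k).
    have cj : c' j = c k j.
      move: cE; rewrite wD -/(weight_sum c') weight_sumZ => /alpha_coef/(_ j).
      by rewrite (negbTE ji) oppr0 add0r => /eqP; rewrite eqr_nat => /eqP.
    rewrite cE -/(weight_sum c') in r.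
    have sp : br f X`_k \in <<X>>%VS.
      by apply: (spanX _ c'); split=> //; exists j; rewrite cj.
    split=> // k' /(coordE _ _ _ r sp) ck'; apply/existsP; exists j.
    by rewrite ji ck' cj.
  move: cE; rewrite wD -/(weight_sum c') weight_sumZ -sumrN.
  under [RHS]eq_bigr do rewrite -scaleNr.
  move=> /alpha_coef/(_ j); rewrite (negbTE ji) oppr0 add0r => /eqP.
  by rewrite gt_eqF // (@le_lt_trans _ _ 0) ?oppr_le0 ?ler0n // ltr0n lt0n.
pose Ec k k' := coord X k' (br e X`_k).
pose Fc k k' := coord X k' (br f X`_k).
have coordN (u : g) (G : 'I_n -> K) : u \in <<X>>%VS -> (forall k', coord X k' u != 0 -> k' \in N) ->
    \sum_k' coord X k' u * G k' = \sum_(k' in N) coord X k' u * G k'.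
  move=> _ uN; rewrite [LHS](bigID (mem N)) /= [X in _ + X]big1 ?addr0 // => k' k'N.
  by apply/eqP; rewrite mulf_eq0; apply/orP; left; apply: contraNT k'N => /uN.
have trE k : k \in N -> (weight_sum (c k) t : K) =
    \sum_(k' in N) (Fc k k' * Ec k' k) - \sum_(k' in N) (Ec k k' * Fc k' k).
  move=> kN; have [sE uE] := stepE k kN; have [sF uF] := stepF k kN.
  have := congr1 (coord X k) (rk k t).
  rewrite linearZ /= coord_free // eqxx mulr1 => <-.
  have -> : br (vsval t) X`_k = br e (br f X`_k) - br f (br e X`_k).
    by rewrite jacobi -tE addrK.
  rewrite linearB /=; congr (_ - _).
    rewrite -(coordN (br f X`_k) (fun k' => Ec k' k)) // {1}(coord_span sF) br_sumr linear_sum.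
    by apply: eq_bigr => k' _; rewrite brZr linearZ.
  rewrite -(coordN (br e X`_k) (fun k' => Fc k' k)) // {1}(coord_span sE) br_sumr linear_sum.
  by apply: eq_bigr => k' _; rewrite brZr linearZ.
(* In coordinates, this is tr(ef) = tr(fe) on the span of N. *)
have tr0 : \sum_(k in N) (weight_sum (c k) t : K) = 0.
  rewrite (eq_bigr _ trE) sumrB [X in _ - X]exchange_big /=; apply/eqP; rewrite subr_eq0.
  by apply/eqP; apply: eq_bigr => k _; apply: eq_bigr => k' _; rewrite mulrC.
have cN k : k \notin N -> forall j, j != i -> c k j = 0%N.
  move=> kN j ji; apply/eqP; apply: contraNT kN => ckj.
  by apply/existsP; exists j; rewrite ji.
have wN k : k \notin N -> (weight_sum (c k) t : K) = (2 * c k i)%:R.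
  move=> kN; rewrite weight_sumE (bigD1 i) //= big1 => [|j ji].
    by rewrite addr0 ai2 -mulrnA.
  by rewrite (cN k kN j ji).
have e0 : e != 0.
  apply/eqP => e0; rewrite e0 br_anti br0r oppr0 in tE; move: ai2.
  have -> : alphav i = 0 by apply: val_inj; rewrite [LHS]tE.
  by rewrite linear0 => /esym/eqP; rewrite pnatr_eq0.
have re' : root_vector br (weight_sum (fun s => s == i : nat)) e.
  by rewrite weight_sumZ -alphaE.
have eX : e \in <<X>>%VS.
  by apply: (spanX _ (fun s => s == i : nat)); split=> //; exists i; rewrite eqxx.
(* [e] lies in the span and has weight [al i], so some basis vector has this weight; it makes the
   sum of the [2 * c k i] over k outside N positive. *)
have [k0 k0N k0i] : exists2 k, k \notin N & c k i != 0%N.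
  have [k ek] : exists k, coord X k e != 0.
    apply/existsP; apply: contraNT e0 => /existsPn ek; rewrite (coord_span eX) big1 // => k _.
    by have := ek k; rewrite negbK => /eqP->; rewrite scale0r.
  have ck := coordE _ _ _ re' eX ek.
  exists k; last by rewrite ck eqxx.
  by apply/existsP => -[j /andP[ji]]; rewrite ck (negbTE ji).
rewrite -(ltr0z K) wE (bigID (mem N)) /= tr0 add0r (eq_bigr _ wN) -natr_sum ltr0n.
by rewrite (bigD1 k0) //= ltn_addr // muln_gt0 /= lt0n.
Qed.

(** As d_i a_ij is symmetric, scaling by d turns the positive values on the coroots into a positive
    combination of rows. It tells how many extra variables to put at each node in order to raise the
    degrees of the R_i. *)
Lemma exists_positive_combination (d : 'I_l -> nat) : (forall i, (0 < d i)%N) ->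
  (forall i j, (d i)%:Z * A i j = (d j)%:Z * A j i) ->
  exists m : 'I_l -> nat, forall i, 0 < \sum_j (m j)%:Z * A j i.
Proof.
move=> d0 dA; have [w w0] := exists_coroot_positive_sum; exists (fun j => d j * w j)%N => i.
have -> : \sum_j (d j * w j)%N%:Z * A j i = (d i)%:Z * \sum_j A i j * (w j)%:Z.
  rewrite mulr_sumr; apply: eq_bigr => j _; rewrite PoszM mulrA dA; ring.
by rewrite mulr_gt0 // ltz_nat.
Qed.

End LieRoots.

Fact commutator_is_zmod_morphism (B : nzRingType) (x : B) : zmod_morphism (commutator x).
Proof. by move=> u v; rewrite /commutator mulrBr mulrBl; zmod. Qed.

HB.instance Definition _ (B : nzRingType) (x : B) :=
  GRing.isZmodMorphism.Build B B (commutator x) (commutator_is_zmod_morphism x).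

(** * Difference operators *)

Section MultiplicationOperators.
Variables (K : comNzRingType) (M : comAlgType K).
Implicit Types (a b : M) (T : {lrmorphism M -> M}).

Fact mul_op_subproof a : ( *%R a) \in @linear_pred K M.
Proof. by apply/asboolP => c u v; rewrite mulrDr scalerAr. Qed.

Definition mul_op a : lin_op M := LinOp (mul_op_subproof a).

Fact shift_op_subproof T : (T : M -> M) \in @linear_pred K M.
Proof. by apply/asboolP => c u v; rewrite linearP. Qed.

Definition shift_op T : lin_op M := LinOp (shift_op_subproof T).

Fact mul_op_is_zmod_morphism : zmod_morphism mul_op.
Proof. by move=> a b; apply: lin_opP => u; rewrite [LHS]mulrBl. Qed.

Fact mul_op_is_monoid_morphism : monoid_morphism mul_op.
Proof.
split; first by apply: lin_opP => u; rewrite [LHS]mul1r.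
by move=> a b; apply: lin_opP => u; exact/esym/mulrA.
Qed.

Fact mul_op_is_scalable : scalable mul_op.
Proof. by move=> c a; apply: lin_opP => u; exact/esym/scalerAl. Qed.

HB.instance Definition _ := GRing.isZmodMorphism.Build M (lin_op M) mul_op
  mul_op_is_zmod_morphism.
HB.instance Definition _ := GRing.isMonoidMorphism.Build M (lin_op M) mul_op
  mul_op_is_monoid_morphism.
HB.instance Definition _ := GRing.isScalable.Build K M (lin_op M) *:%R mul_op
  mul_op_is_scalable.

Lemma shift_mul_op T a : shift_op T * mul_op a = mul_op (T a) * shift_op T.
Proof. by apply: lin_opP => u; exact: rmorphM. Qed.

Lemma shift_opC T1 T2 : (forall u, T1 (T2 u) = T2 (T1 u)) ->
  shift_op T1 * shift_op T2 = shift_op T2 * shift_op T1.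
Proof. by move=> T12; apply: lin_opP => u; exact: T12. Qed.

End MultiplicationOperators.

Section Currents.
Variables (K : numFieldType) (M : comUnitAlgType K) (V : finType).
Variables (z : V -> M) (T : V -> {lrmorphism M -> M}).
Implicit Types (P : pred V) (a b : V -> M) (c s : K).
Hypothesis T_comm : forall v w u, T v (T w u) = T w (T v u).

Local Notation S v := (shift_op (T v)).

(* Coefficient of [u^-(r+1)] in [\sum_(v | P v) a_v / (u - z_v) T_v]. *)
Definition current a P r : lin_op M :=
  \sum_(v | P v) mul_op (a v * z v ^+ r) * S v.

Lemma mul_shift_op (a : M) v (b : M) w :
  mul_op a * S v * (mul_op b * S w) = mul_op (a * T v b) * (S v * S w).
Proof. by rewrite mulrA -(mulrA (mul_op a)) shift_mul_op mulrA -rmorphM /= -!mulrA. Qed.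

Lemma current_quadratic c a P1 P2 :
  (forall v w, P1 v -> P2 w -> v != w -> T v (z w) = z w /\ T w (z v) = z v) ->
  (forall v w, P1 v -> P2 w -> v != w ->
     (z v - z w - c%:A) * (a v * T v (a w)) = (z v - z w + c%:A) * (a w * T w (a v))) ->
  (forall v, P1 v -> P2 v -> T v (z v) = z v - c%:A) ->
  quadratic_relation c (current a P1) (current a P2).
Proof.
(* [k] is [c%:A] made opaque, so that [ring] sees an atom. *)
have [k kE] : exists k, k = c%:A :> M by exists c%:A.
have scE u : c *: u = k * u by rewrite kE mulr_algl.
rewrite -kE => Tz aT Tzz p q; rewrite /current.
have mulE p' q' : current a P1 p' * current a P2 q' = \sum_(v | P1 v) \sum_(w | P2 w)
    mul_op (a v * z v ^+ p' * T v (a w * z w ^+ q')) * (S v * S w).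
  rewrite mulr_suml; apply: eq_bigr => v _; rewrite mulr_sumr.
  by apply: eq_bigr => w _; rewrite mul_shift_op.
have mulE' p' q' : current a P2 q' * current a P1 p' = \sum_(v | P1 v) \sum_(w | P2 w)
    mul_op (a w * z w ^+ q' * T w (a v * z v ^+ p')) * (S v * S w).
  rewrite mulr_suml exchange_big; apply: eq_bigr => w _; rewrite mulr_sumr.
  by apply: eq_bigr => v _; rewrite mul_shift_op (shift_opC (T_comm v w)).
rewrite -!/(current _ _ _) !mulE !mulE' !scaler_sumr -!sumrB -big_split /=.
apply: eq_bigr => v Pv; rewrite !scaler_sumr -!sumrB -big_split /=.
apply: eq_bigr => w Pw; rewrite !scalerAl -!linearZ -!mulrBl -!mulrDl -!rmorphB -rmorphD /=.
congr (mul_op _ * _); rewrite !rmorphM !rmorphXn /= !scE !exprS.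
(* For v = w the coefficients agree by T v (z v) = z v - k; for v != w they differ by the identity
   between the weights, times z_v^p z_w^q. *)
case: (eqVneq v w) Pw => [<-|vw] Pw.
  by rewrite (Tzz v) //; ring.
have [-> ->] := Tz _ _ Pv Pw vw; have e := aT _ _ Pv Pw vw.
transitivity ((z v - z w - k) * (a v * T v (a w)) * (z v ^+ p * z w ^+ q)); first by ring.
by rewrite e; ring.
Qed.

Lemma quadratic_mul_op_current c (h : nat -> M) a P :
  (forall v, P v -> forall p, h p.+1 - (z v + c%:A) * h p
     = T v (h p.+1) - (z v - c%:A) * T v (h p)) ->
  quadratic_relation c (fun p => mul_op (h p)) (current a P).
Proof.
have [k kE] : exists k, k = c%:A :> M by exists c%:A.
have scE u : c *: u = k * u by rewrite kE mulr_algl.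
rewrite -kE => hT p q /=; rewrite /current !mulr_sumr !mulr_suml !scaler_sumr -!sumrB -big_split.
apply: eq_bigr => v Pv /=.
have l (b : M) r : mul_op b * (mul_op (a v * z v ^+ r) * S v) = mul_op (b * (a v * z v ^+ r)) * S v.
  by rewrite mulrA -rmorphM.
have r (b : M) (s' : nat) : mul_op (a v * z v ^+ s') * S v * mul_op b = mul_op (a v * z v ^+ s' * T v b) * S v.
  by rewrite -mulrA shift_mul_op mulrA -rmorphM.
rewrite !l !r !scalerAl -!linearZ -!mulrBl -!mulrDl -!rmorphB -rmorphD /=.
congr (mul_op _ * _); rewrite !scE !exprS.
have e := hT _ Pv p.
transitivity ((h p.+1 - (z v + k) * h p) * (a v * z v ^+ q)); first by ring.
by rewrite e; ring.
Qed.

(** With the weights divided by z_v - z_w + c, the current and the term at w satisfy the hypotheses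
    of [ordered_sum_commutator]: multiplication by z_v raises the mode, and the identity between the
    weights of v and w replaces c by - c when the term at w is moved to the right. The factor t = n
    - 1 of the resulting product is zero. *)
Lemma current_serre c s a P w n (t : 'I_n -> nat) r :
  (0 < n)%N -> c *+ 2 + n.-1%:R * s = 0 -> ~~ P w ->
  (forall v v', P v -> P v' -> v != v' -> T v (z v') = z v') ->
  (forall v, P v -> T v (z v) = z v - s%:A) ->
  (forall v, P v -> T v (z w) = z w /\ T w (z v) = z v) ->
  (forall v, P v -> z v - z w + c%:A \is a GRing.unit) ->
  (forall v v', P v -> P v' -> v != v' ->
     (z v - z v' - s%:A) * (a v * T v (a v')) = (z v - z v' + s%:A) * (a v' * T v' (a v))) ->
  (forall v, P v -> (z v - z w - c%:A) * (a v * T v (a w))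
                  = (z v - z w + c%:A) * (a w * T w (a v))) ->
  \sum_(sg : 'S_n) foldr (fun k x => commutator (current a P (t (sg k))) x)
    (mul_op (a w * z w ^+ r) * S w) (enum 'I_n) = 0.
Proof.
have [k kE] : exists k, k = c%:A :> M by exists c%:A.
have scE u : c *: u = k * u by rewrite kE mulr_algl.
have Tk v : T v k = k by rewrite kE rmorph_alg.
rewrite -kE => n0 c0 Pw Tzz Tz Tzw zU aT awT.
pose a' v := (z v - z w + k)^-1 * a v.
pose y := current a' P.
pose e : lin_op M := mul_op (a w * z w ^+ r) * S w.
pose zeta : lin_op M := mul_op (z w).
have vw v : P v -> v != w by move=> Pv; apply: contraNneq Pw => <-.
have zl (u : M) v : zeta * (mul_op u * S v) = mul_op (z w * u) * S v.
  by rewrite mulrA -rmorphM.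
have xE p : current a P p = y p.+1 + c *: y p - zeta * y p.
  rewrite /y /current mulr_sumr scaler_sumr -big_split -sumrB; apply: eq_bigr => v Pv /=.
  rewrite zl scalerAl -linearZ -mulrDl -mulrBl -rmorphD -rmorphB /=.
  congr (mul_op _ * _); rewrite /a' exprS scE.
  apply: (mulrI (zU v Pv)).
  transitivity ((z v - z w + k) * (z v - z w + k)^-1 *
     ((z v - z w + k) * (a v * z v ^+ p))); last by ring.
  by rewrite divrr ?zU // mul1r.
have zeta_y p : zeta * y p = y p * zeta.
  rewrite /y /current mulr_sumr mulr_suml; apply: eq_bigr => v Pv.
  rewrite -[RHS]mulrA shift_mul_op !mulrA -!rmorphM /= (Tzw _ Pv).1.
  by rewrite mulrC.
have exE p : e * current a P p = (y p.+1 - c *: y p - zeta * y p) * e.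
  rewrite /y /current mulr_sumr scaler_sumr mulr_sumr -sumrB -sumrB mulr_suml.
  apply: eq_bigr => v Pv /=.
  rewrite zl scalerAl -linearZ -!mulrBl -!rmorphB /=.
  rewrite !mul_shift_op (shift_opC (T_comm v w)).
  congr (mul_op _ * _); rewrite !rmorphM !rmorphXn /= (Tzw _ Pv).1 (Tzw _ Pv).2 /a' exprS scE.
  apply: (mulrI (zU v Pv)).
  transitivity ((z v - z w + k) * (a w * T w (a v)) * (z w ^+ r * z v ^+ p)).
    by ring.
  rewrite -awT //.
  transitivity ((z v - z w + k) * (z v - z w + k)^-1 *
     ((z v - z w - k) * (a v * T v (a w))) * (z w ^+ r * z v ^+ p)); last by ring.
  by rewrite divrr ?zU // mul1r.
have y_quad : quadratic_relation s y y.
  apply: current_quadratic => [v v' Pv Pv' vv'|v v' Pv Pv' vv'|v Pv _]; last exact: Tz.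
    by rewrite !Tzz // eq_sym.
  have Tinv u u' : P u -> P u' -> u != u' ->
      T u (z u' - z w + k)^-1 = (z u' - z w + k)^-1.
    move=> Pu Pu' uu'; rewrite rmorphV ?zU //; congr (_^-1).
    by rewrite rmorphD rmorphB /= Tzz // (Tzw _ Pu).1 Tk.
  rewrite /a' !rmorphM /= (Tinv v v') // (Tinv v' v) //; last by rewrite eq_sym.
  have e' := aT _ _ Pv Pv' vv'.
  transitivity ((z v - z w + k)^-1 * (z v' - z w + k)^-1 *
    ((z v - z v' - s%:A) * (a v * T v (a v')))); first by ring.
  by rewrite e'; ring.
transitivity (ordered_sum (fun i => commutator (current a P (t i))) e n
   [set id i | i in [set: 'I_n]]).
  by rewrite -(@sum_perm_ordered_sum _ _ _ (fun i => commutator (current a P (t i)))).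
rewrite (@ordered_sum_commutator _ _ _ (fun i => y (t i)) (fun i => y (t i).+1)
  (fun i => current a P (t i)) zeta e c s) //.
- case: n n0 t c0 => // n _ t c0; rewrite big_ord_recr /= c0 mulr0 scale0r //.
- move=> i i' _; have := y_quad (t i) (t i') => b.
  by apply: (eq_from_subr b); rewrite scalerDr; zmod.
- by rewrite imset_id cardsT card_ord.
Qed.

End Currents.

(** * Meromorphic functions *)

Section MeroFacts.
Local Open Scope quotient_scope.
Local Open Scope classical_set_scope.
Local Open Scope ring_scope.
Import numFieldNormedType.Exports.
Variables (C : numClosedFieldType) (n : nat).
Local Notation V := 'rV[C]_n.
Local Notation mero := (mero C n).
Implicit Types (f g : V -> C) (a b : mero) (v w : V).

Lemma mero_class_eq f g (mf : meromorphic f) (mg : meromorphic g) :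
  f =1 g -> mero_class mf = mero_class mg.
Proof. by move=> fg; congr \pi_mero; apply: val_inj; apply/funext. Qed.

Lemma mero_classD f g (mf : meromorphic f) (mg : meromorphic g)
  (mfg : meromorphic (f + g)) : mero_class mf + mero_class mg = mero_class mfg.
Proof.
by rewrite -[LHS](rmorphD \pi_mero); congr \pi_mero; exact: val_inj.
Qed.

Lemma mero_classM f g (mf : meromorphic f) (mg : meromorphic g)
  (mfg : meromorphic (f * g)) : mero_class mf * mero_class mg = mero_class mfg.
Proof.
by rewrite -[LHS](rmorphM \pi_mero); congr \pi_mero; exact: val_inj.
Qed.

Lemma mero_const_alg (c : C) : mero_const n c = c%:A :> mero.
Proof. by rewrite [RHS](mulr1 (mero_const n c)). Qed.

Lemma meromorphicD f g : meromorphic f -> meromorphic g -> meromorphic (f + g).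
Proof.
move=> mf mg; apply/(@meroP C n).
by rewrite rpredD //; apply/(@meroP C n).
Qed.

Lemma mero_translateD v : {morph mero_translate v : a b / a + b}.
Proof.
move=> a b; have [f [mf ->]] := mero_classE a; have [g [mg ->]] := mero_classE b.
rewrite (mero_classD mf mg (meromorphicD mf mg)) !mero_translateE.
rewrite (mero_classD _ _ (meromorphicD (meromorphic_translate v mf) (meromorphic_translate v mg))).
exact: mero_class_eq.
Qed.

Lemma mero_translateM v : {morph mero_translate v : a b / a * b}.
Proof.
move=> a b; have [f [mf ->]] := mero_classE a; have [g [mg ->]] := mero_classE b.
rewrite (mero_classM mf mg (meromorphicM mf mg)) !mero_translateE.
rewrite (mero_classM _ _ (meromorphicM (meromorphic_translate v mf) (meromorphic_translate v mg))).
exact: mero_class_eq.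
Qed.

Lemma mero_translate_const v (c : C) : mero_translate v (mero_const n c) = mero_const n c.
Proof. by rewrite mero_translateE; exact: mero_class_eq. Qed.

Fact mero_translate_is_zmod_morphism v : zmod_morphism (@mero_translate C n v).
Proof.
move=> a b; have t0 : mero_translate v 0 = 0 :> mero.
  by apply: (addrI (mero_translate v (0 : mero))); rewrite -mero_translateD !addr0.
by rewrite mero_translateD; congr (_ + _); apply/eqP; rewrite -addr_eq0 -mero_translateD addNr t0.
Qed.

Fact mero_translate_is_monoid_morphism v : monoid_morphism (@mero_translate C n v).
Proof.
split; last exact: mero_translateM.
by rewrite -(mero_const1 C n) mero_translate_const.
Qed.

Fact mero_translate_is_scalable v : scalable (@mero_translate C n v).
Proof.
by move=> c a; rewrite [X in mero_translate _ X]/(mero_const n c * a) mero_translateM mero_translate_const.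
Qed.

HB.instance Definition _ v := GRing.isZmodMorphism.Build mero mero (mero_translate v)
  (mero_translate_is_zmod_morphism v).
HB.instance Definition _ v := GRing.isMonoidMorphism.Build mero mero (mero_translate v)
  (mero_translate_is_monoid_morphism v).
HB.instance Definition _ v := GRing.isScalable.Build C mero mero *:%R (mero_translate v)
  (mero_translate_is_scalable v).

Lemma mero_translate_comp v w a : mero_translate v (mero_translate w a) = mero_translate (v + w) a.
Proof.
have [f [mf ->]] := mero_classE a; rewrite !mero_translateE.
by apply: mero_class_eq => x; rewrite /translate addrA.
Qed.

Lemma mero_translate0 a : mero_translate 0 a = a.
Proof.
have [f [mf ->]] := mero_classE a; rewrite mero_translateE.
by apply: mero_class_eq => x; rewrite /translate addr0.
Qed.

Lemma mero_translate_coord v j :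
  mero_translate v (mero_coord C j) = mero_coord C j + (v 0 j)%:A.
Proof.
rewrite -mero_const_alg mero_translateE /mero_const.
have mj : meromorphic (fun x : V => x 0 j).
  by apply: holomorphic_meromorphic => x; exact: differentiable_coord.
have mc : meromorphic (fun _ : V => v 0 j).
  by apply: holomorphic_meromorphic => x; exact: differentiable_cst.
rewrite (@mero_class_eq _ _ _ (meromorphicD mj mc)); last by move=> x; rewrite /translate mxE.
by rewrite -(mero_classD mj mc); congr (_ + _); exact: mero_class_eq.
Qed.

(** f has slope 1 in the coordinate j, so the complement of its zeros is dense, and 1/f is
    meromorphic as the quotient of 1 by f. *)
Lemma mero_class_unit (f : V -> C) (mf : meromorphic f) j :
  (forall x, differentiable f x) ->
  (forall x t, f (x + t *: delta_mx 0 j) = f x + t) ->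
  mero_class mf \is a @GRing.unit mero.
Proof.
move=> df fD; have fdense x : closure [set z | f z != 0] x.
  move=> B xB; have [fx|fx] := eqVneq (f x) 0; last by exists x; split=> //; exact: nbhs_singleton.
  pose p (t : C) : V := x + t *: delta_mx 0 j.
  have pB : \forall t \near (0 : C), B (p t).
    have : p t @[t --> (0 : C)] --> x + (0 : C) *: (delta_mx 0 j : V).
      exact: (cvgD (cvg_cst x) (@scalel_continuous C V (delta_mx 0 j) 0)).
    by rewrite scale0r addr0 => /(_ B xB).
  have [t [t0 Bt]] : exists t : C, t != 0 /\ B (p t).
    have : \forall t \near (0 : C)^', t != 0 /\ B (p t).
      by apply: filterS pB => t Bt t0; split.
    exact: filter_ex.
  by exists (p t); split=> //=; rewrite /p fD fx add0r.
have mg : meromorphic (fun x => (f x)^-1).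
  move=> x; exists (cst 1), f; split.
  - by apply: filterE => y; exact: differentiable_cst.
  - exact: filterE.
  - exact: filterE.
  - by apply: filterE => y _; rewrite div1r.
apply/asboolP; exists (mero_class mg).
rewrite (mero_classM _ _ (meromorphicM mg mf)) -(mero_const1 C n).
apply/mero_classP => O [z Oz] oO.
have [|y [/= fy Oy]] := fdense z O; first exact: open_nbhs_nbhs.
exists y; split=> //; have : \forall w \near y, f w != 0.
  exact: (cvgr_neq0 _ (differentiable_continuous (df y))).
apply: filterS => w fw; suff : (f w)^-1 * f w - 1 = 0 by [].
by rewrite mulVf ?subrr.
Qed.

Lemma mero_coord_scalar_unit j c : mero_coord C j + c%:A \is a @GRing.unit mero.
Proof.
have df x : differentiable (fun x : V => x 0 j + c) x.
  by apply: differentiableD; [exact: differentiable_coord|exact: differentiable_cst].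
have mf := holomorphic_meromorphic df.
have mj : meromorphic (fun x : V => x 0 j).
  by apply: holomorphic_meromorphic => x; exact: differentiable_coord.
have mc : meromorphic (fun _ : V => c).
  by apply: holomorphic_meromorphic => x; exact: differentiable_cst.
have -> : mero_coord C j + c%:A = mero_class mf.
  rewrite -mero_const_alg; transitivity (mero_class mj + mero_class mc).
    by congr (_ + _); exact: mero_class_eq.
  by rewrite (mero_classD mj mc (meromorphicD mj mc)); exact: mero_class_eq.
apply: (mero_class_unit mf (j := j)) => // x t.
by rewrite !mxE !eqxx mulr1 addrAC.
Qed.

Lemma mero_coord_unit j k c : j != k ->
  mero_coord C j - mero_coord C k + c%:A \is a @GRing.unit mero.
Proof.
move=> jk; pose f (x : V) : C := x 0 j - x 0 k + c.
have df x : differentiable f x.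
  apply: differentiableD; last exact: differentiable_cst.
  by apply: differentiableB; exact: differentiable_coord.
have mf := holomorphic_meromorphic df.
have -> : mero_coord C j - mero_coord C k + c%:A = mero_class mf.
  have mj : meromorphic (fun x : V => x 0 j).
    by apply: holomorphic_meromorphic => x; exact: differentiable_coord.
  have mk : meromorphic (fun x : V => x 0 k).
    by apply: holomorphic_meromorphic => x; exact: differentiable_coord.
  have mc : meromorphic (fun _ : V => c).
    by apply: holomorphic_meromorphic => x; exact: differentiable_cst.
  have e : mero_coord C j + c%:A = mero_class mf + mero_coord C k.
    rewrite -mero_const_alg; transitivity (mero_class mj + mero_class mc).
      by congr (_ + _); exact: mero_class_eq.
    transitivity (mero_class mf + mero_class mk); last first.
      by congr (_ + _); exact: mero_class_eq.
    rewrite (mero_classD mj mc (meromorphicD mj mc)) (mero_classD mf mk (meromorphicD mf mk)).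
    apply: mero_class_eq => x; suff : x 0 j + c = f x + x 0 k by [].
    by rewrite /f; ring.
  by apply: (eq_from_subr e); zmod.
apply: (mero_class_unit mf (j := j)) => // x t.
rewrite /f !mxE !eqxx [k == j]eq_sym (negbTE jk) mulr1 mulr0 addr0; ring.
Qed.

End MeroFacts.

(** Both sides are the product of the y - c - s r for 0 <= r <= n, since y - c - s n = y + c. This
    computes the effect of one shift on the products over r in H_i and E_i. *)
Lemma telescope_prod (R : comNzRingType) (y c s : R) n : s *+ n = - (c *+ 2) ->
  (\prod_(1 <= r < n.+1) (y - c - s *+ r)) * (y - c)
  = (\prod_(1 <= r < n.+1) (y + s - c - s *+ r)) * (y + c).
Proof.
move=> sn; pose F r := y - c - s *+ r.
transitivity (\prod_(0 <= r < n.+1) F r).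
  by rewrite [RHS]big_nat_recl // mulrC big_add1 /= /F mulr0n subr0.
rewrite big_nat_recr //= big_add1 /= /F sn; congr (_ * _); last by rewrite mulr2n; zmod.
by apply: eq_bigr => r _; rewrite mulrS; zmod.
Qed.

Lemma unit_cross_mul (R : comUnitRingType) (x y u v : R) :
  u \is a GRing.unit -> v \is a GRing.unit -> x * v = y * u -> x / u = y / v.
Proof.
by move=> uU vU e; rewrite -[x](mulrK vU) e mulrAC mulrK.
Qed.

Lemma map_XsubC (R S : nzRingType) (f : {rmorphism R -> S}) x :
  map_poly f ('X - x%:P) = 'X - (f x)%:P.
Proof. by rewrite rmorphB /= map_polyX map_polyC. Qed.

(** * Representations by difference operators *)

Section DifferenceRepresentation.
Variables (C : numClosedFieldType) (hbar : C) (l : nat) (A : 'M[int]_l) (d : 'I_l -> nat).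
Hypothesis hbar_neq0 : hbar != 0.
Hypothesis A_diag : forall i, A i i = 2.
Hypothesis A_le0 : forall i j, i != j -> A i j <= 0.
Hypothesis d_gt0 : forall i, (0 < d i)%N.
Hypothesis d_sym : forall i j, (d i)%:Z * A i j = (d j)%:Z * A j i.
(** The algebra of functions is left abstract because it is used twice: for meromorphic functions,
    and for functions on a lattice with values in them. *)
Variables (M : comUnitAlgType C) (V : finType) (node : V -> 'I_l) (gam : V -> M).
Variables (T T' : V -> {lrmorphism M -> M}).
Hypothesis TK : forall v u, T v (T' v u) = u.
Hypothesis T'K : forall v u, T' v (T v u) = u.
Hypothesis T_comm : forall v w u, T v (T w u) = T w (T v u).
Local Notation form := (root_form A d).
Local Notation hh := (half_hbar hbar).
Local Notation c i j := (hh (form i j)).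
Local Notation s i := (hh (form i i)).
Hypothesis T_gam : forall v w, v != w -> T v (gam w) = gam w.
Hypothesis T_gamv : forall v, T v (gam v) = gam v - (s (node v))%:A.
Hypothesis gam_unit : forall v w (k : int), v != w ->
  gam v - gam w + (hh k)%:A \is a GRing.unit.
Variable a : V -> M.
Hypothesis a_unit : forall v, a v \is a GRing.unit.
Hypothesis a_quad : forall v w, v != w ->
  (gam v - gam w - (c (node v) (node w))%:A) * (a v * T v (a w))
  = (gam v - gam w + (c (node v) (node w))%:A) * (a w * T w (a v)).
Variable R : 'I_l -> {poly C}.
Hypothesis R_monic : forall i, R i \is monic.
Hypothesis R_size : forall i, ((size (R i)).-1)%:Z = \sum_v A (node v) i.

Lemma formC i j : form i j = form j i. Proof. exact: d_sym. Qed.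

Lemma half_hbarD x y : hh (x + y) = hh x + hh y.
Proof. by rewrite /half_hbar rmorphD /= mulrDr. Qed.

Lemma half_hbarN x : hh (- x) = - hh x.
Proof. by rewrite /half_hbar rmorphN /= mulrN. Qed.

Lemma half_hbarMn x n : hh (n%:Z * x) = hh x *+ n.
Proof. by rewrite /half_hbar rmorphM /= -pmulrn -mulrnAr mulr_natl. Qed.

Lemma i_hbar_neq0 : 'i * hbar != 0 :> C.
Proof. by rewrite mulf_neq0 ?neq0Ci. Qed.

Lemma half_hbar_form_neq0 i : s i != 0.
Proof.
rewrite /half_hbar; apply: mulf_neq0.
  by rewrite mulf_neq0 ?i_hbar_neq0 // invr_eq0 pnatr_eq0.
by rewrite intr_eq0 /root_form A_diag; have := d_gt0 i; case: (d i).
Qed.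

(** As a_ji = 2 (alpha_i, alpha_j) / (alpha_j, alpha_j), this provides the hypothesis of
    [telescope_prod]. *)
Lemma shift_sum i j : i != j -> s j *+ `|A j i|%N = - (c i j *+ 2).
Proof.
move=> ij; rewrite -!half_hbarMn -half_hbarN; congr hh.
rewrite (formC i) /root_form A_diag.
have : `|A j i|%N%:Z = - A j i by rewrite abszE ler0_norm // A_le0 // eq_sym.
by move=> ->; ring.
Qed.

Lemma T_injective v : injective (T v).
Proof. exact: can_inj (T'K v). Qed.

Lemma T'_gam v w : v != w -> T' v (gam w) = gam w.
Proof. by move=> vw; apply: (@T_injective v); rewrite TK T_gam. Qed.

Lemma T'_gamv v : T' v (gam v) = gam v + (s (node v))%:A.
Proof. by apply: (@T_injective v); rewrite TK rmorphD /= rmorph_alg T_gamv subrK. Qed.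

Lemma T'_comm v w u : T' v (T' w u) = T' w (T' v u).
Proof.
by apply: (@T_injective w); rewrite TK; apply: (@T_injective v); rewrite TK T_comm !TK.
Qed.

Lemma TT'_comm v w u : T v (T' w u) = T' w (T v u).
Proof. by apply: (@T_injective w); rewrite TK -T_comm TK. Qed.

Definition H_factor i v : {poly M} := \prod_(1 <= r < (absz (A (node v) i)).+1)
  ('X - (gam v + (hh (form i (node v) + r%:Z * form (node v) (node v)))%:A)%:P).

Definition H_numerator i : {poly M} :=
  map_poly (in_alg M) (R i) * \prod_(v | node v != i) H_factor i v.

Definition H_denominator i : {poly M} :=
  \prod_(v | node v == i) (('X - (gam v)%:P) * ('X - (gam v + (s i)%:A)%:P)).

Lemma H_factor_monic i v : H_factor i v \is monic.
Proof. exact: monic_prod_XsubC. Qed.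

Lemma map_R_monic i : map_poly (in_alg M) (R i) \is monic.
Proof. exact: monic_map. Qed.

Lemma H_numerator_monic i : H_numerator i \is monic.
Proof. by rewrite monicMl ?map_R_monic // monic_prod // => v _; exact: H_factor_monic. Qed.

Lemma T_H_factor i v w : v != w -> map_poly (T v) (H_factor i w) = H_factor i w.
Proof.
move=> vw; rewrite rmorph_prod; apply: eq_bigr => r _.
by rewrite /= map_XsubC rmorphD /= rmorph_alg T_gam.
Qed.

Lemma T'_H_factor i v w : v != w -> map_poly (T' v) (H_factor i w) = H_factor i w.
Proof.
move=> vw; rewrite rmorph_prod; apply: eq_bigr => r _.
by rewrite /= map_XsubC rmorphD /= rmorph_alg T'_gam.
Qed.

Lemma H_factorE i v (y : {poly M}) : y = 'X - (gam v)%:P -> H_factor i v =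
  \prod_(1 <= r < (absz (A (node v) i)).+1)
    (y - (c i (node v))%:A%:P - (s (node v))%:A%:P *+ r).
Proof.
move=> ->; apply: eq_bigr => r _; rewrite half_hbarD half_hbarMn scalerDl -scalerMnl.
by rewrite !polyCD polyCMn; zmod.
Qed.

Lemma T_H_factor_self i v : node v != i ->
  H_factor i v * ('X - (gam v + (c i (node v))%:A)%:P)
  = map_poly (T v) (H_factor i v) * ('X - (gam v - (c i (node v))%:A)%:P).
Proof.
move=> vi; pose y : {poly M} := 'X - (gam v)%:P.
have := @telescope_prod {poly M} y (c i (node v))%:A%:P (s (node v))%:A%:P `|A (node v) i|%N.
rewrite -(H_factorE i (erefl y)) => e.
have -> : map_poly (T v) (H_factor i v) = \prod_(1 <= r < (absz (A (node v) i)).+1)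
    (y + (s (node v))%:A%:P - (c i (node v))%:A%:P - (s (node v))%:A%:P *+ r).
  rewrite rmorph_prod; apply: eq_bigr => r _.
  rewrite /= map_XsubC rmorphD /= rmorph_alg T_gamv half_hbarD half_hbarMn scalerDl -scalerMnl.
  by rewrite !polyCD polyCN polyCMn /y; zmod.
have -> : 'X - (gam v + (c i (node v))%:A)%:P = y - (c i (node v))%:A%:P.
  by rewrite polyCD /y; zmod.
have -> : 'X - (gam v - (c i (node v))%:A)%:P = y + (c i (node v))%:A%:P.
  by rewrite polyCD polyCN /y; zmod.
apply: e; rewrite -!polyCMn -polyCN !scalerMnl -scaleNr; congr (_%:A%:P).
by rewrite shift_sum // eq_sym.
Qed.

Lemma T_R v i : map_poly (T v) (map_poly (in_alg M) (R i)) = map_poly (in_alg M) (R i).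
Proof.
rewrite -map_poly_comp; apply: eq_map_poly => x /=.
by rewrite rmorph_alg.
Qed.

Lemma T_H_numerator_same v : map_poly (T v) (H_numerator (node v)) = H_numerator (node v).
Proof.
rewrite rmorphM /= T_R rmorph_prod; congr (_ * _); apply: eq_bigr => w wi.
by apply: T_H_factor; apply: contraNneq wi => <-.
Qed.

Lemma T_H_numerator i v : node v != i ->
  ('X - (gam v + (c i (node v))%:A)%:P) * H_numerator i
  = ('X - (gam v - (c i (node v))%:A)%:P) * map_poly (T v) (H_numerator i).
Proof.
move=> vi; pose Q := map_poly (in_alg M) (R i) *
  \prod_(w | (node w != i) && (w != v)) H_factor i w.
have NE : H_numerator i = H_factor i v * Q.
  by rewrite /H_numerator (bigD1 v) //= mulrCA.
have TN : map_poly (T v) (H_numerator i) = map_poly (T v) (H_factor i v) * Q.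
  rewrite NE rmorphM /=; congr (_ * _); rewrite rmorphM /= T_R rmorph_prod; congr (_ * _).
  by apply: eq_bigr => w /andP[_ wv]; apply: T_H_factor; rewrite eq_sym.
by rewrite TN NE [LHS]mulrA [RHS]mulrA; congr (_ * Q); rewrite mulrC T_H_factor_self // mulrC.
Qed.

(** As rational functions, H_i / T_v(H_i) = (u - z_v + c) / (u - z_v - c). The shift acts on the
    denominator if v is at node i, and on one factor of the numerator otherwise. *)
Lemma H_ratio i v :
  ('X - (gam v + (c i (node v))%:A)%:P) * H_numerator i * map_poly (T v) (H_denominator i)
  = ('X - (gam v - (c i (node v))%:A)%:P) * map_poly (T v) (H_numerator i) * H_denominator i.
Proof.
have [vi|vi] := eqVneq (node v) i.
  pose Q := \prod_(w | (node w == i) && (w != v))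
    (('X - (gam w)%:P) * ('X - (gam w + (s i)%:A)%:P)).
  have DE : H_denominator i = ('X - (gam v)%:P) * ('X - (gam v + (s i)%:A)%:P) * Q.
    by rewrite /H_denominator (bigD1 v) //= vi.
  have TD : map_poly (T v) (H_denominator i)
      = ('X - (gam v - (s i)%:A)%:P) * ('X - (gam v)%:P) * Q.
    rewrite DE !rmorphM /= !map_XsubC rmorphD /= rmorph_alg T_gamv vi subrK; congr (_ * _).
    rewrite rmorph_prod; apply: eq_bigr => w /andP[_ wv].
    by rewrite rmorphM /= !map_XsubC rmorphD /= rmorph_alg T_gam // eq_sym.
  by have := T_H_numerator_same v; rewrite TD DE vi => ->; ring.
rewrite T_H_numerator //; congr (_ * _).
rewrite rmorph_prod; apply: eq_bigr => w wi; have vw : v != w by apply: contraNneq vi => ->.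
by rewrite rmorphM /= !map_XsubC rmorphD /= rmorph_alg T_gam.
Qed.

Definition pole (p : V * bool) : M :=
  if p.2 then gam p.1 + (s (node p.1))%:A else gam p.1.

Definition pole_of i : pred (V * bool) := fun p => node p.1 == i.

Lemma H_denominatorE i : H_denominator i = \prod_(p | pole_of i p) ('X - (pole p)%:P).
Proof.
rewrite (eq_bigl (fun p => (node p.1 == i) && true)); last by move=> p; rewrite andbT.
rewrite -(pair_big_dep (fun v => node v == i) (fun _ _ => true) (fun v b => 'X - (pole (v, b))%:P)).
by apply: eq_bigr => v /eqP vi /=; rewrite big_bool /= /pole /= vi mulrC.
Qed.

Lemma H_denominator_monic i : H_denominator i \is monic.
Proof. by rewrite H_denominatorE; exact: monic_prod_XsubC. Qed.

Lemma scalar_unit (x : C) : x != 0 -> x%:A \is a @GRing.unit M.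
Proof.
move=> x0; apply/unitrPr; exists (x^-1)%:A.
by rewrite -scalerAl mul1r scalerA divff // scale1r.
Qed.

Lemma pole_unit i p q : pole_of i p -> pole_of i q -> p != q ->
  pole p - pole q \is a GRing.unit.
Proof.
case: p q => v b [w e]; rewrite /pole_of /pole /= => /eqP vi /eqP wi pq.
have [vw|vw] := eqVneq v w.
  subst w; case: b e pq => -[]; rewrite ?eqxx // => _.
    by rewrite addrC addKr scalar_unit ?half_hbar_form_neq0.
  by rewrite opprD addrA subrr add0r unitrN scalar_unit ?half_hbar_form_neq0.
have hh0 : (hh 0)%:A = 0 :> M by rewrite /half_hbar mulr0 scale0r.
have U k (y : M) : y = gam v - gam w + (hh k)%:A -> y \is a GRing.unit.
  by move=> ->; exact: gam_unit.
case: b e {pq} => -[].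
- by apply: (U 0); rewrite hh0 vi wi; zmod.
- by apply: (U (form (node v) (node v))); zmod.
- by apply: (U (- form (node w) (node w))); rewrite half_hbarN scaleNr; zmod.
- by apply: (U 0); rewrite hh0 addr0.
Qed.

(** A variable at node i adds 2 = a_ii to the degree of the denominator, one at another node j adds
    - a_ji to that of the numerator. *)
Lemma H_size_diff i : (size (H_denominator i)).-1%:Z
  = (size (\prod_(v | node v != i) H_factor i v)).-1%:Z + \sum_v A (node v) i.
Proof.
have sumz (P : pred V) (F : V -> nat) : (\sum_(v | P v) F v)%N%:Z = \sum_(v | P v) (F v)%:Z.
  exact: (big_morph Posz PoszD (erefl (Posz 0))).
rewrite !size_prod_monic => [|v _|v _]; last 2 first.
- exact: H_factor_monic.
- by rewrite monicMl monicXsubC.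
rewrite (bigID (fun v => node v == i) xpredT) /= addrCA !sumz -big_split /=.
rewrite [X in _ = _ + X]big1 => [|v vi].
  rewrite addr0; apply: eq_bigr => v /eqP->.
  by rewrite A_diag size_monicM ?monicXsubC ?polyXsubC_eq0 // !size_XsubC.
by rewrite /H_factor size_prod_XsubC size_iota subSS subn0 /= abszE ler0_norm ?addNr // A_le0.
Qed.

(** [R_size] gives numerator and denominator the same degree, which makes H_i(u) = 1 + O(u^-1). *)
Lemma size_H_numerator i : size (H_numerator i) = #|pole_of i|.+1.
Proof.
have size_gt0 (p : {poly M}) : p \is monic -> (0 < size p)%N.
  by move=> mp; rewrite lt0n size_poly_eq0 monic_neq0.
have mP : \prod_(v | node v != i) H_factor i v \is monic.
  by apply: monic_prod => v _; exact: H_factor_monic.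
have sD : size (H_denominator i) = #|pole_of i|.+1.
  by rewrite H_denominatorE size_prod_points.
have := H_size_diff i; rewrite -R_size sD.
rewrite /H_numerator size_monicM ?map_R_monic ?monic_neq0 // size_map_poly_monic //.
have := size_gt0 _ mP; have := size_gt0 _ (map_R_monic i).
rewrite size_map_poly_monic //.
have size_add (x y z : nat) : (0 < x)%N -> (0 < y)%N ->
  z.+1.-1%:Z = y.-1%:Z + x.-1%:Z -> (x + y).-1 = z.+1 by lia.
exact: size_add.
Qed.

Definition H_coef i : nat -> M :=
  partial_fractions_series (pole_of i) pole (H_numerator i).

Lemma H_expansion i : is_expansion (H_numerator i) (H_denominator i) (H_coef i).
Proof.
rewrite H_denominatorE; apply: partial_fractions_expansion.
- exact: pole_unit.
- exact: H_numerator_monic.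
- exact: size_H_numerator.
Qed.

Lemma H_coef_ratio i v p : H_coef i p.+1 - (gam v + (c i (node v))%:A) * H_coef i p
  = T v (H_coef i p.+1) - (gam v - (c i (node v))%:A) * T v (H_coef i p).
Proof.
apply: (expansion_ratio (H_denominator_monic i) _ (H_expansion i)
  (map_expansion (T v) (H_denominator_monic i) (H_expansion i)) (H_ratio i v)).
by rewrite monic_map // H_denominator_monic.
Qed.

Definition H_residue p : M := residue (pole_of (node p.1)) pole (H_numerator (node p.1)) p.

Definition same_node_prod w (y : M) : M :=
  \prod_(v | (node v == node w) && (v != w)) ((y - gam v) * (y - gam v - (s (node w))%:A)).

(** The sign is that of the difference between the chosen pole of w and its other pole. *)
Lemma H_residueE w (e : bool) : H_residue (w, e) =
  (H_numerator (node w)).[pole (w, e)]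
  / ((-1) ^+ (~~ e) * (s (node w))%:A * same_node_prod w (pole (w, e))).
Proof.
congr (_ / _); rewrite (bigD1 (w, ~~ e)) /=; last first.
  by rewrite /pole_of /= eqxx xpair_eqE eqxx /=; case: e.
congr (_ * _).
  rewrite /pole /=; case: e => /=; last by rewrite expr1 mulN1r; zmod.
  by rewrite expr0 mul1r; zmod.
transitivity (\prod_(p | (node p.1 == node w) && (p.1 != w)) (pole (w, e) - pole p)).
  apply: eq_bigl => -[v b]; rewrite /pole_of /= !xpair_eqE.
  by case: (node v == node w) => //=; case: (v == w) => //=; case: b; case: e.
rewrite (eq_bigl (fun p => (fun v => (node v == node w) && (v != w)) p.1 && true)); last first.
  by move=> p; rewrite andbT.
rewrite -(pair_big_dep (fun v => (node v == node w) && (v != w)) (fun _ _ => true)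
  (fun v b => pole (w, e) - pole (v, b))).
apply: eq_bigr => v /andP[/eqP vw _]; rewrite big_bool /= /pole /= vw mulrC.
by congr (_ * _); zmod.
Qed.

Lemma H_numerator_horner w (e : bool) : T' w (H_numerator (node w)).[gam w]
  = (H_numerator (node w)).[gam w + (s (node w))%:A].
Proof.
rewrite -horner_map /= T'_gamv; congr horner.
rewrite rmorphM /= rmorph_prod -map_poly_comp; congr (_ * _).
  by apply: eq_map_poly => x /=; rewrite rmorph_alg.
apply: eq_bigr => v vw; apply: T'_H_factor.
by apply: contraNneq vw => ->.
Qed.

Lemma same_node_prod_unit w (e : bool) : same_node_prod w (pole (w, e)) \is a GRing.unit.
Proof.
rewrite rpred_prod // => v /andP[/eqP vw wv].
have U (k : int) (y : M) : y = gam w - gam v + (hh k)%:A -> y \is a GRing.unit.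
  by move=> ->; apply: gam_unit; rewrite eq_sym.
have hh0 : (hh 0)%:A = 0 :> M by rewrite /half_hbar mulr0 scale0r.
rewrite unitrM /pole; case: e => /=; apply/andP; split.
- by apply: (U (form (node w) (node w))); zmod.
- by apply: (U 0); rewrite hh0; zmod.
- by apply: (U 0); rewrite hh0; zmod.
- by apply: (U (- form (node w) (node w))); rewrite half_hbarN scaleNr; zmod.
Qed.

Lemma H_residue_true w : H_residue (w, true) = - T' w (H_residue (w, false)).
Proof.
rewrite !H_residueE /pole /= expr0 expr1 mul1r.
have U : - 1 * (s (node w))%:A * same_node_prod w (gam w) \is a GRing.unit.
  rewrite !unitrM unitrN unitr1 scalar_unit ?half_hbar_form_neq0 //=.
  exact: (same_node_prod_unit w false).
rewrite rmorphM /= rmorphV //= (H_numerator_horner w true) -mulrN -invrN; congr (_ / _).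
rewrite !rmorphM rmorphN rmorph1 /= rmorph_alg mulN1r mulNr opprK; congr (_ * _).
rewrite rmorph_prod; apply: eq_bigr => v /andP[/eqP vw wv].
rewrite /= rmorphM /= !rmorphB /= rmorph_alg T'_gamv T'_gam 1?eq_sym //.
Qed.

(** At a common node the shift changes [same_node_prod], at distinct nodes it changes the numerator;
    the ratio is the same in both cases. *)
Lemma T_H_residue v w : v != w ->
  (gam v - gam w - (c (node v) (node w))%:A) * T v (H_residue (w, false))
  = (gam v - gam w + (c (node v) (node w))%:A) * H_residue (w, false).
Proof.
move=> vw; rewrite !H_residueE /pole /= expr1.
set S := - 1 * (s (node w))%:A.
have TS : T v S = S by rewrite rmorphM rmorphN rmorph1 /= rmorph_alg.
have SU : S \is a GRing.unit by rewrite unitrM unitrN unitr1 scalar_unit ?half_hbar_form_neq0.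
have DU : same_node_prod w (gam w) \is a GRing.unit := same_node_prod_unit w false.
have TDU : T v (same_node_prod w (gam w)) \is a GRing.unit by rewrite rmorph_unit.
have Tinv : T v (S * same_node_prod w (gam w))^-1 = (S * T v (same_node_prod w (gam w)))^-1.
  by rewrite rmorphV; [rewrite rmorphM /= TS|rewrite unitrM SU].
rewrite rmorphM /= Tinv -horner_map /= T_gam // !mulrA.
apply: unit_cross_mul; [by rewrite unitrM SU|by rewrite unitrM SU|].
have [nvw|nvw] := eqVneq (node v) (node w).
  rewrite -nvw T_H_numerator_same.
  pose D := \prod_(u | ((node u == node w) && (u != w)) && (u != v))
    ((gam w - gam u) * (gam w - gam u - (s (node w))%:A)).
  have DE : same_node_prod w (gam w)
      = (gam w - gam v) * (gam w - gam v - (s (node w))%:A) * D.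
    by rewrite /same_node_prod (bigD1 v) //= nvw eqxx vw.
  have -> : T v (same_node_prod w (gam w))
      = (gam w - gam v + (s (node w))%:A) * (gam w - gam v) * D.
    rewrite DE !rmorphM !rmorphB /= rmorph_alg T_gam // T_gamv nvw; congr (_ * _).
      by congr (_ * _); zmod.
    rewrite rmorph_prod; apply: eq_bigr => u /andP[_ uv].
    by rewrite /= rmorphM /= !rmorphB /= rmorph_alg !T_gam // eq_sym.
  by rewrite DE nvw; ring.
have -> : T v (same_node_prod w (gam w)) = same_node_prod w (gam w).
  rewrite rmorph_prod; apply: eq_bigr => u /andP[/eqP uw _].
  have vu : v != u by apply: contraNneq nvw => ->; rewrite uw.
  by rewrite /= rmorphM /= !rmorphB /= rmorph_alg !T_gam.
have := congr1 (horner^~ (gam w)) (T_H_numerator nvw).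
rewrite /= !hornerM !hornerXsubC (formC (node w)) => e.
have e' := congr1 (fun y => y * (S * same_node_prod w (gam w))) e.
by apply: (eq_from_subr e'); rewrite /=; ring.
Qed.

Definition E_F_residue v : M := ('i * hbar) *: H_residue (v, false).

(** Forced by [E_i, F_i]: the diagonal coefficient a_v T_v(b_v) must be the residue at z_v of H_i,
    times ['i * hbar]. *)
Definition F_weight v : M := T' v (E_F_residue v / a v).

Local Notation kap := E_F_residue.
Local Notation b := F_weight.
Local Notation gam' := (fun v => gam v + (s (node v))%:A).

Lemma F_weightE v : a v * T v (b v) = kap v.
Proof. by rewrite TK mulrC mulrVK. Qed.

Lemma T_E_F_residue v w : v != w ->
  (gam v - gam w - (c (node v) (node w))%:A) * T v (kap w)
  = (gam v - gam w + (c (node v) (node w))%:A) * kap w.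
Proof. by move=> vw; rewrite [T v _]linearZ /= -[LHS]scalerAr -[RHS]scalerAr T_H_residue. Qed.

Lemma gam_subU v w (k : int) (y : M) : v != w ->
  y = gam v - gam w + (hh k)%:A -> y \is a GRing.unit.
Proof. by move=> vw ->; exact: gam_unit. Qed.

(** After T_w, b_w becomes kap_w / a_w. [T_E_F_residue] and [a_quad] involve the same ratio of z_v -
    z_w + c to z_v - z_w - c, which cancels. *)
Lemma E_F_cross v w : v != w -> a v * T v (b w) = b w * T' w (a v).
Proof.
move=> vw; apply: (@T_injective w); rewrite !rmorphM /= T_comm !TK.
rewrite rmorphM /= rmorphV //= mulrA [RHS]mulrAC.
apply: unit_cross_mul => //; first by rewrite rmorph_unit.
have U : gam v - gam w - (c (node v) (node w))%:A \is a GRing.unit.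
  by apply: (gam_subU (k := - form (node v) (node w)) vw); rewrite half_hbarN scaleNr.
apply: (mulrI U).
transitivity ((gam v - gam w - (c (node v) (node w))%:A) * T v (kap w) * (a w * T w (a v))).
  by ring.
rewrite T_E_F_residue //.
transitivity (kap w * ((gam v - gam w + (c (node v) (node w))%:A) * (a w * T w (a v)))).
  by ring.
by rewrite -a_quad //; ring.
Qed.

(** T_w T_v turns the weights b into quotients of the kap by the a. The shifted kap exchange z_v -
    z_w + c and z_v - z_w - c, and [a_quad] is left after clearing denominators. *)
Lemma F_quad v w : v != w ->
  (gam' v - gam' w - (- c (node v) (node w))%:A) * (b v * T' v (b w))
  = (gam' v - gam' w + (- c (node v) (node w))%:A) * (b w * T' w (b v)).
Proof.
move=> vw; have wv : w != v by rewrite eq_sym.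
set k := c (node v) (node w).
apply: (@T_injective v); apply: (@T_injective w).
have gv : T w (T v (gam' v)) = gam v.
  by rewrite rmorphD /= rmorph_alg T_gamv subrK T_gam.
have gw : T w (T v (gam' w)) = gam w.
  by rewrite T_comm rmorphD /= rmorph_alg T_gamv subrK T_gam.
have push (x y : M) (e : C) (p q : M) : T w (T v ((x - y + e%:A) * (p * q)))
    = (T w (T v x) - T w (T v y) + e%:A) * (T w (T v p) * T w (T v q)).
  by rewrite !rmorphM !rmorphD !rmorphN /= !rmorph_alg.
rewrite -scaleNr !push gv gw {push gv gw} opprK.
rewrite [T w (T v (b v))](_ : _ = T w (kap v / a v)); last by rewrite TK.
rewrite [T w (T v (T' v _))](_ : _ = kap w / a w); last by rewrite !TK.
rewrite [T w (T v (b w))](_ : _ = T v (kap w / a w)); last by rewrite T_comm TK.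
rewrite [T w (T v (T' w _))](_ : _ = kap v / a v); last by rewrite T_comm !TK.
rewrite !rmorphM /= !rmorphV //= scaleNr.
have X : gam v - gam w - k%:A \is a GRing.unit.
  by apply: (gam_subU (k := - form (node v) (node w)) vw); rewrite half_hbarN scaleNr.
have X' : gam v - gam w + k%:A \is a GRing.unit by exact: gam_subU vw _.
have e1 := T_E_F_residue vw.
have e2 : (gam v - gam w + k%:A) * T w (kap v) = (gam v - gam w - k%:A) * kap v.
  by have e := T_E_F_residue wv; apply: (eq_from_subr (esym e)); rewrite -/k /k (formC (node w)); ring.
have e3 := a_quad vw; rewrite -/k in e1 e3.
transitivity ((gam v - gam w - k%:A) * kap v * kap w / (T w (a v) * a w)).
  rewrite invrM ?rmorph_unit // -e2; ring.
transitivity ((gam v - gam w + k%:A) * kap w * kap v / (T v (a w) * a v)); last first.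
  rewrite invrM ?rmorph_unit // -e1; ring.
apply: unit_cross_mul; rewrite ?unitrM ?rmorph_unit ?a_unit //.
transitivity (kap v * kap w * ((gam v - gam w - k%:A) * (a v * T v (a w)))); first by ring.
by rewrite e3; ring.
Qed.

Local Notation on i := (fun v => node v == i).

Definition E_current i := current gam T a (on i).
Definition F_current i := current (fun v => gam v + (s (node v))%:A) T' b (on i).

Lemma E_current_quadratic i j : quadratic_relation (c i j) (E_current i) (E_current j).
Proof.
apply: (current_quadratic T_comm) => [v w _ _ vw|v w /eqP<- /eqP<-|v /eqP<- /eqP<-].
- by rewrite !T_gam // eq_sym.
- exact: a_quad.
- exact: T_gamv.
Qed.

Lemma F_current_quadratic i j : quadratic_relation (- c i j) (F_current i) (F_current j).
Proof.
apply: (current_quadratic T'_comm) => [v w _ _ vw|v w /eqP<- /eqP<-|v /eqP<- /eqP<-].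
- by rewrite !rmorphD /= !rmorph_alg !T'_gam // eq_sym.
- exact: F_quad.
- by rewrite rmorphD /= rmorph_alg T'_gamv scaleNr opprK.
Qed.

Lemma HE_quadratic i j :
  quadratic_relation (c i j) (fun p => mul_op (H_coef i p)) (E_current j).
Proof.
by apply: quadratic_mul_op_current => v /eqP<- p; exact: H_coef_ratio.
Qed.

Lemma HF_quadratic i j :
  quadratic_relation (- c i j) (fun p => mul_op (H_coef i p)) (F_current j).
Proof.
apply: quadratic_mul_op_current => v /eqP<- p.
have /(congr1 (T' v)) := H_coef_ratio i v p.
rewrite !rmorphB !rmorphM !rmorphD !rmorphN /= !rmorph_alg !T'K T'_gamv => e.
by apply: (eq_from_subr (esym e)); rewrite scaleNr; ring.
Qed.

Lemma serre_constant i j n : i != j -> n%:Z = 1 - A i j ->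
  (0 < n)%N /\ c i j *+ 2 + n.-1%:R * s i = 0.
Proof.
move=> ij nA; have Aij := A_le0 ij; have n0 : (0 < n)%N by lia.
split=> //; rewrite mulr_natl -!half_hbarMn -half_hbarD.
have -> : 2 * form i j + n.-1%:Z * form i i = 0.
  have -> : n.-1%:Z = - A i j by lia.
  by rewrite /root_form A_diag; ring.
by rewrite /half_hbar mulr0.
Qed.

Lemma foldr_commutator_sum (B : nzRingType) (J : Type) (x : J -> B) (I : Type) (r : seq I)
    (P : pred I) (F : I -> B) (ks : seq J) :
  foldr (fun k => commutator (x k)) (\sum_(k <- r | P k) F k) ks
  = \sum_(k <- r | P k) foldr (fun k => commutator (x k)) (F k) ks.
Proof. by elim: ks => //= k ks ->; rewrite raddf_sum. Qed.

Lemma E_current_serre i j n (t : 'I_n -> nat) r : i != j -> n%:Z = 1 - A i j ->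
  serre_sum E_current i j t r = 0.
Proof.
move=> ij nA; have [n0 c0] := serre_constant ij nA.
(* The nested commutators are additive in E_j, so its terms are treated one at a time. *)
rewrite /serre_sum; under eq_bigr do rewrite foldr_commutator_sum.
rewrite exchange_big big1 //= => w /eqP wj.
have vw v : node v == i -> v != w by move=> /eqP vi; apply: contraNneq ij => vw; rewrite -vi vw wj.
apply: (current_serre T_comm (c := c i j) (s := s i)) => //.
- by rewrite wj eq_sym.
- by move=> v v' _ _ vv'; exact: T_gam.
- by move=> v /eqP<-; exact: T_gamv.
- by move=> v /vw vw'; rewrite !T_gam // eq_sym.
- by move=> v /vw; exact: gam_unit.
- by move=> v v' /eqP vi /eqP v'i vv'; have := a_quad vv'; rewrite vi v'i.
- by move=> v vi; have := a_quad (vw v vi); rewrite (eqP vi) wj.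
Qed.

Lemma F_current_serre i j n (t : 'I_n -> nat) r : i != j -> n%:Z = 1 - A i j ->
  serre_sum F_current i j t r = 0.
Proof.
move=> ij nA; have [n0 c0] := serre_constant ij nA.
rewrite /serre_sum; under eq_bigr do rewrite foldr_commutator_sum.
rewrite exchange_big big1 //= => w /eqP wj.
have vw v : node v == i -> v != w by move=> /eqP vi; apply: contraNneq ij => vw; rewrite -vi vw wj.
apply: (current_serre T'_comm (c := - c i j) (s := - s i)) => //.
- by rewrite mulrN mulNrn -opprD c0 oppr0.
- by rewrite wj eq_sym.
- by move=> v v' _ _ vv'; rewrite rmorphD /= rmorph_alg T'_gam.
- by move=> v /eqP<-; rewrite rmorphD /= rmorph_alg T'_gamv scaleNr opprK.
- by move=> v /vw vw'; rewrite !rmorphD /= !rmorph_alg !T'_gam // eq_sym.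
(* The F currents have their poles at z_v + c_vv, which adds [form i i - form j j] to the
   difference. *)
- move=> v vi; apply: (gam_subU (k := form i i - form j j - form i j) (vw v vi)).
  by rewrite !half_hbarD !half_hbarN !scalerDl !scaleNr (eqP vi) wj; zmod.
- by move=> v v' /eqP vi /eqP v'i vv'; have := F_quad vv'; rewrite vi v'i.
- by move=> v vi; have := F_quad (vw v vi); rewrite (eqP vi) wj.
Qed.

Lemma shift_opK v : shift_op (T v) * shift_op (T' v) = 1.
Proof. by apply: lin_opP => u; exact: TK. Qed.

Lemma shift_op'K v : shift_op (T' v) * shift_op (T v) = 1.
Proof. by apply: lin_opP => u; exact: T'K. Qed.

(** Terms with v != w cancel by [E_F_cross]. A term with v = w gives kap_v z_v^(p+q) - T'_v(kap_v)
    (z_v + c_vv)^(p+q); by [H_residue_true] these are the contributions of the two poles of v to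
    H_i. *)
Lemma EF_commutator i j p q : commutator (E_current i p) (F_current j q)
  = ('i * hbar * (i == j)%:R) *: mul_op (H_coef i (p + q).+1).
Proof.
rewrite /commutator /E_current /F_current /current.
pose G v w := mul_op (a v * gam v ^+ p) * shift_op (T v)
   * (mul_op (b w * (gam w + (s (node w))%:A) ^+ q) * shift_op (T' w))
  - mul_op (b w * (gam w + (s (node w))%:A) ^+ q) * shift_op (T' w)
   * (mul_op (a v * gam v ^+ p) * shift_op (T v)).
have -> : forall P1 P2 : pred V,
  (\sum_(v | P1 v) mul_op (a v * gam v ^+ p) * shift_op (T v)) *
  (\sum_(w | P2 w) mul_op (b w * (gam w + (s (node w))%:A) ^+ q) * shift_op (T' w)) -
  (\sum_(w | P2 w) mul_op (b w * (gam w + (s (node w))%:A) ^+ q) * shift_op (T' w)) *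
  (\sum_(v | P1 v) mul_op (a v * gam v ^+ p) * shift_op (T v))
  = \sum_(v | P1 v) \sum_(w | P2 w) G v w.
  move=> P1 P2; rewrite mulr_suml mulr_sumr -sumrB; apply: eq_bigr => v _.
  by rewrite mulr_sumr mulr_suml -sumrB.
have G0 v w : v != w -> G v w = 0.
  move=> vw; have wv : w != v by rewrite eq_sym.
  rewrite /G !mulrA -!(mulrA (mul_op _) (shift_op _)) !shift_mul_op !mulrA -!rmorphM -!mulrA.
  have -> : shift_op (T' w) * shift_op (T v) = shift_op (T v) * shift_op (T' w).
    by apply: lin_opP => u; exact/esym/TT'_comm.
  rewrite !mulrA -!mulrBl -rmorphB /=.
  have Tz : T v (gam w + (s (node w))%:A) = gam w + (s (node w))%:A.
    by rewrite rmorphD /= rmorph_alg T_gam.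
  rewrite [T v (_ * _)]rmorphM [T' w (_ * _)]rmorphM !rmorphXn /= Tz T'_gam //.
  have e := E_F_cross vw.
  set y := (X in mul_op X); suff -> : y = 0 by rewrite rmorph0 !mul0r.
  have e' := congr1 (fun u => u * (gam v ^+ p * (gam w + (s (node w))%:A) ^+ q)) e.
  by apply: (eq_from_subr e'); rewrite /= /y; ring.
have Gvv v : G v v = mul_op (kap v * gam v ^+ (p + q)
   - T' v (kap v) * (gam v + (s (node v))%:A) ^+ (p + q)).
  rewrite /G !mulrA -!(mulrA (mul_op _) (shift_op _)) !shift_mul_op !mulrA -!rmorphM -!mulrA.
  rewrite shift_opK shift_op'K !mulr1 -rmorphB /=; congr (mul_op _).
  have Tz : T v (gam v + (s (node v))%:A) = gam v.
    by rewrite rmorphD /= rmorph_alg T_gamv subrK.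
  rewrite [T v (_ * _)]rmorphM [T' v (_ * _)]rmorphM !rmorphXn /= Tz T'_gamv.
  by rewrite -F_weightE [T' v (_ * _)]rmorphM /= T'K !exprD; ring.
have [<-|ij] := eqVneq i j; last first.
  rewrite mulr0 scale0r big1 // => v /eqP vi; rewrite big1 // => w /eqP wj.
  by apply: G0; apply: contraNneq ij => vw; rewrite -vi vw wj.
rewrite mulr1 -linearZ /= /H_coef /partial_fractions_series.
rewrite scaler_sumr raddf_sum /=.
rewrite (eq_bigl (fun p => (node p.1 == i) && true)); last by move=> p'; rewrite /pole_of andbT.
rewrite -(pair_big_dep (fun v => node v == i) (fun _ _ => true)
  (fun v e => mul_op (('i * hbar) *: (residue (pole_of i) pole (H_numerator i) (v, e)
       * pole (v, e) ^+ (p + q))))).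
apply: eq_bigr => v /eqP vi; rewrite (bigD1 v) ?vi //= big1 => [|w /andP[_ wv]]; last first.
  by apply: G0; rewrite eq_sym.
rewrite addr0 Gvv big_bool /= -rmorphD /=; congr (mul_op _).
have := H_residue_true v; rewrite /H_residue /= vi => ->.
rewrite /kap /H_residue /= vi /pole /= vi linearZ /= -!scalerAl -scalerBr -scalerDr; congr (_ *: _).
by ring.
Qed.

Theorem difference_representation :
  exists psi : yangian hbar A d -> lin_op M,
  [/\ psi 1 = 1, forall x y, psi (x * y) = psi x * psi y,
      forall e x y, psi (e *: x + y) = e *: psi x + psi y &
      [/\ forall i n, psi (H_series (yH hbar A d) i n) = mul_op (H_coef i n),
          forall i n, psi (yE hbar A d i n) = E_current i n &
          forall i n, psi (yF hbar A d i n) = F_current i n]].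
Proof.
pose H i n := mul_op (H_coef i n.+1).
have HsE i : H_series H i = (fun p => mul_op (H_coef i p)).
  by apply/funext => -[|p] //=; rewrite rmorph1.
pose gen (x : yangian_gen l) : lin_op M := match x with
  | GenH i n => H i n | GenE i n => E_current i n | GenF i n => F_current i n end.
pose ev : {rmorphism free_yangian C l -> lin_op M} := @free_eval C (yangian_gen l) (lin_op M) gen.
have evZ e x : ev (e *: x) = e *: ev x by exact: free_evalZ.
have rel x y : free_rel hbar A d x y -> ev x = ev y.
  move=> /(yangian_rel_morph evZ).
  have -> : (fun i n => ev (free_gen C (GenH i n))) = H.
    by apply/funext => i; apply/funext => n; exact: free_eval_gen.
  have -> : (fun i n => ev (free_gen C (GenE i n))) = E_current.
    by apply/funext => i; apply/funext => n; exact: free_eval_gen.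
  have -> : (fun i n => ev (free_gen C (GenF i n))) = F_current.
    by apply/funext => i; apply/funext => n; exact: free_eval_gen.
  apply: yangian_rel_modes.
  - by move=> i j p q; rewrite /H -!rmorphM mulrC.
  - by move=> i j; rewrite HsE; exact: HE_quadratic.
  - by move=> i j; rewrite HsE; exact: HF_quadratic.
  - exact: E_current_quadratic.
  - exact: F_current_quadratic.
  - by move=> i j p q; exact: EF_commutator.
  - exact: E_current_serre.
  - exact: F_current_serre.
have [psi [psiE psi1 psiM psiD]] := presented_eval evZ rel (@yangian_proper C hbar l A d).
have psi_gen x : psi (yangian_of_gen hbar A d x) = gen x.
  by rewrite /yangian_of_gen psiE; exact: free_eval_gen.
exists psi; split=> //; split=> [i [|n]|i n|i n]; rewrite /= ?psi1 ?rmorph1 //; exact: psi_gen.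
Qed.

End DifferenceRepresentation.

(** * Weights that are products over pairs of variables *)

Section PairWeights.
Variables (C : numClosedFieldType) (hbar : C) (l : nat) (A : 'M[int]_l) (d : 'I_l -> nat).
Hypothesis A_diag : forall i, A i i = 2.
Hypothesis A_le0 : forall i j, i != j -> A i j <= 0.
Hypothesis d_sym : forall i j, (d i)%:Z * A i j = (d j)%:Z * A j i.
Variables (M : comUnitAlgType C) (V : finType) (node : V -> 'I_l) (gam : V -> M).
Variables (T : V -> {lrmorphism M -> M}).
Local Notation form := (root_form A d).
Local Notation hh := (half_hbar hbar).
Local Notation c i j := (hh (form i j)).
Local Notation s i := (hh (form i i)).
Hypothesis T_gam : forall v w, v != w -> T v (gam w) = gam w.
Hypothesis T_gamv : forall v, T v (gam v) = gam v - (s (node v))%:A.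
Hypothesis gam_unit : forall v w (k : int), v != w ->
  gam v - gam w + (hh k)%:A \is a GRing.unit.

Section Weight.
Variables (e : 'I_l -> C) (f : V -> V -> M).
Hypothesis f_T : forall u v w, v != w -> u != v -> u != w -> T u (f v w) = f v w.
Hypothesis f_quad : forall v w, v != w ->
  (gam v - gam w - (c (node v) (node w))%:A) * (f v w * T v (f w v))
  = (gam v - gam w + (c (node v) (node w))%:A) * (f w v * T w (f v w)).

Definition pair_weight v : M := e (node v) *: \prod_(w | w != v) f v w.

Lemma T_pair_weight v w : v != w -> T v (pair_weight w) =
  T v (f w v) * (e (node w) *: \prod_(u | (u != w) && (u != v)) f w u).
Proof.
move=> vw; rewrite /pair_weight linearZ /= -scalerAr; congr (_ *: _).
rewrite (bigD1 v) //= rmorphM rmorph_prod /=; congr (_ * _).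
by apply: eq_bigr => u /andP[uw uv]; rewrite f_T // eq_sym.
Qed.

Lemma pair_weightE v w : v != w -> pair_weight v =
  f v w * (e (node v) *: \prod_(u | (u != v) && (u != w)) f v u).
Proof.
by move=> vw; rewrite /pair_weight -scalerAr (bigD1 w) // eq_sym.
Qed.

(** T_v fixes the factors of the weight at w other than f w v, and symmetrically; these factors are
    common to both sides, which leaves the identity for the pair. *)
Lemma pair_weight_quad v w : v != w ->
  (gam v - gam w - (c (node v) (node w))%:A) * (pair_weight v * T v (pair_weight w))
  = (gam v - gam w + (c (node v) (node w))%:A) * (pair_weight w * T w (pair_weight v)).
Proof.
move=> vw; have wv : w != v by rewrite eq_sym.
rewrite (T_pair_weight vw) (T_pair_weight wv) (pair_weightE vw) (pair_weightE wv).
set x := e (node v) *: _; set y := e (node w) *: _.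
have e' := congr1 (fun u => u * (x * y)) (f_quad vw).
by apply: (eq_from_subr e'); rewrite /=; ring.
Qed.

Hypothesis f_unit : forall v w, v != w -> f v w \is a GRing.unit.
Hypothesis e_neq0 : forall i, e i != 0.

Lemma pair_weight_unit v : pair_weight v \is a GRing.unit.
Proof.
rewrite /pair_weight -mulr_algl unitrM scalar_unit //.
by rewrite rpred_prod // => w wv; rewrite f_unit // eq_sym.
Qed.

End Weight.

(** The interaction of v and w when it goes entirely into the weight of v and f w v = 1. For
    distinct nodes this is the choice made in the theorem, v being at the smaller node. *)
Definition one_sided_factor v w : M :=
  if node v == node w then ((gam v - gam w) * (gam v - gam w - (s (node v))%:A))^-1
  else \prod_(1 <= r < (absz (A (node w) (node v))).+1)
    (gam v - (hh (form (node v) (node w) + r%:Z * form (node w) (node w)))%:A - gam w).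

Local Notation osf := one_sided_factor.

Lemma one_sided_factor_same_unit v w : v != w ->
  (gam v - gam w) * (gam v - gam w - (s (node v))%:A) \is a GRing.unit.
Proof.
move=> vw; rewrite unitrM; apply/andP; split.
  by have := gam_unit 0 vw; rewrite /half_hbar mulr0 scale0r addr0.
by have := gam_unit (- form (node v) (node v)) vw; rewrite half_hbarN scaleNr.
Qed.

Lemma one_sided_factor_unit v w : v != w -> osf v w \is a GRing.unit.
Proof.
move=> vw; rewrite /osf; case: ifP => _.
  by rewrite unitrV one_sided_factor_same_unit.
rewrite rpred_prod // => r _.
have := gam_unit (- (form (node v) (node w) + r%:Z * form (node w) (node w))) vw.
by rewrite half_hbarN scaleNr addrAC.
Qed.

Lemma T_one_sided_factor u v w : v != w -> u != v -> u != w -> T u (osf v w) = osf v w.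
Proof.
move=> vw uv uw; rewrite /osf; case: ifP => _.
  rewrite rmorphV ?one_sided_factor_same_unit //.
  by rewrite rmorphM !rmorphB /= rmorph_alg !T_gam.
rewrite rmorph_prod; apply: eq_bigr => r _.
by rewrite /= !rmorphB /= rmorph_alg !T_gam.
Qed.

Lemma one_sided_factor_quad v w : v != w ->
  (gam v - gam w - (c (node v) (node w))%:A) * osf v w
  = (gam v - gam w + (c (node v) (node w))%:A) * T w (osf v w).
Proof.
move=> vw; have wv : w != v by rewrite eq_sym.
rewrite /osf; case: eqVneq => [nvw|nvw].
  have U (k : int) (y : M) : y = gam v - gam w + (hh k)%:A -> y \is a GRing.unit.
    by move=> ->; exact: gam_unit.
  have hh0 : (hh 0)%:A = 0 :> M by rewrite /half_hbar mulr0 scale0r.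
  have U0 : gam v - gam w \is a GRing.unit by apply: (U 0); rewrite hh0 addr0.
  have U1 : gam v - gam w - (s (node v))%:A \is a GRing.unit.
    by apply: (U (- form (node v) (node v))); rewrite half_hbarN scaleNr.
  have U2 : gam v - gam w + (s (node v))%:A \is a GRing.unit by exact: U.
  rewrite rmorphV ?one_sided_factor_same_unit // rmorphM !rmorphB /= rmorph_alg.
  rewrite T_gamv T_gam // nvw !opprB -nvw.
  have -> : gam v + ((s (node v))%:A - gam w) = gam v - gam w + (s (node v))%:A by zmod.
  have -> : gam v - gam w + (s (node v))%:A - (s (node v))%:A = gam v - gam w by zmod.
  by rewrite [X in _ * X = _]invrM // mulVKr // invrM // mulrCA divrr // mulr1.
have e := @telescope_prod M (gam v - gam w) (c (node v) (node w))%:A (s (node w))%:A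
  `|A (node w) (node v)|%N.
rewrite mulrC [RHS]mulrC rmorph_prod /=.
have -> : \prod_(1 <= r < (absz (A (node w) (node v))).+1)
    (gam v - (hh (form (node v) (node w) + r%:Z * form (node w) (node w)))%:A - gam w)
  = \prod_(1 <= r < (absz (A (node w) (node v))).+1)
    (gam v - gam w - (c (node v) (node w))%:A - (s (node w))%:A *+ r).
  by apply: eq_bigr => r _; rewrite half_hbarD half_hbarMn scalerDl -scalerMnl; zmod.
have -> : \prod_(1 <= r < (absz (A (node w) (node v))).+1)
    T w (gam v - (hh (form (node v) (node w) + r%:Z * form (node w) (node w)))%:A - gam w)
  = \prod_(1 <= r < (absz (A (node w) (node v))).+1)
    (gam v - gam w + (s (node w))%:A - (c (node v) (node w))%:A - (s (node w))%:A *+ r).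
  apply: eq_bigr => r _; rewrite !rmorphB /= rmorph_alg T_gamv T_gam // half_hbarD half_hbarMn scalerDl -scalerMnl; zmod.
apply: e; rewrite !scalerMnl -scaleNr; congr (_ *: _).
exact: (shift_sum hbar A_diag A_le0 d_sym).
Qed.

Lemma one_sided_pair (f : V -> V -> M) v w : v != w ->
  (f v w = osf v w /\ f w v = 1) \/ (f v w = 1 /\ f w v = osf w v) ->
  (gam v - gam w - (c (node v) (node w))%:A) * (f v w * T v (f w v))
  = (gam v - gam w + (c (node v) (node w))%:A) * (f w v * T w (f v w)).
Proof.
move=> vw [[-> ->]|[-> ->]].
  by rewrite rmorph1 mulr1 mul1r one_sided_factor_quad.
have wv : w != v by rewrite eq_sym.
have e := one_sided_factor_quad wv.
rewrite rmorph1 mulr1 mul1r; apply: (eq_from_subr e).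
by rewrite (formC d_sym (node w)); ring.
Qed.

(** The choice made in the theorem for two variables at one node, where the interaction is
    shared. *)
Lemma symmetric_pair (f : V -> V -> M) v w : v != w -> node v = node w ->
  f v w = (gam v - gam w)^-1 -> f w v = (gam w - gam v)^-1 ->
  (gam v - gam w - (c (node v) (node w))%:A) * (f v w * T v (f w v))
  = (gam v - gam w + (c (node v) (node w))%:A) * (f w v * T w (f v w)).
Proof.
move=> vw nvw -> ->; have wv : w != v by rewrite eq_sym.
have U0 : gam v - gam w \is a GRing.unit.
  by have := gam_unit 0 vw; rewrite /half_hbar mulr0 scale0r addr0.
have U0' : gam w - gam v \is a GRing.unit by rewrite -opprB unitrN.
have U1 : gam v - gam w - (s (node v))%:A \is a GRing.unit.
  by have := gam_unit (- form (node v) (node v)) vw; rewrite half_hbarN scaleNr.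
have U2 : gam v - gam w + (s (node v))%:A \is a GRing.unit by exact: gam_unit.
rewrite !rmorphV //= !rmorphB /= !T_gamv !T_gam // nvw.
have -> : gam w - (gam v - (s (node w))%:A) = - (gam v - gam w - (s (node w))%:A) by zmod.
have -> : gam v - (gam w - (s (node w))%:A) = gam v - gam w + (s (node w))%:A by zmod.
rewrite nvw in U1 U2; rewrite invrN mulrN mulrCA mulrN divrr // mulrCA divrr // mulr1.
by rewrite -[gam w - _]opprB invrN mulr1; ring.
Qed.

End PairWeights.

Section BigTagged.
Variables (R : Type) (idx : R) (op : Monoid.com_law idx) (l : nat) (m : 'I_l -> nat).
Local Notation V := {i : 'I_l & 'I_(m i)}.

Lemma big_tag_pred (P : pred 'I_l) (F : V -> R) :
  \big[op/idx]_(v : V | P (tag v)) F v =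
  \big[op/idx]_(i | P i) \big[op/idx]_(k < m i) F (Tagged (fun i => 'I_(m i)) k).
Proof.
rewrite (sig_big_dep P (fun _ _ => true) (fun i k => F (Tagged (fun i => 'I_(m i)) k))) /=.
by apply: eq_big => [v|[i k] _ //]; rewrite andbT.
Qed.

Lemma big_tag_eq i (F : V -> R) : \big[op/idx]_(v : V | tag v == i) F v =
  \big[op/idx]_(k < m i) F (Tagged (fun i => 'I_(m i)) k).
Proof. by rewrite (big_tag_pred (pred1 i)) big_pred1_eq. Qed.

End BigTagged.

(** * The operators of the theorem as currents on meromorphic functions *)

Section MeroRepresentation.
Variables (C : numClosedFieldType) (hbar : C) (l : nat) (A : 'M[int]_l) (d m : 'I_l -> nat).
Hypothesis hbar_neq0 : hbar != 0.
Hypothesis A_diag : forall i, A i i = 2.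
Hypothesis A_le0 : forall i j, i != j -> A i j <= 0.
Hypothesis d_gt0 : forall i, (0 < d i)%N.
Hypothesis d_sym : forall i j, (d i)%:Z * A i j = (d j)%:Z * A j i.
Local Notation V := {i : 'I_l & 'I_(m i)}.
Local Notation M := (mero C (nvars m)).
Local Notation form := (root_form A d).
Local Notation hh := (half_hbar hbar).
Local Notation node := (fun v : V => tag v).
Local Notation Tag k := (Tagged (fun i => 'I_(m i)) k).

Definition mero_gamma (v : V) : M := mero_coord C (enum_rank v).

Definition mero_shift (v : V) : {lrmorphism M -> M} :=
  mero_translate (- hh (form (tag v) (tag v)) *: delta_mx 0 (enum_rank v)).

Definition mero_shift' (v : V) : {lrmorphism M -> M} :=
  mero_translate (hh (form (tag v) (tag v)) *: delta_mx 0 (enum_rank v)).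

Arguments mero_shift : simpl never.
Arguments mero_shift' : simpl never.

Local Notation gam := mero_gamma.
Local Notation T := mero_shift.
Local Notation T' := mero_shift'.

Lemma mero_shiftK v u : T v (T' v u) = u.
Proof. by rewrite /mero_shift /mero_shift' /= mero_translate_comp -scalerDl addNr scale0r mero_translate0. Qed.

Lemma mero_shift'K v u : T' v (T v u) = u.
Proof. by rewrite /mero_shift /mero_shift' /= mero_translate_comp -scalerDl addrN scale0r mero_translate0. Qed.

Lemma mero_shift_comm v w u : T v (T w u) = T w (T v u).
Proof. by rewrite /mero_shift /= !mero_translate_comp addrC. Qed.

Lemma mero_shift_gamma v w : v != w -> T v (gam w) = gam w.
Proof.
move=> vw; rewrite /mero_shift /= mero_translate_coord !mxE /= (inj_eq enum_rank_inj) eq_sym.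
by rewrite (negbTE vw) mulr0 scale0r addr0.
Qed.

Lemma mero_shift_gammav v : T v (gam v) = gam v - (hh (form (tag v) (tag v)))%:A.
Proof. by rewrite /mero_shift /= mero_translate_coord !mxE !eqxx mulr1 scaleNr. Qed.

Lemma mero_gamma_unit v w (k : int) : v != w -> gam v - gam w + (hh k)%:A \is a GRing.unit.
Proof. by move=> vw; apply: mero_coord_unit; rewrite (inj_eq enum_rank_inj). Qed.

Definition mero_factor (v w : V) : M :=
  if tag v == tag w then (gam v - gam w)^-1
  else if (tag v < tag w)%N then one_sided_factor hbar A d (fun v => tag v) gam v w else 1.

Definition mero_weight : V -> M := pair_weight (fun v => tag v) (inv_sqrt_d C d) mero_factor.

Lemma mero_factor_unit v w : v != w -> mero_factor v w \is a GRing.unit.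
Proof.
move=> vw; rewrite /mero_factor; case: ifP => _.
  by rewrite unitrV; have := mero_gamma_unit 0 vw; rewrite /half_hbar mulr0 scale0r addr0.
by case: ifP => _; [exact: (one_sided_factor_unit _ _ _ mero_gamma_unit)|exact: unitr1].
Qed.

Lemma mero_shift_factor u v w : v != w -> u != v -> u != w ->
  T u (mero_factor v w) = mero_factor v w.
Proof.
move=> vw uv uw; rewrite /mero_factor; case: ifP => _.
  rewrite rmorphV; first by rewrite rmorphB /= !mero_shift_gamma.
  by have := mero_gamma_unit 0 vw; rewrite /half_hbar mulr0 scale0r addr0.
case: ifP => _; last exact: rmorph1.
by apply: T_one_sided_factor => //; [exact: mero_shift_gamma|exact: mero_gamma_unit].
Qed.

Lemma mero_factor_quad v w : v != w ->
  (gam v - gam w - (hh (form (tag v) (tag w)))%:A) * (mero_factor v w * T v (mero_factor w v))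
  = (gam v - gam w + (hh (form (tag v) (tag w)))%:A) * (mero_factor w v * T w (mero_factor v w)).
Proof.
move=> vw; have [nvw|nvw] := eqVneq (tag v) (tag w).
  apply: (@symmetric_pair _ _ _ A d _ _ (fun v => tag v) gam T
      mero_shift_gamma mero_shift_gammav mero_gamma_unit) => //.
    by rewrite /mero_factor nvw eqxx.
  by rewrite /mero_factor nvw eqxx.
apply: (@one_sided_pair _ _ _ A d A_diag A_le0 d_sym _ _ (fun v => tag v) gam T
  mero_shift_gamma mero_shift_gammav mero_gamma_unit) => //.
rewrite /mero_factor (eq_sym (tag w)) (negbTE nvw).
by case: ltngtP => vw'; [left|right|case/eqP: nvw; exact: val_inj].
Qed.

Lemma inv_sqrt_d_neq0 i : inv_sqrt_d C d i != 0.
Proof. by rewrite invr_eq0 sqrtC_eq0 pnatr_eq0 -lt0n. Qed.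

Lemma mero_weight_unit v : mero_weight v \is a GRing.unit.
Proof. by apply: pair_weight_unit; [exact: mero_factor_unit|exact: inv_sqrt_d_neq0]. Qed.

Lemma mero_weight_quad v w : v != w ->
  (gam v - gam w - (hh (form (tag v) (tag w)))%:A) * (mero_weight v * T v (mero_weight w))
  = (gam v - gam w + (hh (form (tag v) (tag w)))%:A) * (mero_weight w * T w (mero_weight v)).
Proof.
by move=> vw; apply: pair_weight_quad => //; [exact: mero_shift_factor|exact: mero_factor_quad].
Qed.

Lemma mero_weightE i (k : 'I_(m i)) : mero_weight (Tag k) = inv_sqrt_d C d i *:
  ((\prod_(s < l | (i < s)%N) \prod_(1 <= r < (absz (A s i)).+1)
     (Ppoly C m s).[gamma C k - pole_shift hbar A d m i s r]) / gamma_diff C k).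
Proof.
rewrite /mero_weight /pair_weight /=; congr (_ *: _).
(* Variables at node i give [gamma_diff], those at larger nodes the product over s, the remaining
   ones 1. *)
rewrite (bigID (fun w : V => tag w == i)) /= mulrC; congr (_ * _).
  rewrite (eq_bigr (fun w : V => if (i < tag w)%N then
      one_sided_factor hbar A d (fun v => tag v) gam (Tag k) w else 1)); last first.
    by move=> w /andP[_ wi]; rewrite /mero_factor /= eq_sym (negbTE wi).
  rewrite -big_mkcondr /=.
  transitivity (\prod_(w : V | (i < tag w)%N)
    one_sided_factor hbar A d (fun v => tag v) gam (Tag k) w).
    apply: eq_bigl => w; case: ltnP => iw; rewrite ?andbF // andbT.
    rewrite andbC; case: eqVneq => [wi|wi] /=; first by rewrite wi ltnn in iw.
    by apply: contraNneq wi => ->.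
  rewrite (big_tag_pred _ (fun s : 'I_l => (i < s)%N)); apply: eq_bigr => s si.
  rewrite (eq_bigr (fun k' : 'I_(m s) => \prod_(1 <= r < (absz (A s i)).+1)
     (gamma C k - pole_shift hbar A d m i s r - gamma C k'))); last first.
    move=> k' _; rewrite /one_sided_factor /= ifN //.
    by apply: contraTneq si => ->; rewrite ltnn.
  rewrite exchange_big; apply: eq_bigr => r _ /=.
  by rewrite /Ppoly horner_prod; apply: eq_bigr => p _; rewrite hornerXsubC.
rewrite /gamma_diff -prodrV => [|p pk]; last first.
  have := @mero_gamma_unit (Tag k) (Tag p) 0; rewrite /half_hbar mulr0 scale0r addr0; apply.
  by rewrite eq_Tagged eq_sym.
transitivity (\prod_(w : V | (tag w == i) && (w != Tag k)) (gam (Tag k) - gam w)^-1).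
  apply: eq_big => [w|w /andP[_ wi]]; first exact: andbC.
  by rewrite /mero_factor /= eq_sym wi.
rewrite big_mkcondr big_tag_eq -big_mkcond.
by apply: eq_bigl => p; rewrite eq_Tagged.
Qed.

Local Notation isd := (inv_sqrt_d C d).

Lemma E_opE i n (u : M) :
  E_op hbar A d i n u = current gam T mero_weight (fun v => tag v == i) n u.
Proof.
rewrite /current lin_op_sumE big_tag_eq /E_op scaler_sumr; apply: eq_bigr => k _.
by rewrite [RHS]/(mero_weight (Tag k) * gam (Tag k) ^+ n * T (Tag k) u) mero_weightE !scalerAl.
Qed.

Variables (Rn Rd : 'I_l -> {poly C}).

Lemma Ppoly_comp s (t : M) :
  Ppoly C m s \Po ('X - t%:P) = \prod_(p < m s) ('X - (gamma C p + t)%:P).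
Proof.
rewrite /Ppoly rmorph_prod; apply: eq_bigr => p _.
by rewrite /= comp_polyB comp_polyX comp_polyC polyCD; zmod.
Qed.

Lemma H_numE i : H_num hbar A d m Rn i = H_numerator hbar A d (fun v => tag v) gam Rn i.
Proof.
rewrite /H_num /H_numerator; congr (_ * _).
rewrite (big_tag_pred _ (fun s => s != i)); apply: eq_bigr => s si.
rewrite /H_factor /= exchange_big; apply: eq_bigr => r _ /=.
by rewrite Ppoly_comp.
Qed.

Lemma H_denE i : H_den hbar A d m Rd i =
  to_meroP m (Rd i) * H_denominator hbar A d (fun v => tag v) gam i.
Proof.
rewrite /H_den /H_denominator; congr (_ * _).
by rewrite big_tag_eq big_split /= Ppoly_comp.
Qed.

Hypothesis Rn_monic : forall i, Rn i \is monic.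

Lemma H_num_horner i (y : M) : (H_num hbar A d m Rn i).[y] = (to_meroP m (Rn i)).[y] *
  \prod_(s < l | s != i) \prod_(1 <= r < (absz (A s i)).+1)
     (Ppoly C m s).[y - pole_shift hbar A d m i s r].
Proof.
rewrite /H_num hornerM horner_prod; congr (_ * _); apply: eq_bigr => s _.
rewrite horner_prod; apply: eq_bigr => r _.
by rewrite horner_comp hornerXsubC.
Qed.

Definition F_coef i (k : 'I_(m i)) : M := - isd i *:
  (R_at Rn Rd i (gamma C k + step hbar A d m i) *
  (\prod_(s < l | (s < i)%N) \prod_(1 <= r < (absz (A s i)).+1)
     (Ppoly C m s).[gamma C k - pole_shift hbar A d m i s r + step hbar A d m i])
  / gamma_diff C k).

Lemma mero_shift_gamma_self i (k : 'I_(m i)) :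
  T (Tag k) (gamma C k) = gamma C k - step hbar A d m i.
Proof. exact: (mero_shift_gammav (Tag k)). Qed.

Lemma mero_shift_gamma_other i j (k : 'I_(m i)) (p : 'I_(m j)) :
  Tag k != Tag p -> T (Tag k) (gamma C p) = gamma C p.
Proof. exact: mero_shift_gamma. Qed.

Lemma shift_gamma_diff i (k : 'I_(m i)) : T (Tag k) (gamma_diff C k) =
  \prod_(p < m i | p != k) (gamma C k - step hbar A d m i - gamma C p).
Proof.
rewrite /gamma_diff rmorph_prod; apply: eq_bigr => p pk; rewrite rmorphB /=.
by rewrite mero_shift_gamma_self mero_shift_gamma_other // eq_Tagged eq_sym.
Qed.

Lemma gamma_diff_unit i (k : 'I_(m i)) : gamma_diff C k \is a GRing.unit.
Proof.
rewrite rpred_prod // => p pk.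
have := @mero_gamma_unit (Tag k) (Tag p) 0; rewrite /half_hbar mulr0 scale0r addr0; apply.
by rewrite eq_Tagged eq_sym.
Qed.

Lemma shift_step i (k : 'I_(m i)) (y : M) :
  T (Tag k) (y + step hbar A d m i) = T (Tag k) y + step hbar A d m i.
Proof. by rewrite rmorphD /= rmorph_alg. Qed.

Lemma shift_F_coef i (k : 'I_(m i)) : Rd i = 1 -> T (Tag k) (F_coef k) = - isd i *:
  ((to_meroP m (Rn i)).[gamma C k] *
  (\prod_(s < l | (s < i)%N) \prod_(1 <= r < (absz (A s i)).+1)
     (Ppoly C m s).[gamma C k - pole_shift hbar A d m i s r])
  / T (Tag k) (gamma_diff C k)).
Proof.
move=> Rd1; have Ts : T (Tag k) (gamma C k + step hbar A d m i) = gamma C k.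
  by rewrite shift_step mero_shift_gamma_self subrK.
rewrite /F_coef linearZ /=; congr (_ *: _).
rewrite rmorphM rmorphM /= rmorphV ?gamma_diff_unit //=; congr (_ * _ / _).
  rewrite /R_at Rd1 /to_meroP rmorph1 hornerC divr1 -horner_map /= Ts; congr horner.
  by rewrite -map_poly_comp; apply: eq_map_poly => x /=; rewrite rmorph_alg.
rewrite rmorph_prod; apply: eq_bigr => s si; rewrite rmorph_prod; apply: eq_bigr => r _ /=.
rewrite /Ppoly !horner_prod rmorph_prod; apply: eq_bigr => p _ /=.
rewrite !hornerXsubC (addrAC (gamma C k)) rmorphB rmorphB /= Ts rmorph_alg.
rewrite mero_shift_gamma_other //.
by apply: contraTneq si => /(congr1 (fun v : V => tag v)) /= ->; rewrite ltnn.
Qed.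

(** After T_v the weight is kap_v / a_v. Dividing the product over s != i in H_i by the one over s >
    i in a_v leaves s < i, and the factor [gamma_diff] of [same_node_prod] cancels against that of
    a_v. *)
Lemma F_coefE i (k : 'I_(m i)) : Rd i = 1 -> F_coef k =
  F_weight hbar A d (fun v => tag v) gam T' mero_weight Rn (Tag k).
Proof.
move=> Rd1; apply: (can_inj (mero_shift'K (Tag k))); rewrite /F_weight mero_shiftK.
apply: (mulIr (mero_weight_unit (Tag k))); rewrite mulrVK ?mero_weight_unit //.
rewrite shift_F_coef // mero_weightE /E_F_residue H_residueE /= -H_numE H_num_horner.
rewrite /pole /= expr1.
set r := (to_meroP m (Rn i)).[_].
set N1 := \prod_(s < l | (i < s)%N) _; set N2 := \prod_(s < l | (s < i)%N) _.
set N := \prod_(s < l | s != i) _.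
have -> : N = N1 * N2.
  rewrite /N (bigID (fun s : 'I_l => (i < s)%N)) /=; congr (_ * _).
    by apply: eq_bigl => s; rewrite andb_idl // => lt_is; apply: contraTneq lt_is => ->; rewrite ltnn.
  by apply: eq_bigl => s; rewrite -leqNgt leq_eqVlt -val_eqE /=; case: ltngtP.
have -> : same_node_prod hbar A d (fun v => tag v) gam (Tag k) (gam (Tag k))
    = gamma_diff C k * T (Tag k) (gamma_diff C k).
  rewrite shift_gamma_diff /same_node_prod /=.
  transitivity (\prod_(v : V | tag v == i) (if v != Tag k then
     (gam (Tag k) - gam v) * (gam (Tag k) - gam v - (hh (form i i))%:A) else 1)).
    by rewrite -big_mkcondr.
  rewrite big_tag_eq -big_mkcond /gamma_diff -big_split /=.
  by apply: eq_big => [p|p _]; rewrite ?eq_Tagged // addrAC.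
set g := gamma_diff C k; have gU : g \is a GRing.unit := gamma_diff_unit k.
set g' := T (Tag k) g; have g'U : g' \is a GRing.unit by rewrite rmorph_unit.
have sU : (hh (form i i))%:A \is a @GRing.unit M.
  exact/scalar_unit/(half_hbar_form_neq0 hbar_neq0 A_diag d_gt0).
(* As a_ii = 2, c_vv is ['i * hbar] times d_i; so ['i * hbar] over c_vv is 1 / d_i, the product of
   the factors d_i^(-1/2) of E_i and F_i. *)
have isd2 : isd i * isd i = (d i)%:R^-1 by rewrite /inv_sqrt_d -invrM ?unitfE ?sqrtC_eq0 ?pnatr_eq0 -?lt0n // -expr2 sqrtCK.
have d0 : (d i)%:R != 0 :> C by rewrite pnatr_eq0 -lt0n.
have hsE : hh (form i i) = 'i * hbar * (d i)%:R.
  rewrite /half_hbar /root_form A_diag rmorphM /= -pmulrn; by field.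
have -> : - 1 * (hh (form i i))%:A * (g * g') = (- hh (form i i)) *: (g * g') :> M.
  by rewrite mulN1r mulNr -scalerAl mul1r scaleNr.
rewrite invrZ ?unitrM ?gU // ?unitfE ?oppr_eq0 ?(half_hbar_form_neq0 hbar_neq0 A_diag d_gt0) //.
rewrite invrM //.
have -> : - isd i *: (r * N2 / g') * (isd i *: (N1 / g))
   = (- (isd i * isd i)) *: (r * N2 / g' * (N1 / g)).
  by rewrite -scalerAl -scalerAr scalerA mulNr.
have -> : ('i * hbar) *: (r * (N1 * N2) * ((- hh (form i i))^-1 *: (g'^-1 / g)))
   = (- (isd i * isd i)) *: (r * (N1 * N2) * (g'^-1 / g)).
  rewrite -scalerAr scalerA isd2 hsE; congr (_ *: _).
  by field; rewrite d0 hbar_neq0 neq0Ci.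
congr (_ *: _); ring.
Qed.

Lemma F_opE i n (u : M) : Rd i = 1 -> F_op hbar A d Rn Rd i n u
  = current (fun v : V => gam v + (hh (form (tag v) (tag v)))%:A) T'
      (F_weight hbar A d (fun v => tag v) gam T' mero_weight Rn) (fun v => tag v == i) n u.
Proof.
move=> Rd1; rewrite /current lin_op_sumE big_tag_eq /F_op scaler_sumr; apply: eq_bigr => k _.
by rewrite -F_coefE // /F_coef [RHS]/(_ * _ * _) !scalerAl.
Qed.

End MeroRepresentation.

Section YangianRepresentation.
Variables (C : numClosedFieldType) (hbar : C) (l : nat) (A : 'M[int]_l) (d m : 'I_l -> nat).
Hypothesis hbar_neq0 : hbar != 0.
Hypothesis A_diag : forall i, A i i = 2.
Hypothesis A_le0 : forall i j, i != j -> A i j <= 0.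
Hypothesis d_gt0 : forall i, (0 < d i)%N.
Hypothesis d_sym : forall i j, (d i)%:Z * A i j = (d j)%:Z * A j i.
Local Notation V := {i : 'I_l & 'I_(m i)}.
Local Notation M := (mero C (nvars m)).

Lemma sum_tag_A i : \sum_(v : V) A (tag v) i = \sum_j (m j)%:Z * A j i.
Proof.
rewrite (big_tag_pred _ xpredT); apply: eq_bigr => j _.
by rewrite /= sumr_const card_ord -mulr_natl natz.
Qed.

Theorem mero_yangian_representation (Rn Rd : 'I_l -> {poly C}) :
  (forall i, Rn i \is monic) -> (forall i, Rd i = 1) ->
  (forall i, ((size (Rn i)).-1)%:Z = \sum_j (m j)%:Z * A j i) ->
  exists phi : yangian hbar A d -> M -> M,
    represents_HE Rn Rd (fun _ => True) phi /\
    forall i s f, phi (yF hbar A d i s) f = F_op hbar A d Rn Rd i s f.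
Proof.
move=> Rn_monic Rd1 Rn_size.
have [|psi [psi1 psiM psiD [psiH psiE psiF]]] := difference_representation hbar_neq0 A_diag A_le0
  d_gt0 d_sym (@mero_shiftK C hbar l A d m) (@mero_shift'K C hbar l A d m)
  (@mero_shift_comm C hbar l A d m) (@mero_shift_gamma C hbar l A d m)
  (@mero_shift_gammav C hbar l A d m) (@mero_gamma_unit C hbar l m)
  (mero_weight_unit hbar A d_gt0) (mero_weight_quad hbar A_diag A_le0 d_sym) Rn_monic.
  by move=> i; rewrite Rn_size sum_tag_A.
exists (fun x => psi x); split; last first.
  by move=> i s f; rewrite psiF F_opE.
split.
- split=> [x _|f|x y f _ _|a x y f _ _].
  + exact: lin_op_linear.
  + by rewrite psi1.
  + by rewrite psiM.
  + by rewrite psiD.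
- move=> i; exists (H_coef hbar A d (fun v : V => tag v) (@mero_gamma C l m) Rn i).
    rewrite H_numE H_denE Rd1 /to_meroP rmorph1 mul1r.
    apply: H_expansion => //; first exact: mero_gamma_unit.
    by move=> j; rewrite Rn_size sum_tag_A.
  by move=> n f; rewrite psiH.
- by move=> i n f; rewrite psiE E_opE.
Qed.

End YangianRepresentation.

(** * Rational [R_i]: approximation by representations with polynomial [R_i] *)

Section FunctionAlgebra.
Variables (C : numFieldType) (X : Type) (x0 : X) (M : comUnitAlgType C).

(** The argument records a point of X, which makes the algebra nonzero. *)
Definition fun_alg of X : Type := X -> M.
Local Notation F := (fun_alg x0).

HB.instance Definition _ := GRing.ComPzRing.on F.
HB.instance Definition _ := GRing.Lmodule.on F.

Fact fun_alg_neq0 : (1 : F) != 0.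
Proof.
by apply/eqP => /(congr1 (fun f : F => f x0)) /eqP; apply/negP; exact: oner_neq0.
Qed.

HB.instance Definition _ := GRing.PzSemiRing_isNonZero.Build F fun_alg_neq0.

Fact fun_alg_scaleAl (c : C) (f g : F) : c *: (f * g) = c *: f * g.
Proof. by apply/funext => x; exact: scalerAl. Qed.

HB.instance Definition _ := GRing.Lmodule_isLalgebra.Build C F fun_alg_scaleAl.
HB.instance Definition _ := GRing.Lalgebra_isComAlgebra.Build C F.

Definition fun_alg_unit : {pred F} := fun f => `[< forall x, f x \is a GRing.unit >].
Definition fun_alg_inv (f : F) : F := if f \in fun_alg_unit then fun x => (f x)^-1 else f.

Fact fun_alg_mulVr : {in fun_alg_unit, left_inverse 1 fun_alg_inv *%R}.
Proof.
move=> f uf; rewrite /fun_alg_inv uf; apply/funext => x.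
by apply: mulVr; move/asboolP: uf; exact.
Qed.

Fact fun_alg_unitPl (f g : F) : g * f = 1 -> fun_alg_unit f.
Proof.
move=> gf; apply/asboolP => x; apply/unitrPr; exists (g x).
by rewrite mulrC; exact: (congr1 (fun h : F => h x) gf).
Qed.

Fact fun_alg_inv_out : {in [predC fun_alg_unit], fun_alg_inv =1 id}.
Proof. by move=> f; rewrite inE /= /fun_alg_inv => /negbTE->. Qed.

HB.instance Definition _ := GRing.ComNzRing_hasMulInverse.Build F
  fun_alg_mulVr fun_alg_unitPl fun_alg_inv_out.

Lemma fun_alg_unitP (f : F) : (forall x, f x \is a GRing.unit) -> f \is a GRing.unit.
Proof. by move=> uf; apply/asboolP. Qed.

Definition fun_eval x (f : F) : M := f x.

HB.instance Definition _ x := GRing.isZmodMorphism.Build F M (fun_eval x) (fun _ _ => erefl).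
HB.instance Definition _ x := GRing.isMonoidMorphism.Build F M (fun_eval x)
  (conj erefl (fun _ _ => erefl)).
HB.instance Definition _ x := GRing.isScalable.Build C F M *:%R (fun_eval x) (fun _ _ => erefl).

Definition fun_cst (u : M) : F := fun _ => u.
HB.instance Definition _ := GRing.isZmodMorphism.Build M F fun_cst (fun _ _ => erefl).
HB.instance Definition _ := GRing.isMonoidMorphism.Build M F fun_cst
  (conj erefl (fun _ _ => erefl)).
HB.instance Definition _ := GRing.isScalable.Build C M F *:%R fun_cst (fun _ _ => erefl).

Definition fun_comp (g : X -> X) (f : F) : F := f \o g.
HB.instance Definition _ g := GRing.isZmodMorphism.Build F F (fun_comp g) (fun _ _ => erefl).
HB.instance Definition _ g := GRing.isMonoidMorphism.Build F F (fun_comp g)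
  (conj erefl (fun _ _ => erefl)).
HB.instance Definition _ g := GRing.isScalable.Build C F F *:%R (fun_comp g) (fun _ _ => erefl).

Definition fun_map (T : {lrmorphism M -> M}) (f : F) : F := T \o f.

Fact fun_map_is_zmod_morphism T : zmod_morphism (fun_map T).
Proof. by move=> f g; apply/funext => x; exact: raddfB. Qed.
Fact fun_map_is_monoid_morphism T : monoid_morphism (fun_map T).
Proof.
by split=> [|f g]; apply/funext => x; [exact: rmorph1|exact: rmorphM].
Qed.
Fact fun_map_is_scalable T : scalable (fun_map T).
Proof. by move=> c f; apply/funext => x; exact: linearZ. Qed.

HB.instance Definition _ T := GRing.isZmodMorphism.Build F F (fun_map T) (fun_map_is_zmod_morphism T).
HB.instance Definition _ T := GRing.isMonoidMorphism.Build F F (fun_map T) (fun_map_is_monoid_morphism T).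
HB.instance Definition _ T := GRing.isScalable.Build C F F *:%R (fun_map T) (fun_map_is_scalable T).

End FunctionAlgebra.

Lemma divp_monic (K : fieldType) (p q : {poly K}) : p \is monic -> q \is monic ->
  (size q <= size p)%N -> p %/ q \is monic.
Proof.
move=> mp mq qp; have q0 := monic_neq0 mq.
have d0 : p %/ q != 0 by rewrite divpN0.
have sr : (size (p %% q)%R < size (p %/ q * q)%R)%N.
  rewrite size_mul //; apply: (@leq_trans (size q)); first by rewrite ltn_modp.
  by move: d0; rewrite -size_poly_eq0; case: (size _) => // n _; rewrite addSn leq_addl.
have := lead_coefDl sr; rewrite -divp_eq (monicP mp) lead_coefM (monicP mq) mulr1.
by move=> e; rewrite monicE -e.
Qed.

(** * Actions of Y(b) as limits of subquotients of representations of Y(g) *)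

Section BorelLimit.
Variables (C : numClosedFieldType) (hbar : C) (l : nat) (A : 'M[int]_l) (d : 'I_l -> nat).
Variables (M : comUnitAlgType C) (h : 'I_l -> nat -> M) (X : 'I_l -> nat -> lin_op M).
Local Notation Y := (yangian hbar A d).

(** The graph of the wanted morphism on Y(b). It is total there by construction; the work lies in
    showing that it is single-valued. *)
Inductive realizes : Y -> lin_op M -> Prop :=
| realizesH i n : realizes (yH hbar A d i n) (mul_op (h i n.+1))
| realizesE i n : realizes (yE hbar A d i n) (X i n)
| realizes1 : realizes 1 1
| realizesD x y o o' : realizes x o -> realizes y o' -> realizes (x + y) (o + o')
| realizesZ a x o : realizes x o -> realizes (a *: x) (a *: o)
| realizesM x y o o' : realizes x o -> realizes y o' -> realizes (x * y) (o * o').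

Lemma realizes_exists x : yangian_borel x -> exists o, realizes x o.
Proof.
elim=> [i n|i n| |x1 x2 _ [ o1 r1] _ [ o2 r2]|a x1 _ [ o1 r1]|x1 x2 _ [ o1 r1] _ [ o2 r2]].
- by eexists; exact: realizesH.
- by eexists; exact: realizesE.
- by eexists; exact: realizes1.
- by eexists; exact: realizesD r1 r2.
- by eexists; exact: realizesZ r1.
- by eexists; exact: realizesM r1 r2.
Qed.

Definition algebra_morphism (F : comUnitAlgType C) (psi : Y -> lin_op F) : Prop :=
  [/\ psi 1 = 1, forall x y, psi (x * y) = psi x * psi y
    & forall b x y, psi (b *: x + y) = b *: psi x + psi y].

(* [o'] acts on the subquotient of [F] given by [S] and [p] as [o] on [M]. *)
Definition intertwines (F : comUnitAlgType C) (S : F -> Prop) (p : {linear F -> M})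
    (o' : lin_op F) (o : lin_op M) : Prop :=
  forall u, S u -> S (o' u) /\ p (o' u) = o (p u).

Definition approximates N (F : comUnitAlgType C) (S : F -> Prop) (p : {linear F -> M})
    (psi : Y -> lin_op F) : Prop :=
  [/\ algebra_morphism psi,
      forall a u v, S u -> S v -> S (a *: u + v), forall x, exists2 u, S u & p u = x,
      forall i n, (n < N)%N -> intertwines S p (psi (yH hbar A d i n)) (mul_op (h i n.+1))
    & forall i n, intertwines S p (psi (yE hbar A d i n)) (X i n)].

(** An expression involves finitely many H_i^(n); N0 exceeds their indices. *)
Lemma realizes_intertwines x o : realizes x o -> exists N0, forall N F S p psi,
  (N0 <= N)%N -> @approximates N F S p psi -> intertwines S p (psi x) o.
Proof.
elim=> [i n|i n| |x1 x2 o1 o2 _ [N1 a1] _ [N2 a2]|a x1 o1 _ [N1 a1]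
  |x1 x2 o1 o2 _ [N1 a1] _ [N2 a2]].
- by exists n.+1 => N F S p psi nN [_ _ _ + _]; apply.
- by exists 0%N => N F S p psi _ [].
- by exists 0%N => N F S p psi _ [ [psi1 _ _] _ _ _ _] u Su; rewrite psi1.
- exists (maxn N1 N2) => N F S p psi; rewrite geq_max => /andP[N1N N2N] ap u Su.
  have [[_ _ psiD] SD _ _ _] := ap.
  have [S1 e1] := a1 _ _ _ _ _ N1N ap u Su; have [S2 e2] := a2 _ _ _ _ _ N2N ap u Su.
  have -> : psi (x1 + x2) = psi x1 + psi x2 by rewrite -[x1 in LHS]scale1r psiD scale1r.
  by rewrite lin_opDE -[psi x1 u]scale1r; split; [exact: SD|rewrite linearP e1 e2 scale1r].
- exists N1 => N F S p psi N1N ap u Su; have [[_ _ psiD] SD _ _ _] := ap.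
  have [S1 e1] := a1 _ _ _ _ _ N1N ap u Su.
  have psi0 : psi 0 = 0.
    by rewrite -[0 in LHS](addr0 0) -{1}(scaler0 _ (-1)) psiD scaleN1r addNr.
  have -> : psi (a *: x1) = a *: psi x1 by rewrite -[a *: x1]addr0 psiD psi0 addr0.
  have S0 : S 0 by rewrite -(addNr u) -scaleN1r; exact: SD.
  rewrite lin_opZE; split; last by rewrite linearZ e1.
  by rewrite -[a *: _]addr0; exact: SD.
- exists (maxn N1 N2) => N F S p psi; rewrite geq_max => /andP[N1N N2N] ap u Su.
  have [[_ psiM _] _ _ _ _] := ap.
  have [S2 e2] := a2 _ _ _ _ _ N2N ap u Su; have [S1 e1] := a1 _ _ _ _ _ N1N ap _ S2.
  by rewrite psiM lin_opME e1 e2.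
Qed.

(** A single approximation of high order intertwines [psi x] with the operators of any two
    expressions of x; as p maps S onto M, these operators coincide. *)
Theorem borel_representation :
  (forall N, exists (F : comUnitAlgType C) (S : F -> Prop) (p : {linear F -> M})
     (psi : Y -> lin_op F), approximates N S p psi) ->
  exists phi : Y -> M -> M, [/\ algebra_action (@yangian_borel _ hbar l A d) phi,
    forall i n u, phi (yH hbar A d i n) u = h i n.+1 * u
  & forall i n u, phi (yE hbar A d i n) u = X i n u].
Proof.
move=> approx; have uniq x o o' : realizes x o -> realizes x o' -> o = o'.
  move=> /realizes_intertwines[N1 r1] /realizes_intertwines[N2 r2].
  have [F [S [p [psi ap]]]] := approx (maxn N1 N2).
  apply: lin_opP => x0; have [_ _ /(_ x0)[u Su <-] _ _] := ap.
  have [_ <-] := r1 _ _ _ _ _ (leq_maxl _ _) ap u Su.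
  by have [_ <-] := r2 _ _ _ _ _ (leq_maxr _ _) ap u Su.
(* An element without a realization is sent to 0. *)
pose phi x : lin_op M :=
  if pselect (exists o, realizes x o) is left ex then projT1 (cid ex) else 0.
have phiE x o : realizes x o -> phi x = o.
  move=> ro; rewrite /phi; case: pselect => [ex|[]]; last by exists o.
  exact: uniq (projT2 (cid ex)) ro.
exists (fun x => phi x); split=> [|i n u|i n u]; last 2 first.
- by rewrite (phiE _ _ (realizesH i n)).
- by rewrite (phiE _ _ (realizesE i n)).
split=> [x _|u|x y u /realizes_exists[ o ro] /realizes_exists[ o' ro']
  |a x y u /realizes_exists[ o ro] /realizes_exists[ o' ro']].
- exact: lin_op_linear.
- by rewrite (phiE _ _ realizes1).
- by rewrite (phiE _ _ ro) (phiE _ _ ro') (phiE _ _ (realizesM ro ro')).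
- by rewrite (phiE _ _ ro) (phiE _ _ ro') (phiE _ _ (realizesD (realizesZ a ro) ro')).
Qed.

End BorelLimit.

Lemma predn_size_monic (K : nzRingType) (p : {poly K}) : p \is monic -> (size p).-1.+1 = size p.
Proof. by move=> mp; rewrite prednK // lt0n size_poly_eq0 monic_neq0. Qed.

Lemma size_pred_monicM (K : nzRingType) (p q : {poly K}) : p \is monic -> q \is monic ->
  (size (p * q)).-1 = ((size p).-1 + (size q).-1)%N.
Proof.
move=> mp mq; rewrite size_monicM ?monic_neq0 //.
by rewrite -(predn_size_monic mp) -(predn_size_monic mq) /= addnS.
Qed.

(** * Extension by lattice variables and rational R_i *)

Section BorelDifferenceRepresentation.
Variables (C : numClosedFieldType) (hbar : C) (l : nat) (A : 'M[int]_l) (d : 'I_l -> nat).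
Hypothesis hbar_neq0 : hbar != 0.
Hypothesis A_diag : forall i, A i i = 2.
Hypothesis A_le0 : forall i j, i != j -> A i j <= 0.
Hypothesis d_gt0 : forall i, (0 < d i)%N.
Hypothesis d_sym : forall i j, (d i)%:Z * A i j = (d j)%:Z * A j i.
Variables (M : comUnitAlgType C) (V : finType) (node : V -> 'I_l) (gam : V -> M).
Variables (T T' : V -> {lrmorphism M -> M}).
Hypothesis TK : forall v u, T v (T' v u) = u.
Hypothesis T'K : forall v u, T' v (T v u) = u.
Hypothesis T_comm : forall v w u, T v (T w u) = T w (T v u).
Local Notation form := (root_form A d).
Local Notation hh := (half_hbar hbar).
Local Notation c i j := (hh (form i j)).
Local Notation s i := (hh (form i i)).
Hypothesis T_gam : forall v w, v != w -> T v (gam w) = gam w.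
Hypothesis T_gamv : forall v, T v (gam v) = gam v - (s (node v))%:A.
Hypothesis gam_unit : forall v w (k : int), v != w ->
  gam v - gam w + (hh k)%:A \is a GRing.unit.
Hypothesis gam_unit1 : forall v (x : C), gam v + x%:A \is a GRing.unit.
Variables (e : 'I_l -> C) (f : V -> V -> M).
Hypothesis e_neq0 : forall i, e i != 0.
Hypothesis f_T : forall u v w, v != w -> u != v -> u != w -> T u (f v w) = f v w.
Hypothesis f_quad : forall v w, v != w ->
  (gam v - gam w - (c (node v) (node w))%:A) * (f v w * T v (f w v))
  = (gam v - gam w + (c (node v) (node w))%:A) * (f w v * T w (f v w)).
Hypothesis f_unit : forall v w, v != w -> f v w \is a GRing.unit.

Section LatticeExtension.
Variables (W : finType) (nodeW : W -> 'I_l).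

Definition lattice := W -> int.
Definition lattice0 : lattice := fun=> 0.
Local Notation F := (fun_alg M lattice0).

(* Distinct [lattice_offset w] differ by a non-integral multiple of [half_hbar hbar 1]. *)
Definition lattice_offset (w : W) : C :=
  'i * hbar / 2%:R * ((enum_rank w).+1%:R / #|W|.+1%:R).

Definition lattice_node (v : V + W) : 'I_l :=
  match v with inl v => node v | inr w => nodeW w end.

Definition lattice_gamma (v : V + W) : F :=
  match v with
  | inl v => fun_cst lattice0 (gam v)
  | inr w => fun n => (lattice_offset w - hh (form (nodeW w) (nodeW w) * n w))%:A
  end.

Definition lattice_bump (w : W) (k : int) (n : lattice) : lattice :=
  fun u => n u + k *+ (u == w).

Definition lattice_shift (v : V + W) : {lrmorphism F -> F} :=
  match v with inl v => fun_map (x0 := lattice0) (T v) | inr w => fun_comp (lattice_bump w 1) end.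

Definition lattice_shift' (v : V + W) : {lrmorphism F -> F} :=
  match v with inl v => fun_map (x0 := lattice0) (T' v) | inr w => fun_comp (lattice_bump w (-1)) end.

Local Notation nodeX := lattice_node.
Local Notation gamX := lattice_gamma.
Local Notation TX := lattice_shift.
Local Notation TX' := lattice_shift'.

Lemma lattice_bumpK w k n : lattice_bump w k (lattice_bump w (- k) n) = n.
Proof. by apply/funext => u; rewrite /lattice_bump mulNrn subrK. Qed.

Lemma lattice_bumpC w w' k k' n :
  lattice_bump w k (lattice_bump w' k' n) = lattice_bump w' k' (lattice_bump w k n).
Proof. by apply/funext => u; rewrite /lattice_bump addrAC. Qed.

Lemma lattice_shiftK v u : TX v (TX' v u) = u.
Proof.
apply/funext => n; case: v => [v|w]; first exact: TK.
by rewrite -[in RHS](lattice_bumpK w (-1) n) opprK.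
Qed.

Lemma lattice_shift'K v u : TX' v (TX v u) = u.
Proof.
apply/funext => n; case: v => [v|w]; first exact: T'K.
by rewrite -[in RHS](lattice_bumpK w 1 n).
Qed.

Lemma lattice_shift_comm v w u : TX v (TX w u) = TX w (TX v u).
Proof.
apply/funext => n; case: v w => [v|v] [w|w] //; first exact: T_comm.
by change (u (lattice_bump w 1 (lattice_bump v 1 n)) = u (lattice_bump v 1 (lattice_bump w 1 n)));
  rewrite lattice_bumpC.
Qed.

Lemma lattice_shift_gamma v w : v != w -> TX v (gamX w) = gamX w.
Proof.
move=> vw; apply/funext => n; case: v w vw => [v|v] [w|w] vw //.
- by apply: T_gam; apply: contraNneq vw => ->.
- exact: rmorph_alg.
- rewrite /= /fun_comp /= /lattice_bump; case: (eqVneq w v) => [wv|_]; first by case/eqP: vw; rewrite wv.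
  by rewrite mulr0n addr0.
Qed.

Lemma lattice_shift_gammav v : TX v (gamX v) = gamX v - (s (nodeX v))%:A.
Proof.
apply/funext => n; case: v => [v|w]; first exact: T_gamv.
rewrite /= /fun_comp /= /lattice_bump eqxx mulr1n mulrDr mulr1 half_hbarD.
change ((lattice_offset w - (hh (form (nodeW w) (nodeW w) * n w) + s (nodeW w)))%:A
 = (lattice_offset w - hh (form (nodeW w) (nodeW w) * n w))%:A - (s (nodeW w))%:A :> M).
by rewrite -scalerBl opprD addrA.
Qed.

(** The ranks differ by less than [#|W|.+1], so their difference divided by it is an integer only if
    it is 0. *)
Lemma lattice_offset_neq w w' (k : int) : w != w' ->
  lattice_offset w - lattice_offset w' + hh k != 0.
Proof.
move=> ww'; rewrite /lattice_offset /half_hbar -mulrBr -mulrDr mulf_neq0 //.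
  by rewrite mulf_neq0 ?i_hbar_neq0 // invr_eq0 pnatr_eq0.
have W0 : #|W|.+1%:R != 0 :> C by rewrite pnatr_eq0.
apply: contraNneq ww' => e0; apply/eqP/enum_rank_inj/val_inj.
have : ((enum_rank w)%:Z - (enum_rank w')%:Z + k * #|W|.+1%:Z)%:~R = 0 :> C.
  rewrite rmorphD rmorphB rmorphM /= -!pmulrn.
  apply: (mulIf (invr_neq0 W0)); rewrite mul0r -[RHS]e0 -!natr1; field.
  by rewrite natr1.
move/eqP; rewrite intr_eq0 => /eqP.
have int_eq (a b N : nat) (z : int) : (a < N)%N -> (b < N)%N ->
    a%:Z - b%:Z + z * N.+1%:Z = 0 -> a = b.
  move=> aN bN e1; have z0 : z = 0 by nia.
  by rewrite z0 in e1; lia.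
exact: int_eq (ltn_ord (enum_rank w)) (ltn_ord (enum_rank w')).
Qed.

Lemma lattice_gamma_unit v w (k : int) : v != w ->
  gamX v - gamX w + (hh k)%:A \is a GRing.unit.
Proof.
move=> vw; apply: fun_alg_unitP => n.
case: v w vw => [v|v] [w|w] vw.
- by apply: gam_unit; apply: contraNneq vw => ->.
- change (gam v - (lattice_offset w - hh (form (nodeW w) (nodeW w) * n w))%:A + (hh k)%:A \is a GRing.unit).
  by rewrite -addrA -scaleNr -scalerDl; exact: gam_unit1.
- set x := lattice_offset v - hh (form (nodeW v) (nodeW v) * n v).
  change (x%:A - gam w + (hh k)%:A \is a GRing.unit); clearbody x.
  have -> : x%:A - gam w + (hh k)%:A = - (gam w + (- x - hh k)%:A).
    by rewrite scalerBl scaleNr; zmod.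
  by rewrite unitrN.
- change ((lattice_offset v - hh (form (nodeW v) (nodeW v) * n v))%:A
    - (lattice_offset w - hh (form (nodeW w) (nodeW w) * n w))%:A + (hh k)%:A \is a @GRing.unit M).
  rewrite -scalerBl -scalerDl; apply: scalar_unit.
  have := @lattice_offset_neq v w (k - form (nodeW v) (nodeW v) * n v
    + form (nodeW w) (nodeW w) * n w).
  rewrite !half_hbarD half_hbarN => H; apply: contraTneq (H _) => [e0|]; last by apply: contraNneq vw => ->.
  by rewrite negbK -e0; apply/eqP; ring.
Qed.

(** Interactions of old and new variables go entirely to the weights of the new ones, so that the
    old weights remain those on M ([lattice_weight_inl]). *)
Definition lattice_factor (v w : V + W) : F :=
  match v, w with
  | inl v, inl w => fun_cst lattice0 (f v w)
  | inl _, inr _ => 1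
  | inr _, inl _ => one_sided_factor hbar A d nodeX gamX v w
  | inr v', inr w' => if (enum_rank w' < enum_rank v')%N
      then one_sided_factor hbar A d nodeX gamX v w else 1
  end.

Local Notation fX := lattice_factor.

Lemma lattice_factor_unit v w : v != w -> fX v w \is a GRing.unit.
Proof.
move=> vw; have U := one_sided_factor_unit A d nodeX lattice_gamma_unit vw.
case: v w vw U => [v|v] [w|w] vw U //=.
- apply: fun_alg_unitP => n; apply: f_unit; by apply: contraNneq vw => ->.
- exact: unitr1.
- by case: ifP => _; rewrite ?unitr1.
Qed.

Lemma lattice_shift_factor u v w : v != w -> u != v -> u != w -> TX u (fX v w) = fX v w.
Proof.
move=> vw uv uw.
have E := T_one_sided_factor A d (nodeX) lattice_shift_gamma lattice_gamma_unit vw uv uw.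
case: v w vw uv uw E => [v|v] [w|w] vw uv uw E //.
- apply/funext => n; case: u uv uw {E} => [u|u] uv uw //.
  apply: f_T; [apply: contraNneq vw|apply: contraNneq uv|apply: contraNneq uw]; by move=> ->.
- exact: rmorph1.
- by rewrite /fX; case: ifP => _ //; exact: rmorph1.
Qed.

Lemma lattice_factor_quad v w : v != w ->
  (gamX v - gamX w - (c (nodeX v) (nodeX w))%:A) * (fX v w * TX v (fX w v))
  = (gamX v - gamX w + (c (nodeX v) (nodeX w))%:A) * (fX w v * TX w (fX v w)).
Proof.
move=> vw.
have P := @one_sided_pair _ _ _ A d A_diag A_le0 d_sym _ _ nodeX gamX TX
  lattice_shift_gamma lattice_shift_gammav lattice_gamma_unit fX v w vw.
case: v w vw P => [v|v] [w|w] vw P.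
- apply/funext => n; apply: f_quad; by apply: contraNneq vw => ->.
- by apply: P; right; split.
- by apply: P; left; split.
- apply: P; rewrite /fX; case: ltngtP => vw'; [by left; split|by right; split|].
  by case/eqP: vw; congr inr; apply/enum_rank_inj/val_inj.
Qed.

Definition lattice_weight : V + W -> F := pair_weight nodeX e fX.

Lemma lattice_weight_inl v : lattice_weight (inl v) = fun_cst lattice0 (pair_weight node e f v).
Proof.
rewrite /lattice_weight /pair_weight linearZ /=; congr (_ *: _).
rewrite big_sumType /= [X in _ * X]big1 ?mulr1 // rmorph_prod.
by apply: eq_bigl => w; rewrite (inj_eq (@inl_inj V W)).
Qed.

Variable R : 'I_l -> {poly C}.
Hypothesis R_monic : forall i, R i \is monic.

Lemma lattice_sum_A i :
  \sum_v A (nodeX v) i = \sum_v A (node v) i + \sum_w A (nodeW w) i.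
Proof. by rewrite big_sumType. Qed.

Hypothesis R_size : forall i,
  ((size (R i)).-1)%:Z = \sum_v A (node v) i + \sum_w A (nodeW w) i.

Definition lattice_H_coef := H_coef hbar A d nodeX gamX R.

(* At [lattice0] the extra variables multiply [H_i(u)] by
   [lattice_numerator i / lattice_denominator i]. *)
Definition lattice_numerator i : {poly C} := \prod_(w | nodeW w != i)
  \prod_(1 <= r < (absz (A (nodeW w) i)).+1)
    ('X - (lattice_offset w + hh (form i (nodeW w) + r%:Z * form (nodeW w) (nodeW w)))%:P).

Definition lattice_denominator i : {poly C} := \prod_(w | nodeW w == i)
  (('X - (lattice_offset w)%:P) * ('X - (lattice_offset w + s i)%:P)).

Lemma lattice_numerator_monic i : lattice_numerator i \is monic.
Proof. by apply: monic_prod => w _; exact: monic_prod_XsubC. Qed.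

Lemma lattice_denominator_monic i : lattice_denominator i \is monic.
Proof. by apply: monic_prod => w _; rewrite monicMl monicXsubC. Qed.

Lemma lattice_size_diff i : (size (lattice_denominator i)).-1%:Z
  = (size (lattice_numerator i)).-1%:Z + \sum_w A (nodeW w) i.
Proof.
have sumz (P : pred W) (G : W -> nat) : (\sum_(v | P v) G v)%N%:Z = \sum_(v | P v) (G v)%:Z.
  exact: (big_morph Posz PoszD (erefl (Posz 0))).
rewrite !size_prod_monic => [|w _|w _]; last 2 first.
- exact: monic_prod_XsubC.
- by rewrite monicMl monicXsubC.
rewrite (bigID (fun w => nodeW w == i) xpredT) /= addrCA !sumz -big_split /=.
rewrite [X in _ = _ + X]big1 => [|w wi].
  rewrite addr0; apply: eq_bigr => w /eqP->.
  by rewrite A_diag size_monicM ?monicXsubC ?polyXsubC_eq0 // !size_XsubC.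
by rewrite size_prod_XsubC size_iota subSS subn0 /= abszE ler0_norm ?addNr // A_le0.
Qed.

Local Notation ev0 := (fun_eval (x0 := lattice0) (M := M) lattice0).

Lemma lattice_eval_gamma w (x : C) :
  ev0 (gamX (inr w) + x%:A) = (lattice_offset w + x)%:A.
Proof.
change ((lattice_offset w - hh (form (nodeW w) (nodeW w) * 0))%:A + x%:A
  = (lattice_offset w + x)%:A :> M).
by rewrite mulr0 /half_hbar mulr0 subr0 scalerDl.
Qed.

Lemma lattice_eval_numerator i :
  map_poly ev0 (H_numerator hbar A d nodeX gamX R i)
  = H_numerator hbar A d node gam R i * map_poly (in_alg M) (lattice_numerator i).
Proof.
rewrite rmorphM /= -map_poly_comp rmorph_prod /H_numerator -mulrA; congr (_ * _).
rewrite big_sumType /=; congr (_ * _).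
  apply: eq_bigr => v _; rewrite rmorph_prod; apply: eq_bigr => r _ /=.
  by rewrite map_XsubC.
rewrite rmorph_prod; apply: eq_bigr => w _; rewrite !rmorph_prod; apply: eq_bigr => r _ /=.
by rewrite !map_XsubC; congr ('X - _%:P); exact: lattice_eval_gamma.
Qed.

Lemma lattice_eval_denominator i :
  map_poly ev0 (H_denominator hbar A d nodeX gamX i)
  = H_denominator hbar A d node gam i * map_poly (in_alg M) (lattice_denominator i).
Proof.
rewrite rmorph_prod big_sumType /=; congr (_ * _).
  by apply: eq_bigr => v _; rewrite rmorphM /= !map_XsubC.
rewrite rmorph_prod; apply: eq_bigr => w _.
rewrite [LHS]rmorphM [RHS]rmorphM /= !map_XsubC.
congr (_ * _); congr ('X - _%:P); last exact: lattice_eval_gamma.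
by have := lattice_eval_gamma w 0; rewrite scale0r !addr0.
Qed.

(** The two fractions differ by Phi / D times the remainder over [Rd * lattice_denominator i]. The
    degree of D exceeds that of Phi by the sum over v, and that of the lattice denominator exceeds
    that of the lattice numerator by the sum over w; hence the order in 1/u is larger than their
    total. *)
Lemma lattice_H_coef_close (Rn Rd : {poly C}) i (h : nat -> M) N :
  Rn \is monic -> Rd \is monic ->
  (size Rn).-1%:Z = (size Rd).-1%:Z + \sum_v A (node v) i ->
  is_expansion (H_numerator hbar A d node gam (fun=> Rn) i)
    (map_poly (in_alg M) Rd * H_denominator hbar A d node gam i) h ->
  (size (Rn * lattice_denominator i - R i * (Rd * lattice_numerator i))%R
    < size (Rd * lattice_numerator i)%R)%N ->
  N%:Z <= \sum_v A (node v) i + \sum_w A (nodeW w) i ->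
  forall k, (k < N)%N -> h k = lattice_H_coef i k lattice0.
Proof.
move=> mRn mRd sR hexp srem LN.
set Phi := \prod_(v | node v != i) H_factor hbar A d node gam i v.
have mPhi : Phi \is monic by apply: monic_prod => v _; exact: H_factor_monic.
set D := H_denominator hbar A d node gam i.
have mD : D \is monic by exact: H_denominator_monic.
have mX : H_denominator hbar A d nodeX gamX i \is monic by exact: H_denominator_monic.
have mN := lattice_numerator_monic i; have mQ := lattice_denominator_monic i.
have mapm (p : {poly C}) : p \is monic -> map_poly (in_alg M) p \is monic by exact: monic_map.
have hX : is_expansion (map_poly ev0 (H_numerator hbar A d nodeX gamX R i))
    (map_poly ev0 (H_denominator hbar A d nodeX gamX i)) (fun k => lattice_H_coef i k lattice0).
  apply: (map_expansion ev0 mX); apply: H_expansion => //.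
  - exact: lattice_gamma_unit.
  - by move=> j; rewrite R_size lattice_sum_A.
rewrite lattice_eval_numerator lattice_eval_denominator in hX.
apply: (expansion_close _ _ hexp hX); rewrite ?monicMl ?mapm //.
have -> : H_numerator hbar A d node gam (fun=> Rn) i * (D * map_poly (in_alg M) (lattice_denominator i))
   - H_numerator hbar A d node gam R i * map_poly (in_alg M) (lattice_numerator i)
     * (map_poly (in_alg M) Rd * D)
   = Phi * D * map_poly (in_alg M) (Rn * lattice_denominator i - R i * (Rd * lattice_numerator i)).
  by rewrite /H_numerator -/Phi rmorphB !rmorphM /=; ring.
have sz1 (p : {poly M}) : p \is monic -> (0 < size p)%N.
  by move=> mp; rewrite lt0n size_poly_eq0 monic_neq0.
have sz2 (p : {poly C}) : p \is monic -> (0 < size p)%N.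
  by move=> mp; rewrite lt0n size_poly_eq0 monic_neq0.
have e1 : (size D).-1%:Z = (size Phi).-1%:Z + \sum_v A (node v) i by exact: H_size_diff.
have e2 := lattice_size_diff i.
have sm : (size (map_poly (in_alg M) (Rn * lattice_denominator i - R i * (Rd * lattice_numerator i)))
    <= size (Rn * lattice_denominator i - R i * (Rd * lattice_numerator i))%R)%N.
  by apply/leq_sizeP => j sj; rewrite coef_map /= (@leq_sizeP _ _ _ (leqnn _) j sj) scale0r.
move: srem sm; set rem := (_ - _)%R => srem sm.
rewrite [size (Rd * _)]size_monicM ?monic_neq0 // in srem.
have sPD := size_monicM mPhi (monic_neq0 mD).
have sl := size_polyMleq (Phi * D) (map_poly (in_alg M) rem).
have sq : size (map_poly (in_alg M) Rd * D * (D * map_poly (in_alg M) (lattice_denominator i)))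
   = ((size Rd).-1 + (size D).-1 + (size D).-1 + (size (lattice_denominator i)).-1).+1%N.
  rewrite !size_monicM ?monicMl ?mapm ?monic_neq0 ?monicMl ?mapm // !size_map_poly_monic //.
  have sizes (x y z : nat) : (0 < x)%N -> (0 < y)%N -> (0 < z)%N ->
    ((x + y).-1 + (y + z).-1).-1 = (x.-1 + y.-1 + y.-1 + z.-1).+1%N.
    by case: x y z => [|x] [|y] [|z] // _ _ _; rewrite !addSn !addnS /=; lia.
  by apply: sizes; [exact: sz2|exact: sz1|exact: sz2].
rewrite sq; apply: leq_trans (leq_add sl (leqnn N)) _; rewrite sPD.
(* The letters are sizes: a of Rn, b of Rd, c' of D, e' of Phi, g' and h' of the lattice denominator
   and numerator, r and r' of the remainder over C and over M. *)
have final (a b c' e' g' h' r r' : nat) (Lv Lw : int) :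
  (0 < e')%N -> (0 < h')%N -> (0 < a)%N -> (0 < g')%N -> (0 < b)%N -> (0 < c')%N ->
  N%:Z <= Lv + Lw ->
  a.-1%:Z = b.-1%:Z + Lv -> c'.-1%:Z = e'.-1%:Z + Lv -> g'.-1%:Z = h'.-1%:Z + Lw ->
  (r < (b + h').-1)%N -> (r' <= r)%N ->
  (((e' + c').-1 + r').-1 + N <= (b.-1 + c'.-1 + c'.-1 + g'.-1).+1)%N.
  case: e' => // e' _; case: h' => // h' _; case: a => // a _; case: g' => // g' _.
  by case: b => // b _; case: c' => // c' _; rewrite !addSn !addnS /=; lia.
apply: final LN sR e1 e2 srem sm;
  [exact: sz1|exact: sz2|exact: sz2|exact: sz2|exact: sz2|exact: sz1].
Qed.

(* Functions on the lattice vanishing at the points with a positive coordinate: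
   the shifts of the extra variables act by zero on their values at [lattice0]. *)
Definition lattice_supported (u : F) := forall n : lattice, (exists w, 0 < n w) -> u n = 0.

Theorem lattice_approximation :
  exists psi : yangian hbar A d -> lin_op F,
  [/\ algebra_morphism psi, forall i n u, lattice_supported u -> lattice_supported (psi (yH hbar A d i n) u) /\
        psi (yH hbar A d i n) u lattice0 = lattice_H_coef i n.+1 lattice0 * u lattice0 &
      forall i n u, lattice_supported u -> lattice_supported (psi (yE hbar A d i n) u) /\
        psi (yE hbar A d i n) u lattice0
        = current gam T (pair_weight node e f) (fun v => node v == i) n (u lattice0)].
Proof.
have [|psi [psi1 psiM psiD [psiH psiE psiF]]] := difference_representation hbar_neq0 A_diag A_le0
  d_gt0 d_sym lattice_shiftK lattice_shift'K lattice_shift_comm lattice_shift_gamma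
  lattice_shift_gammav lattice_gamma_unit
  (pair_weight_unit nodeX lattice_factor_unit e_neq0)
  (pair_weight_quad e lattice_shift_factor lattice_factor_quad) R_monic.
  by move=> i; rewrite R_size lattice_sum_A.
exists psi; split=> [|i n u Uu|i n u Uu]; first by split.
  have -> : psi (yH hbar A d i n) = mul_op (lattice_H_coef i n.+1) := psiH i n.+1.
  by split=> // k kw; change (lattice_H_coef i n.+1 k * u k = 0); rewrite Uu // mulr0.
have E k : psi (yE hbar A d i n) u k = \sum_(v | node v == i)
    pair_weight node e f v * gam v ^+ n * T v (u k)
  + \sum_(w | nodeW w == i) (lattice_weight (inr w) * gamX (inr w) ^+ n) k * u (lattice_bump w 1 k).
  rewrite psiE /E_current /current lin_op_sumE big_sumType.
  rewrite [LHS](rmorphD (fun_eval k)) !(rmorph_sum (fun_eval k)); congr (_ + _).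
  apply: eq_bigr => v _; rewrite -[pair_weight _ _ _ v]/(fun_cst lattice0 _ k).
  have -> : pair_weight nodeX e fX (inl v) = fun_cst lattice0 (pair_weight node e f v).
    exact: lattice_weight_inl.
  rewrite [LHS](rmorphM (fun_eval k)) (rmorphM (fun_eval k)) (rmorphXn (fun_eval k)).
  by [].
split=> [k [w kw]|].
  (* Shifts of old variables do not move the lattice point, and a bump by 1 keeps a positive
     coordinate positive. *)
  rewrite E big1 ?add0r => [|v _]; last by rewrite Uu ?rmorph0 ?mulr0 //; exists w.
  rewrite big1 // => w' _; rewrite Uu ?mulr0 //; exists w.
  by rewrite /lattice_bump; case: (w == w'); rewrite ?mulr1n ?mulr0n; lia.
rewrite E [X in _ + X]big1 ?addr0 => [|w _].
  by rewrite /current lin_op_sumE.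
by rewrite Uu ?mulr0 //; exists w; rewrite /lattice_bump eqxx.
Qed.

End LatticeExtension.

Hypothesis A_positive : exists m : 'I_l -> nat, forall i, 0 < \sum_j (m j)%:Z * A j i.

Lemma exists_large_lattice N : exists m : 'I_l -> nat, forall i,
  N%:Z <= \sum_v A (node v) i + \sum_(w : {i : 'I_l & 'I_(m i)}) A (tag w) i.
Proof.
have [mp mp_gt0] := A_positive.
(* The sums over [mp] are at least 1, so K copies outweigh a negative sum over v and leave at least
   N. *)
pose K := (N + \sum_i absz (\sum_v A (node v) i)%R)%N.
exists (fun j => K * mp j)%N => i; rewrite (sum_tag_A A).
have -> : \sum_j (K * mp j)%N%:Z * A j i = K%:Z * \sum_j (mp j)%:Z * A j i.
  by rewrite mulr_sumr; apply: eq_bigr => j _; rewrite PoszM mulrA.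
have := mp_gt0 i; set t := \sum_j _ => t0.
have : (absz (\sum_v A (node v) i)%R + N <= K)%N.
  by rewrite /K addnC leq_add2l (bigD1 i) //= leq_addr.
set x := \sum_v _ => xK; have Kt : K%:Z <= K%:Z * t by nia.
by lia.
Qed.

Theorem borel_difference_representation (Rn Rd : 'I_l -> {poly C}) :
  (forall i, Rn i \is monic) -> (forall i, Rd i \is monic) ->
  (forall i, (size (Rn i)).-1%:Z = (size (Rd i)).-1%:Z + \sum_v A (node v) i) ->
  exists (h : 'I_l -> nat -> M) (phi : yangian hbar A d -> M -> M),
  [/\ algebra_action (@yangian_borel _ hbar l A d) phi,
      forall i, is_expansion (H_numerator hbar A d node gam Rn i)
        (map_poly (in_alg M) (Rd i) * H_denominator hbar A d node gam i) (h i),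
      forall i n u, phi (H_series (yH hbar A d) i n) u = h i n * u
    & forall i n u, phi (yE hbar A d i n) u
        = current gam T (pair_weight node e f) (fun v => node v == i) n u].
Proof.
move=> mRn mRd sR; set Hn := H_numerator hbar A d node gam Rn.
pose Hd i := map_poly (in_alg M) (Rd i) * H_denominator hbar A d node gam i.
have mRnM i : map_poly (in_alg M) (Rn i) \is monic by exact: monic_map.
have mRdM i : map_poly (in_alg M) (Rd i) \is monic by exact: monic_map.
have mD i : H_denominator hbar A d node gam i \is monic by exact: H_denominator_monic.
have mP i : \prod_(v | node v != i) H_factor hbar A d node gam i v \is monic.
  by apply: monic_prod => v _; exact: H_factor_monic.
have mHn i : Hn i \is monic by exact: H_numerator_monic.
have mHd i : Hd i \is monic by rewrite monicMl.
have sH i : size (Hn i) = size (Hd i).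
  rewrite -[LHS]predn_size_monic // -[RHS]predn_size_monic //; congr _.+1.
  apply/eqP; rewrite -eqz_nat !size_pred_monicM // !size_map_poly_monic //.
  rewrite !PoszD sR (H_size_diff hbar d A_diag A_le0).
  by apply/eqP; ring.
have /all_sig[h hE] i : {h | is_expansion (Hn i) (Hd i) h}.
  by apply: cid; apply: expansion_exists; rewrite ?sH.
have h0 i : h i 0%N = 1 := expansion0 (mHn i) (mHd i) (sH i) (hE i).
pose X i := current gam T (pair_weight node e f) (fun v => node v == i).
have [|phi [phiA phiH phiE]] := @borel_representation C hbar l A d M h X; last first.
  exists h, phi; split=> // i [|n] u; last exact: phiH.
  by rewrite h0 mul1r; case: phiA.
(* [N.+1] because H_i^(n) is the coefficient of index n + 1 of H_i(u). *)
move=> N; have [m m_large] := exists_large_lattice N.+1.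
pose W := {i : 'I_l & 'I_(m i)}; pose nodeW (w : W) := tag w.
pose num i := Rd i * lattice_numerator nodeW i.
pose den i := Rn i * lattice_denominator nodeW i.
have mnum i : num i \is monic by rewrite monicMl // lattice_numerator_monic.
have mden i : den i \is monic by rewrite monicMl // lattice_denominator_monic.
have sz i : (size (den i)).-1%:Z = (size (num i)).-1%:Z +
    (\sum_v A (node v) i + \sum_w A (nodeW w) i).
  rewrite !size_pred_monicM ?lattice_numerator_monic ?lattice_denominator_monic //.
  rewrite !PoszD sR lattice_size_diff; ring.
have num_le i : (size (num i) <= size (den i))%N.
  have mi : N.+1%:Z <= \sum_v A (node v) i + \sum_w A (nodeW w) i by exact: m_large.
  by move: mi (sz i); rewrite -(predn_size_monic (mnum i)) -(predn_size_monic (mden i)); lia.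
(* For the new H_i to be exactly the given one, R_i would have to be the fraction [den i] over
   [num i]; its polynomial part is taken. *)
pose R i := den i %/ num i.
have mR i : R i \is monic by exact: divp_monic.
have szR i : (size (R i)).-1%:Z = \sum_v A (node v) i + \sum_w A (nodeW w) i.
  have := sz i; have := num_le i; rewrite size_divp ?monic_neq0 //.
  by rewrite -(predn_size_monic (mnum i)) -(predn_size_monic (mden i)) /=; lia.
have [psi [psiA psiH psiE]] := lattice_approximation mR szR.
(* The function concentrated at the origin is a supported preimage of x under evaluation. *)
pose u (x : M) : fun_alg M (lattice0 (W := W)) := fun n => if `[< forall w, n w = 0 >] then x else 0.
exists _, (@lattice_supported W), (fun_eval (x0 := lattice0 (W := W)) (M := M) (lattice0 (W := W))), psi.
split=> //.
- move=> a u1 u2 S1 S2 n nw; change (a *: u1 n + u2 n = 0).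
  by rewrite S1 // S2 // scaler0 addr0.
- move=> x; exists (u x) => [n [w nw]|].
    by rewrite /u asboolF // => /(_ w) nw0; rewrite nw0 in nw.
  by change (u x (lattice0 (W := W)) = x); rewrite /u asboolT.
- move=> i n nN u0 /(psiH i n)[S1 e1]; split=> //; rewrite [LHS]e1; congr (_ * _).
  have srem : (size (den i - R i * num i)%R < size (num i))%N.
    by rewrite {1}(divp_eq (den i) (num i)) addrAC subrr add0r ltn_modp monic_neq0.
  exact/esym/(lattice_H_coef_close mR szR (mRn i) (mRd i) (sR i) (hE i) srem (m_large i)).
Qed.

End BorelDifferenceRepresentation.

Theorem mero_borel_representation (C : numClosedFieldType) (hbar : C) (l : nat)
  (A : 'M[int]_l) (d m : 'I_l -> nat) (Rn Rd : 'I_l -> {poly C}) :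
  hbar != 0 -> (forall i, A i i = 2) -> (forall i j, i != j -> A i j <= 0) ->
  (forall i, (0 < d i)%N) -> (forall i j, (d i)%:Z * A i j = (d j)%:Z * A j i) ->
  (exists mp : 'I_l -> nat, forall i, 0 < \sum_j (mp j)%:Z * A j i) ->
  (forall i, Rn i \is monic) -> (forall i, Rd i \is monic) ->
  (forall i, (size (Rn i)).-1%:Z = (size (Rd i)).-1%:Z + \sum_j (m j)%:Z * A j i) ->
  exists phi : yangian hbar A d -> mero C (nvars m) -> mero C (nvars m),
    represents_HE Rn Rd (@yangian_borel _ hbar l A d) phi.
Proof.
move=> hbar_neq0 A_diag A_le0 d_gt0 d_sym A_pos mRn mRd sR.
have [|h [phi [phiA hE phiH phiE]]] := borel_difference_representation hbar_neq0 A_diag A_le0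
  d_gt0 d_sym (@mero_shiftK C hbar l A d m) (@mero_shift'K C hbar l A d m)
  (@mero_shift_comm C hbar l A d m) (@mero_shift_gamma C hbar l A d m)
  (@mero_shift_gammav C hbar l A d m) (@mero_gamma_unit C hbar l m)
  (fun v x => mero_coord_scalar_unit (enum_rank v) x)
  (inv_sqrt_d_neq0 C d_gt0) (@mero_shift_factor C hbar l A d m)
  (@mero_factor_quad C hbar l A d m A_diag A_le0 d_sym) (@mero_factor_unit C hbar l A d m) A_pos mRn mRd.
  by move=> i; rewrite sR sum_tag_A.
exists phi; split=> // [i|i n u].
  by exists (h i) => //; rewrite H_numE H_denE.
by rewrite phiE E_opE.
Qed.

Theorem theorem3p1 (R : realType) (hbar : R[i]) (hbar_neq0 : hbar != 0)
  (l : nat) (g : vectType R[i]) (br : g -> g -> g)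
  (br_lie : lie_bracket br) (g_simple : lie_simple br)
  (h b : {vspace g})
  (h_cartan : cartan_subalgebra br h) (b_borel : borel_subalgebra br b)
  (h_sub_b : (h <= b)%VS)
  (alpha : l.-tuple 'Hom(subvs_of h, R[i]^o))
  (alpha_simple : simple_roots br b alpha)
  (alphav : 'I_l -> subvs_of h)
  (alphav_coroot : forall i, is_coroot br (tnth alpha i) (alphav i))
  (A : 'M[int]_l)
  (A_cartan : forall i j, (A i j)%:~R = tnth alpha j (alphav i) :> R[i])
  (d : 'I_l -> nat) (d_gt0 : forall i, (0 < d i)%N)
  (d_sym : forall i j, (d i)%:Z * A i j = (d j)%:Z * A j i)
  (m : 'I_l -> nat) (m_gt0 : forall i, (0 < m i)%N) :
  (forall (n : 'I_l -> nat) (nu : forall i, 'I_(n i) -> R[i]),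
     (forall i, (n i)%:Z = \sum_j (m j)%:Z * A j i) ->
     let Rn i := \prod_(k < n i) ('X - (nu i k)%:P) in
     let Rd i := 1 in
     exists phi : yangian hbar A d -> mero R[i] (nvars m) -> mero R[i] (nvars m),
       represents_HE Rn Rd (fun _ => True) phi /\
       forall i s f, phi (yF hbar A d i s) f = F_op hbar A d Rn Rd i s f)
  /\
  (forall (np nm : 'I_l -> nat) (nup : forall i, 'I_(np i) -> R[i])
      (num : forall i, 'I_(nm i) -> R[i]),
     (forall i, (np i)%:Z - (nm i)%:Z = \sum_j (m j)%:Z * A j i) ->
     let Rn i := \prod_(k < np i) ('X - (nup i k)%:P) in
     let Rd i := \prod_(k < nm i) ('X - (num i k)%:P) in
     exists phi : yangian hbar A d -> mero R[i] (nvars m) -> mero R[i] (nvars m),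
       represents_HE Rn Rd (@yangian_borel _ hbar l A d) phi).
Proof.
(* These three facts on the Cartan matrix are what the structure of g contributes. *)
have A_diag := A_diag alphav_coroot A_cartan.
have A_le0 := A_offdiag_le0 br_lie alpha_simple alphav_coroot A_cartan.
have A_pos := exists_positive_combination br_lie alpha_simple alphav_coroot A_cartan d_gt0 d_sym.
have monic_R k (nu : 'I_k -> R[i]) : \prod_(i < k) ('X - (nu i)%:P) \is monic.
  exact: monic_prod_XsubC.
have size_R k (nu : 'I_k -> R[i]) : (size (\prod_(i < k) ('X - (nu i)%:P))%R).-1 = k.
  by rewrite size_prod_XsubC /= /index_enum -enumT size_enum_ord.
split=> [n nu n_eq|np nm nup num n_eq] Rn Rd.
  apply: mero_yangian_representation => // i; first exact: monic_R.
  by rewrite -n_eq; congr Posz; exact: size_R.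
apply: mero_borel_representation => // i; [exact: monic_R|exact: monic_R|].
have -> : (size (Rn i)).-1 = np i by exact: size_R.
have -> : (size (Rd i)).-1 = nm i by exact: size_R.
by rewrite -n_eq addrC subrK.
Qed.
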